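(* Let $n>2$, $q>2^*$ and $f(u,r)=K(r)\,u|u|^{q-2}$, where $h$ satisfies (H) and $K$ satisfies (K) (see context). Set $l_u=l(q,\delta_0)$ and $l_s=l(q,\delta_\infty)$, and assume $2_*(\eta)<l_u<{\rm I}(\eta)$ and $2^*<l_s<{\rm I}(\beta)$. Consider the equation $$u''+\frac{n-1}{r}u'+\frac{h(r)}{r^2}u+f(u,r)=0 .$$ Then there is an increasing sequence $(A_k)_{k\ge 0}$ of positive numbers such that $u(r,A_k)$ is an $R_kf$-solution for every $k\geq 0$. Moreover $u(r,d)$ is an $R_0s$-solution for any $0<d<A_0$, and for every $k\ge1$ there is $A_k^*\in[A_{k-1},A_k)$ such that $u(r,d)$ is an $R_ks$-solution whenever $A_k^*<d<A_k$.
   Context: Condition (H): $h:(0,\infty)\to\mathbb R$ is differentiable, $h(r)<\frac{(n-2)^2}{4}$ for every $r>0$; $\lim_{r\to0}h(r)=\eta<\frac{(n-2)^2}{4}$ and $\frac{h(r)-\eta}{r}\in L^1(0,1]$; $\lim_{r\to\infty}h(r)=\beta<\frac{(n-2)^2}{4}$ and $\frac{h(r)-\beta}{r}\in L^1[1,\infty)$. Condition (K): $K:(0,\infty)\to\mathbb R$ is $C^1$ and there is $R>0$ with $K(r)<0$ for $0<r<R$ and $K(r)>0$ for $r>R$. Moreover $K(r)=k_0r^{\delta_0}+o(r^{\delta_0})$ as $r\to0$ and $K(r)=k_\infty r^{\delta_\infty}+o(r^{\delta_\infty})$ as $r\to\infty$, with constants $k_0<0<k_\infty$ and $\delta_0,\delta_\infty>-2$;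 and there is $\varpi>0$ (small) with $\lim_{r\to0}r^{-\varpi}\frac{d}{dr}[K(r)r^{-\delta_0}]=0$ and $\lim_{r\to\infty}r^{\varpi}\frac{d}{dr}[K(r)r^{-\delta_\infty}]=0$. Constants: $2^*=\frac{2n}{n-2}$, $l(q,\delta)=2\frac{q+\delta}{2+\delta}$. For $\eta<\frac{(n-2)^2}{4}$: $2_*(\eta)=2\frac{n+\sqrt{(n-2)^2-4\eta}}{n-2+\sqrt{(n-2)^2-4\eta}}$; ${\rm I}(\eta)=+\infty$ if $\eta\le0$ and ${\rm I}(\eta)=2\frac{n-\sqrt{(n-2)^2-4\eta}}{n-2-\sqrt{(n-2)^2-4\eta}}$ if $0<\eta<\frac{(n-2)^2}{4}$; $\kappa(\eta)=\frac{(n-2)-\sqrt{(n-2)^2-4\eta}}{2}$. The same formulas with $\beta$ in place of $\eta$. Solutions. For $d\in\mathbb R$, $u(r,d)$ denotes the unique solution with $\lim_{r\to0}u(r,d)r^{\kappa(\eta)}=d$; such solutions are called R-solutions. A solution $u$ is a fast decay solution (fd) if $\lim_{r\to\infty}u(r)r^{n-2-\kappa(\beta)}=L\in\mathbb R$, and a slow decay solution (sd) if $\lim_{r\to\infty}u(r)r^{n-2-\kappa(\beta)}=\pm\infty$. An $R_kf$-solution (resp. $R_ks$-solution) is a solution that is both an R-solution and fd (resp. an R-solution and sd) and has exactly $k$ zeros in $(0,\infty)$, all nondegenerate. *)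

(* Defs.v *)
From HB Require Import structures.
From mathcomp Require Import all_boot all_order all_algebra.
From mathcomp Require Import all_classical all_reals all_analysis.

Set Implicit Arguments.
Unset Strict Implicit.
Unset Printing Implicit Defensive.

Import Order.TTheory GRing.Theory Num.Theory.
Import numFieldNormedType.Exports.

Local Open Scope ring_scope.
Local Open Scope classical_set_scope.

(* Functions on (0, +oo) are represented by total functions R -> R; every
   condition below only involves their values at positive arguments. The
   dimension n is a real parameter. *)

Definition crit_exp {R : realType} (n : R) : R := 2 * n / (n - 2).

Definition l_exp {R : realType} (q delta : R) : R :=
  2 * ((q + delta) / (2 + delta)).

Definition sub_exp {R : realType} (n eta : R) : R :=
  2 * ((n + Num.sqrt ((n - 2) ^+ 2 - 4 * eta)) /
       (n - 2 + Num.sqrt ((n - 2) ^+ 2 - 4 * eta))).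

Definition I_exp {R : realType} (n eta : R) : \bar R :=
  if eta <= 0 then +oo%E
  else (2 * ((n - Num.sqrt ((n - 2) ^+ 2 - 4 * eta)) /
             (n - 2 - Num.sqrt ((n - 2) ^+ 2 - 4 * eta))))%:E.

Definition kappa {R : realType} (n eta : R) : R :=
  (n - 2 - Num.sqrt ((n - 2) ^+ 2 - 4 * eta)) / 2.

(* The little-o notation infers a filter_on structure, which the library does
   not declare for pinfty_nbhs. *)
Canonical pinfty_filter_on (R : realType) : filter_on R :=
  FilterType (pinfty_nbhs R) (@proper_pinfty_nbhs R).

Record cond_H {R : realType} (n eta beta : R) (h : R -> R) : Prop := {
  H_diff : forall r : R, 0 < r -> derivable h r 1;
  H_lt : forall r : R, 0 < r -> h r < (n - 2) ^+ 2 / 4;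
  H_lim0 : h r @[r --> 0^'+] --> eta;
  H_eta : eta < (n - 2) ^+ 2 / 4;
  H_int0 : (@lebesgue_measure R).-integrable `]0, 1]
             (fun r => ((h r - eta) / r)%:E);
  H_limoo : h r @[r --> +oo] --> beta;
  H_beta : beta < (n - 2) ^+ 2 / 4;
  H_intoo : (@lebesgue_measure R).-integrable `[1, +oo[
              (fun r => ((h r - beta) / r)%:E) }.

Record cond_K {R : realType} (delta0 deltaoo : R) (K : R -> R) : Prop := {
  K_diff : forall r : R, 0 < r -> derivable K r 1;
  K_C1 : forall r : R, 0 < r -> {for r, continuous (derive1 K)};
  K_sign : exists2 r0 : R, 0 < r0 &
    (forall r : R, 0 < r -> r < r0 -> K r < 0) /\ (forall r : R, r0 < r -> 0 < K r);
  K_delta0 : -2 < delta0;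
  K_deltaoo : -2 < deltaoo;
  K_asym0 : exists2 k0 : R, k0 < 0 &
    forall r : R, K r = k0 * r `^ delta0 +o_(r \near 0^'+) (r `^ delta0);
  K_asymoo : exists2 koo : R, 0 < koo &
    forall r : R, K r = koo * r `^ deltaoo +o_(r \near +oo) (r `^ deltaoo);
  K_deriv : exists2 w : R, 0 < w &
    r `^ (- w) * derive1 (fun s => K s * s `^ (- delta0)) r @[r --> 0^'+] --> 0 /\
    r `^ w * derive1 (fun s => K s * s `^ (- deltaoo)) r @[r --> +oo] --> 0 }.

Definition power_nonlin {R : realType} (q : R) (K : R -> R) (u r : R) : R :=
  K r * (u * `|u| `^ (q - 2)).

(* u solves the equation on (0, T); T = +oo is a solution on the half line. *)
Definition solution_on {R : realType} (n : R) (h : R -> R) (f : R -> R -> R)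
    (T : \bar R) (u : R -> R) : Prop :=
  forall r : R, 0 < r -> (r%:E < T)%E ->
    [/\ derivable u r 1, derivable (derive1 u) r 1 &
        derive1 (derive1 u) r + (n - 1) / r * derive1 u r + h r / r ^+ 2 * u r
          + f (u r) r = 0].

Definition R_limit {R : realType} (n eta d : R) (u : R -> R) : Prop :=
  u r * r `^ kappa n eta @[r --> 0^'+] --> d.

Definition R_solution {R : realType} (n eta : R) (u : R -> R) : Prop :=
  exists d, R_limit n eta d u.

Definition fast_decay {R : realType} (n beta : R) (u : R -> R) : Prop :=
  exists L : R, u r * r `^ (n - 2 - kappa n beta) @[r --> +oo] --> L.

Definition slow_decay {R : realType} (n beta : R) (u : R -> R) : Prop :=
  u r * r `^ (n - 2 - kappa n beta) @[r --> +oo] --> +oo \/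
  u r * r `^ (n - 2 - kappa n beta) @[r --> +oo] --> -oo.

Definition nondeg_zeros {R : realType} (k : nat) (u : R -> R) : Prop :=
  ([set r : R | 0 < r /\ u r = 0] #= `I_k)%card /\
  (forall r : R, 0 < r -> u r = 0 -> derive1 u r != 0).

Definition Rkf_solution {R : realType} (n eta beta : R) (h : R -> R)
    (f : R -> R -> R) (k : nat) (u : R -> R) : Prop :=
  [/\ solution_on n h f +oo%E u, R_solution n eta u, fast_decay n beta u &
      nondeg_zeros k u].

Definition Rks_solution {R : realType} (n eta beta : R) (h : R -> R)
    (f : R -> R -> R) (k : nat) (u : R -> R) : Prop :=
  [/\ solution_on n h f +oo%E u, R_solution n eta u, slow_decay n beta u &
      nondeg_zeros k u].

(* "u is the solution u(., d)": it is defined on all of (0, +oo), and any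
   solution with the same d, even if it is only defined on some (0, T),
   coincides with u there. For some d the solution may blow up at a finite r
   (K is negative near 0); then no u satisfies this predicate. *)
Definition the_solution {R : realType} (n eta : R) (h : R -> R)
    (f : R -> R -> R) (d : R) (u : R -> R) : Prop :=
  [/\ solution_on n h f +oo%E u, R_limit n eta d u &
      forall (T : \bar R) (v : R -> R), (0 < T)%E ->
        solution_on n h f T v -> R_limit n eta d v ->
        forall r : R, 0 < r -> (r%:E < T)%E -> v r = u r].

(* Main.v *)
(* In logarithmic time [t = ln r] the function [y t = r^m u(r)], [m = (n-2)/2], satisfies
   [y'' = a y - b y |y|^p] with [p = q - 2], [a = m^2 - h(e^t)], [b = K(e^t) e^((2 - m p) t)].
   Here [a] tends to [l0^2] at [-oo] and to [l1^2] at [+oo], both integrably, [b] changes sign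
   once, from [-] to [+], at [t0], and [b e^(p gam t)] has a positive limit with
   [0 < gam < l1].  R-solutions are those for which [e^(- l0 t) y] has a limit [d] at [-oo].

   Before [t0] such a solution is increasing and [e^(- l0 t) (l0 y + y')] is almost
   nondecreasing, so [d] is bounded by the phase at [t0]; after [t0] a large phase forces
   many zeros by Sturm comparison.  Hence the set of [d] for which the solution exists and
   has fewer than [k] zeros is bounded, and it is closed.

   At [+oo] the variable [x = e^(- gam t) y] satisfies an equation asymptotic to
   [x'' + 2 gam x' + kap x |x|^p - c x = 0], which has a saddle at [0] and sinks at [P], [- P].  A
   Lyapunov function with a trapping sublevel set in [x > 0] shows that a solution with finitely
   many zeros either stays away from [0] (slow decay) or tends to the saddle (fast decay).
   Being slow with [k] zeros is an open condition on [d]; near a fast solution with [k]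
   zeros every solution has [k] zeros, or has [k + 1] zeros and is slow.

   Now [A_k^*] is the supremum of the [d] with fewer than [k] zeros, and [A_k] the infimum
   of the [d > A_k^*] for which the solution is not slow with [k] zeros. *)

Require Import Defs.
From HB Require Import structures.
From mathcomp Require Import all_boot all_order all_algebra.
From mathcomp Require Import all_classical all_reals all_analysis.
From mathcomp Require Import ring lra.
Import Order.TTheory GRing.Theory Num.Theory.
Import numFieldNormedType.Exports.
Set Implicit Arguments.
Unset Strict Implicit.
Unset Printing Implicit Defensive.
Local Open Scope ring_scope.
Local Open Scope classical_set_scope.

(** * Derivatives and limits *)

Section Derivatives.
Variable R : realType.
Implicit Types (f g : R -> R) (a b c l t : R).

(** With [m = (n - 2)/2] and [p = q - 2] the exponents read l(q, delta) = 2 + 2p/(2 + delta), 2^* =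
    2 + 2/m and, for eta > 0, I(eta) = 2 + 2/(m - l0). So l_u < I(eta) makes b e^(p l0 t) integrable
    at -oo, where the equation for e^(- l0 t) y becomes a perturbation of z'' + 2 l0 z' = 0; 2^* <
    l_s gives gam > 0, hence damping in the limit equation, and l_s < I(beta) gives gam < l1, hence
    a saddle at its origin. The obstacle is the sign of b before t0: a solution may blow up there,
    so the set of d with a global solution need not be an interval, and zeros cannot be followed as
    d grows. Once t0 is reached, an energy excludes blow-up. The argument therefore never moves
    along d; it takes suprema and infima of sets of d in whose definition existence is included. The
    number of zeros is not known to be monotone in d either, which is why A_k^* may exceed A_{k-1}.
    Integrable functions are carried as primitives with a limit, so that most estimates are
    monotonicity statements. *)

Definition isD f t l : Prop := is_derive t 1 f l.
Definition ctn f t : Prop :=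
  forall e, 0 < e -> exists2 d, 0 < d & forall s, `|s - t| < d -> `|f s - f t| < e.

Lemma ctnP f t : ctn f t <-> {for t, continuous f}.
Proof.
split=> [h|cf e e0].
  apply/cvgrPdist_lt => e e0; have [d d0 hd] := h e e0.
  by exists d => //= s; rewrite /= distrC => /hd; rewrite distrC.
have /cvgrPdist_lt /(_ e e0) [d /= d0 hd] := cf.
by exists d => // s st; rewrite distrC; apply: hd; rewrite /= distrC.
Qed.

Lemma ctn_cst c t : ctn (fun=> c) t.
Proof. by apply/ctnP; exact: cvg_cst. Qed.

Lemma ctn_add f g t : ctn f t -> ctn g t -> ctn (fun s => f s + g s) t.
Proof. by move=> /ctnP cf /ctnP cg; apply/ctnP; exact: continuousD cf cg. Qed.

Lemma ctn_sub f g t : ctn f t -> ctn g t -> ctn (fun s => f s - g s) t.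
Proof. by move=> /ctnP cf /ctnP cg; apply/ctnP; exact: continuousB cf cg. Qed.

Lemma ctn_mul f g t : ctn f t -> ctn g t -> ctn (fun s => f s * g s) t.
Proof. by move=> /ctnP cf /ctnP cg; apply/ctnP; exact: continuousM cf cg. Qed.

Lemma ctn_comp f g t : ctn f (g t) -> ctn g t -> ctn (fun s => f (g s)) t.
Proof. by move=> /ctnP cf /ctnP cg; apply/ctnP; exact: continuous_comp cg cf. Qed.

Lemma ctn_norm f t : ctn f t -> ctn (fun s => `|f s|) t.
Proof.
move=> /ctnP cf; apply/ctnP; apply: (@continuous_comp _ _ _ f Num.norm t cf).
exact: norm_continuous.
Qed.

Lemma isD_eq f t l l' : isD f t l' -> l' = l -> isD f t l.
Proof. by move=> h <-. Qed.

Lemma isD_cst c t : isD (fun=> c) t 0.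
Proof. exact: is_derive_cst. Qed.

Lemma isD_id t : isD (fun s => s) t 1.
Proof. exact: is_derive_id. Qed.

Lemma isD_add f g t a b : isD f t a -> isD g t b -> isD (fun s => f s + g s) t (a + b).
Proof. by move=> fa gb; exact: is_deriveD. Qed.

Lemma isD_opp f t a : isD f t a -> isD (fun s => - f s) t (- a).
Proof. by move=> fa; exact: is_deriveN. Qed.

Lemma isD_mul f g t a b :
  isD f t a -> isD g t b -> isD (fun s => f s * g s) t (a * g t + f t * b).
Proof.
move=> fa gb; apply: (isD_eq (is_deriveM fa gb)).
by rewrite /GRing.scale /= addrC mulrC [X in _ + X = _]mulrC [f t * b]mulrC addrC.
Qed.

Lemma isD_comp f g t a b : isD f (g t) a -> isD g t b -> isD (fun s => f (g s)) t (a * b).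
Proof.
move=> fa gb.
have df : derivable f (g t) 1 by case: fa.
have dg : derivable g t 1 by case: gb.
split.
  have := differentiable_comp ((derivable1_diffP _ _).1 dg) ((derivable1_diffP _ _).1 df).
  by move/derivable1_diffP.
have := derive1_comp dg df; rewrite !derive1E => ->.
by case: fa => [_ ->]; case: gb => [_ ->].
Qed.

Lemma isD_expR f t a : isD f t a -> isD (fun s => expR (f s)) t (expR (f t) * a).
Proof. by move=> fa; apply: (@isD_comp expR f) => //; exact: is_derive_expR. Qed.

Lemma isD_sqr f t a : isD f t a -> isD (fun s => f s ^+ 2) t (2 * f t * a).
Proof.
move=> fa; rewrite (_ : (fun s => _) = (fun s => f s * f s)); last first.
  by apply/funext => s; rewrite expr2.
by apply: isD_eq (isD_mul fa fa) _; ring.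
Qed.

Lemma isD_cont f t a : isD f t a -> ctn f t.
Proof. by case=> df _; exact/ctnP/differentiable_continuous/derivable1_diffP. Qed.

Lemma near_isD f g t a : (exists2 e, 0 < e & forall s, `|s - t| < e -> f s = g s) ->
  isD f t a -> isD g t a.
Proof.
move=> [e e0 fg] fa; apply: (near_eq_is_derive (f := f)) fa => //.
by exists e => //= s; rewrite /= distrC => /fg ->.
Qed.

Lemma cont_within f a b : (forall t, a <= t <= b -> ctn f t) ->
  {within `[a, b], continuous f}.
Proof.
move=> cf; apply: continuous_in_subspaceT => x; rewrite inE /= in_itv /=.
by move=> /cf/ctnP.
Qed.

Lemma MVTD f f' a b : a <= b -> (forall t, a <= t <= b -> isD f t (f' t)) ->
  exists2 c, a <= c <= b & f b - f a = f' c * (b - a).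
Proof.
move=> ab df.
have [||c cab ->] := @MVT_segment R f f' a b ab.
- by move=> x /itvP xab; apply: df; rewrite !xab.
- by apply: cont_within => t tab; apply: isD_cont (df t tab).
by exists c => //; rewrite in_itv /= in cab.
Qed.

Lemma incrD f f' a b : a <= b -> (forall t, a <= t <= b -> isD f t (f' t)) ->
  (forall t, a <= t <= b -> 0 <= f' t) -> f a <= f b.
Proof.
move=> ab df f0; have [c cab e] := MVTD ab df.
by rewrite -subr_ge0 e mulr_ge0 ?f0 ?subr_ge0.
Qed.

Lemma incrSD f f' a b : a < b -> (forall t, a <= t <= b -> isD f t (f' t)) ->
  (forall t, a <= t <= b -> 0 < f' t) -> f a < f b.
Proof.
move=> ab df f0; have [c cab e] := MVTD (ltW ab) df.
by rewrite -subr_gt0 e mulr_gt0 ?f0 ?subr_gt0.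
Qed.

Lemma lipD f f' w w' a b : a <= b ->
  (forall t, a <= t <= b -> isD f t (f' t)) ->
  (forall t, a <= t <= b -> isD w t (w' t)) ->
  (forall t, a <= t <= b -> `|f' t| <= w' t) -> `|f b - f a| <= w b - w a.
Proof.
move=> ab df dw fw; rewrite ler_norml; apply/andP; split.
  rewrite -subr_ge0 opprK.
  suff : f a + w a <= f b + w b by lra.
  apply: (@incrD (fun t => f t + w t) (fun t => f' t + w' t)) => // t tab.
    by apply: isD_add; [exact: df|exact: dw].
  by have := fw t tab; rewrite ler_norml => /andP[]; lra.
suff : w a - f a <= w b - f b by lra.
apply: (@incrD (fun t => w t - f t) (fun t => w' t - f' t)) => // t tab.
  by apply: isD_add; [exact: dw|apply: isD_opp; exact: df].
by have := fw t tab; rewrite ler_norml => /andP[]; lra.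
Qed.

(** The difference quotients from the left are nonnegative. Meant for the first time at which a
    barrier is reached. *)
Lemma isD_left_ge f t l a : isD f t l -> a < t ->
  (forall s, a <= s <= t -> f s <= f t) -> 0 <= l.
Proof.
move=> df at_ h; rewrite leNgt; apply/negP => l0.
have [dd dl] := df.
have := @derivable_nbhsP; move=> _.
have /cvgrPdist_lt /(_ (- l)) := dd.
rewrite -/(derive f t 1) dl oppr_gt0 => /(_ l0) [e /= e0 he].
pose u := Num.min (e / 2) (t - a).
have u0 : 0 < u by rewrite lt_min divr_gt0//= subr_gt0.
have ue : u < e by rewrite gt_min; apply/orP; left; lra.
have ua : u <= t - a by rewrite ge_min lexx orbT.
have := he (- u); rewrite /= sub0r opprK gtr0_norm // => /(_ ue).
rewrite oppr_eq0 gt_eqF // => /(_ isT).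
rewrite /GRing.scale /= mulr1 addrC invrN mulNr opprK.
have := h (t - u) => /(_ _)/=.
move=> /(_ ltac:(apply/andP; split; lra)) hu.
have : 0 <= u^-1 * (f t - f (t - u)) by rewrite mulr_ge0 ?invr_ge0 ?subr_ge0 // ltW.
rewrite (_ : u^-1 * (f t - f (t - u)) = - (u^-1 * (f (t - u) - f t))); last by ring.
rewrite [- u + t]addrC; set X := u^-1 * _ => hX; rewrite ltr_norml => /andP[]; lra.
Qed.

Lemma cont_bounded f a b : (forall t, a <= t <= b -> ctn f t) ->
  exists2 M, 0 < M & forall t, a <= t <= b -> `|f t| <= M.
Proof.
move=> cf; have [ab|ab] := leP a b; last first.
  by exists 1 => // t /andP[at_ tb]; exfalso; have := le_trans at_ tb; rewrite leNgt ab.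
have cn : {within `[a, b], continuous (fun t => `|f t|)}.
  by apply: cont_within => t tab; apply/ctn_norm/cf.
have [c cab h] := EVT_max ab cn.
exists (`|f c| + 1); first by have := normr_ge0 (f c); lra.
by move=> t tab; rewrite (le_trans (h t _)) ?in_itv //; lra.
Qed.

Lemma cont_pos_min f a b : a <= b -> (forall t, a <= t <= b -> ctn f t) ->
  (forall t, a <= t <= b -> 0 < f t) -> exists2 m, 0 < m & forall t, a <= t <= b -> m <= f t.
Proof.
move=> ab cf f0; have [c cab h] := EVT_min ab (cont_within cf).
by exists (f c); [exact: f0 | move=> t tab; exact: h].
Qed.

Lemma IVTD f a b : a <= b -> (forall t, a <= t <= b -> ctn f t) ->
  f a * f b <= 0 -> exists2 c, a <= c <= b & f c = 0.
Proof.
move=> ab cf fab.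
have v0 : Num.min (f a) (f b) <= 0 <= Num.max (f a) (f b).
  rewrite ge_min le_max.
  apply/andP; split; apply/orP.
    have [fa|fa] := leP (f a) 0; [by left|right].
    by rewrite pmulr_rle0 in fab.
  have [fa|fa] := leP 0 (f a); [by left|right].
  by rewrite nmulr_rle0 in fab.
have [c cab fc] := IVT ab (cont_within cf) v0.
by exists c => //; rewrite in_itv in cab.
Qed.

(** The exit time is the infimum of the times with [0 <= f]: such times accumulate there, which
    excludes [f s < 0], and the times just before it exclude [0 < f s]. *)
Lemma first_exit f a b : (forall t, a <= t <= b -> ctn f t) ->
  f a < 0 -> (exists2 t, a <= t <= b & 0 <= f t) ->
  exists2 s, a < s <= b & f s = 0 /\ forall t, a <= t < s -> f t < 0.
Proof.
move=> cf fa [t1 /andP[at1 t1b] ft1].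
pose S := [set t | a <= t <= t1 /\ 0 <= f t].
have Sn : S !=set0 by exists t1; split; rewrite ?at1 ?lexx.
have Slb : lbound S a by move=> x [/andP[]].
have hS : has_inf S by split => //; exists a.
pose s := inf S.
have as_ : a <= s by apply: lb_le_inf.
have st1 : s <= t1 by apply: ge_inf; [by case: hS | by split; rewrite ?at1 ?lexx].
have sab : a <= s <= b by rewrite as_ (le_trans st1).
have below t : a <= t < s -> f t < 0.
  move=> /andP[at_ ts]; rewrite ltNge; apply/negP => ft.
  have : s <= t.
    apply: ge_inf; first by case: hS.
    by split; rewrite ?at_ ?(le_trans (ltW ts)).
  by rewrite leNgt ts.
have fs0 : 0 <= f s.
  rewrite leNgt; apply/negP => fs.
  have := (cf s sab) (- f s); rewrite oppr_gt0 => /(_ fs)[d d0 hd].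
  have [x [/andP[ax xt] fx] xs] := inf_adherent d0 hS.
  have sx : s <= x by apply: ge_inf; [by case: hS | by split; rewrite ?ax ?xt].
  have := hd x; rewrite ger0_norm ?subr_ge0 // ltrBlDr addrC => /(_ xs).
  by rewrite ltr_norml => /andP[]; lra.
have {}as_ : a < s.
  by rewrite lt_neqAle as_ andbT; apply/eqP => e; move: fs0; rewrite -e leNgt fa.
exists s; first by rewrite as_ (le_trans st1).
split => //; apply/eqP; rewrite eq_le fs0 andbT leNgt; apply/negP => fs.
have [d d0 hd] := (cf s sab) (f s) fs.
pose u := Num.max a (s - d / 2).
have us : u < s by rewrite gt_max as_ /=; lra.
have au : a <= u by rewrite le_max lexx.
have : `|u - s| < d.
  rewrite ltr0_norm ?subr_lt0 //.
  have : s - d / 2 <= u by rewrite le_max lexx orbT.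
  lra.
move=> /hd; have := below u; rewrite au us => /(_ isT).
by rewrite ltr_norml => ? /andP[]; lra.
Qed.

(** Continuous induction: at a first exit the weak inequality holds on the whole past, and improving
    it to a strict one contradicts [f s = 0]. A bound may thus be assumed while it is being
    proved. *)
Lemma bootstrap f a b : (forall t, a <= t <= b -> ctn f t) -> f a < 0 ->
  (forall t, a < t <= b -> (forall s, a <= s <= t -> f s <= 0) -> f t < 0) ->
  forall t, a <= t <= b -> f t < 0.
Proof.
move=> cf fa h t tab; rewrite ltNge; apply/negP => ft.
have [s sab [fs hs]] := first_exit cf fa (ex_intro2 _ _ t tab ft).
have : f s < 0.
  apply: h => // r /andP[ar]; rewrite le_eqVlt => /predU1P[->|rs]; first by rewrite fs.
  by apply/ltW/hs; rewrite ar.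
by rewrite fs ltxx.
Qed.

End Derivatives.

(** Differentiation guided by syntax. The derivative is produced as an existential variable, and
    [isD_eq] compares it afterwards with the wanted form. *)
Ltac isD_step :=
  lazymatch goal with
  | |- isD (fun s => @?f s + @?g s) _ _ => eapply isD_add
  | |- isD (fun s => - @?f s) _ _ => eapply isD_opp
  | |- isD (fun s => @?f s * @?g s) _ _ =>
      first [eassumption | eapply isD_mul]
  | |- isD (fun s => expR (@?f s)) _ _ => eapply isD_expR
  | |- isD (fun s => (@?f s) ^+ 2) _ _ => eapply isD_sqr
  | _ => first [eapply isD_id | eapply isD_cst | eassumption]
  end.

Ltac isD_auto := first [eassumption | isD_step; [isD_auto ..] | idtac].

Ltac isD_calc := apply: isD_eq; [isD_auto | cbv beta; ring].

(* [lraf h1 h2] runs [lra] on the listed hypotheses only, which is much faster in large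
   contexts.  Clearing section variables would break [lra], so only what was introduced
   after [mark] is cleared. *)
Definition section_mark := True.
Ltac mark := have mark0 : section_mark by exact I.
Ltac prune := repeat match goal with
  h : ?T |- _ => lazymatch T with section_mark => fail 1 | _ => clear h end end.
Tactic Notation "lraf" hyp_list(hs) := revert hs; prune; intros; lra.

(** * Primitives and limits at both infinities *)

Section Primitives.
Variable R : realType.
Implicit Types (f g w : R -> R) (a b c l t : R).

Lemma eqD f g h a b : a <= b -> (forall t, a <= t <= b -> isD f t (h t)) ->
  (forall t, a <= t <= b -> isD g t (h t)) -> f b - f a = g b - g a.
Proof.
move=> ab df dg; apply/eqP; rewrite -subr_eq0 -normr_le0.
have := @lipD R (fun t => f t - g t) (fun t => h t - h t) (fun=> 0) (fun=> 0) a b ab.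
rewrite subrr (_ : f b - g b - (f a - g a) = f b - f a - (g b - g a)); last by ring.
apply => t tab; [|exact: isD_cst|by rewrite subrr normr0].
by apply: isD_add; [exact: df|apply: isD_opp; exact: dg].
Qed.

Lemma primitive_right g a : (forall t, ctn g t) ->
  exists F, forall t, a < t -> isD F t (g t).
Proof.
move=> cg; exists (fun x => \int[@lebesgue_measure R]_(t in `[a, x]) g t)%R => t at_.
have tt : t < t + 1 by lra.
have ig : (@lebesgue_measure R).-integrable `[a, t + 1] (EFin \o g).
  apply: continuous_compact_integrable; first exact: segment_compact.
  by apply: cont_within => s _; exact: cg.
have [dF eF] := continuous_FTC1_closed tt ig at_ ((ctnP _ _).1 (cg t)).
by split; [exact: dF|rewrite -derive1E; exact: eF].
Qed.

(** [primitive_right] covers only the points right of its base. Normalised to vanish at [0], the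
    primitives with bases [a < 0] agree where they are defined, so the base may move with the point:
    [- (|x| + 1)] lies left of both [x] and [0]. *)
Lemma primitive g : (forall t, ctn g t) -> exists F, forall t, isD F t (g t).
Proof.
move=> cg.
have /choice[G dG] : forall a, exists F, forall t, a < t -> isD F t (g t).
  by move=> a; exact: primitive_right.
have eG a b s : a < 0 -> a < s -> b < 0 -> b < s -> G a s - G a 0 = G b s - G b 0.
  move=> a0 as_ b0 bs; have [s0|s0] := leP 0 s.
    by apply: (eqD (h := g)) => // t /andP[t0 ts]; apply: dG; lra.
  have : G a 0 - G a s = G b 0 - G b s; last by lra.
  by apply: (eqD (h := g)) => [|t /andP[t0 ts]|t /andP[t0 ts]]; [exact: ltW|apply: dG; lra..].
exists (fun x => G (- (`|x| + 1)) x - G (- (`|x| + 1)) 0) => t.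
have nt := normr_ge0 t; have tn := ler_norm t; have tn' := ler_norm (- t); rewrite normrN in tn'.
apply: (@near_isD _ (fun s => G (- (`|t| + 2)) s + - G (- (`|t| + 2)) 0)); last first.
  apply: isD_eq; first by apply: isD_add; [apply: dG; lra|exact: isD_cst].
  by rewrite addr0.
exists (1 / 2); first lra.
move=> s; rewrite ltr_norml => /andP[s1 s2].
have ns := normr_ge0 s; have sn := ler_norm s; have sn' := ler_norm (- s); rewrite normrN in sn'.
by apply: eG; lra.
Qed.

Definition limN f l := forall e, 0 < e -> exists T, forall t, t <= T -> `|f t - l| < e.
Definition limP f l := forall e, 0 < e -> exists T, forall t, T <= t -> `|f t - l| < e.

Lemma limN_P f l : limN f l <-> limP (fun t => f (- t)) l.
Proof.
split=> h e e0; have [T hT] := h e e0; exists (- T) => t tT.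
  by apply: hT; lra.
by rewrite -[t]opprK; apply: hT; lra.
Qed.

Lemma limP_D f g l m : limP f l -> limP g m -> limP (fun t => f t + g t) (l + m).
Proof.
move=> fl gm e e0; have e2 : 0 < e / 2 by lra.
have [T1 h1] := fl _ e2; have [T2 h2] := gm _ e2.
exists (Num.max T1 T2) => t; rewrite ge_max => /andP[t1 t2].
rewrite (_ : _ - _ = (f t - l) + (g t - m)); last by ring.
by rewrite (le_lt_trans (ler_normD _ _)) //; have := h1 t t1; have := h2 t t2; lra.
Qed.

Lemma limP_Z f l c : limP f l -> limP (fun t => c * f t) (c * l).
Proof.
move=> fl e e0; have c1 : 0 < `|c| + 1 by have := normr_ge0 c; lra.
have [T h] := fl _ (divr_gt0 e0 c1); exists T => t /h ft.
rewrite -mulrBr normrM (@le_lt_trans _ _ ((`|c| + 1) * `|f t - l|)) //.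
  by rewrite ler_wpM2r //; lra.
by rewrite mulrC -ltr_pdivlMr.
Qed.

Lemma limN_D f g l m : limN f l -> limN g m -> limN (fun t => f t + g t) (l + m).
Proof. by move=> /limN_P a /limN_P b; apply/limN_P; exact: limP_D a b. Qed.

Lemma limN_Z f l c : limN f l -> limN (fun t => c * f t) (c * l).
Proof. by move=> /limN_P a; apply/limN_P; exact: limP_Z. Qed.

Lemma limP_cst c : limP (fun=> c) c.
Proof. by move=> e e0; exists 0 => t _; rewrite subrr normr0. Qed.

Lemma limN_cst c : limN (fun=> c) c.
Proof. by apply/limN_P; exact: limP_cst. Qed.

Lemma limP_uniq f l m : limP f l -> limP f m -> l = m.
Proof.
move=> fl fm; apply/eqP; rewrite -subr_eq0 -normr_le0 leNgt; apply/negP => h.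
have h2 : 0 < `|l - m| / 2 by lra.
have [T1 h1] := fl _ h2; have [T2 h3] := fm _ h2.
have := h1 (Num.max T1 T2); rewrite le_max lexx => /(_ isT).
have := h3 (Num.max T1 T2); rewrite le_max lexx orbT => /(_ isT).
set z := f _; have : `|l - m| <= `|z - l| + `|z - m|.
  rewrite (_ : l - m = - (z - l) + (z - m)); last by ring.
  by rewrite (le_trans (ler_normD _ _)) // normrN.
lra.
Qed.

Lemma limN_uniq f l m : limN f l -> limN f m -> l = m.
Proof. by move=> /limN_P a /limN_P b; exact: limP_uniq a b. Qed.

Lemma limP_monotone f T M : (forall s t, T <= s -> s <= t -> f s <= f t) ->
  (forall t, T <= t -> f t <= M) -> exists l, limP f l /\ forall t, T <= t -> f t <= l.
Proof.
move=> mf fM; pose S := [set f t | t in [set t | T <= t]].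
have hS : has_sup S.
  split; first by exists (f T), T => //=.
  by exists M => _ [t Tt <-]; exact: fM.
have ub t : T <= t -> f t <= sup S.
  by move=> Tt; apply: sup_upper_bound => //; exists t.
exists (sup S); split => // e e0; have [_ [t Tt <-] h] := sup_adherent e0 hS.
have {}Tt : T <= t by [].
exists t => s ts; have := mf _ _ Tt ts; have := ub s (le_trans Tt ts).
by move=> *; rewrite ler0_norm; lra.
Qed.

Lemma limN_monotone f T M : (forall s t, s <= t -> t <= T -> f s <= f t) ->
  (forall t, t <= T -> M <= f t) -> exists l, limN f l /\ forall t, t <= T -> l <= f t.
Proof.
move=> mf fM.
have [||l [hl hb]] := @limP_monotone (fun t => - f (- t)) (- T) (- M).
- by move=> s t Ts st; rewrite lerN2; apply: mf; lra.
- by move=> t Tt; rewrite lerN2; apply: fM; lra.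
exists (- l); split.
  apply/limN_P => e e0; have [T1 h] := hl e e0; exists T1 => t /h.
  by rewrite -normrN (_ : - (- f (- t) - l) = f (- t) - - l) //; ring.
by move=> t tT; have := hb (- t); rewrite opprK lerN2 => /(_ tT); lra.
Qed.

Lemma limP_bound f l : limP f l -> exists T, forall t, T <= t -> `|f t| <= `|l| + 1.
Proof.
move=> /(_ 1 ltr01)[T h]; exists T => t /h ft.
by rewrite -[f t](subrK l) (le_trans (ler_normD _ _)) //; lra.
Qed.

Lemma limN_bound f l : limN f l -> exists T, forall t, t <= T -> `|f t| <= `|l| + 1.
Proof.
move=> /limN_P/limP_bound[T h]; exists (- T) => t tT.
by rewrite -[t]opprK; apply: h; lra.
Qed.

Lemma limP_ext f g T l : (forall t, T <= t -> f t = g t) -> limP f l -> limP g l.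
Proof.
move=> fg fl e e0; have [T1 h] := fl e e0; exists (Num.max T T1) => t.
by rewrite ge_max => /andP[t1 t2]; rewrite -fg // h.
Qed.

Lemma limN_ext f g T l : (forall t, t <= T -> f t = g t) -> limN f l -> limN g l.
Proof.
move=> fg /limN_P fl; apply/limN_P; apply: limP_ext fl => t; apply: (_ : - T <= t -> _).
by move=> Tt; apply: fg; lra.
Qed.

Lemma limP_le f l c T : limP f l -> (forall t, T <= t -> f t <= c) -> l <= c.
Proof.
move=> fl h; rewrite leNgt; apply/negP => cl.
have [T1 h1] := fl (l - c) ltac:(lra).
have := h1 (Num.max T T1); rewrite le_max lexx orbT => /(_ isT).
have := h (Num.max T T1); rewrite le_max lexx => /(_ isT).
by move=> ?; rewrite ltr_norml => /andP[]; lra.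
Qed.

Lemma limN_le f l c T : limN f l -> (forall t, t <= T -> f t <= c) -> l <= c.
Proof.
move=> /limN_P fl h; apply: (limP_le (T := - T) fl) => t tT; apply: h; lra.
Qed.

(** [f + w] is nondecreasing and bounded, hence convergent, and [w] converges. This is convergence
    of an absolutely convergent integral, stated for primitives. *)
Lemma limP_dominated f f' w w' l T :
  (forall t, T <= t -> isD f t (f' t)) -> (forall t, T <= t -> isD w t (w' t)) ->
  (forall t, T <= t -> `|f' t| <= w' t) -> limP w l -> exists m, limP f m.
Proof.
move=> df dw fw wl.
have wm s t : T <= s -> s <= t -> w s <= w t.
  move=> Ts st; apply: (incrD (f' := w')) => // r /andP[sr rt]; first by apply: dw; lra.
  by rewrite (le_trans _ (fw r _)) //; lra.
have wl' t : T <= t -> w t <= l.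
  move=> Tt; have := @limP_le (fun s => - w s) (- l) (- w t) t.
  rewrite !lerN2; apply; last by move=> s ts; rewrite lerN2 wm.
  by move=> e e0; have [T1 h] := wl e e0; exists T1 => s /h; rewrite -opprD normrN.
have fw2 s t : T <= s -> s <= t -> `|f t - f s| <= w t - w s.
  by move=> Ts st; apply: (lipD (f' := f') (w' := w')) => // r /andP[sr rt];
    [apply: df|apply: dw|apply: fw]; lra.
have [||k [hk _]] := @limP_monotone (fun t => f t + w t) T (f T + 2 * (l - w T) + w T).
- move=> s t Ts st; have := fw2 _ _ Ts st; rewrite ler_norml => /andP[]; lra.
- move=> t Tt; have := fw2 _ _ (lexx T) Tt; have := wl' _ Tt; rewrite ler_norml => ? /andP[]; lra.
exists (k + - 1 * l).
have := limP_D hk (limP_Z (-1) wl); apply: (limP_ext (T := T)) => t _; ring.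
Qed.

Lemma limN_dominated f f' w w' l T :
  (forall t, t <= T -> isD f t (f' t)) -> (forall t, t <= T -> isD w t (w' t)) ->
  (forall t, t <= T -> `|f' t| <= w' t) -> limN w l -> exists m, limN f m.
Proof.
move=> df dw fw /limN_P wl.
have rev g g' t : t >= - T -> (forall t, t <= T -> isD g t (g' t)) ->
    isD (fun s => - g (- s)) t (g' (- t)).
  move=> tT dg; have dgt : isD g (- t) (g' (- t)) by apply: dg; lra.
  have dN := isD_opp (isD_id t).
  apply: (isD_eq (isD_comp (isD_opp dgt) dN)).
  by rewrite mulrN1 opprK.
have [||||m hm] := @limP_dominated (fun s => - f (- s)) (fun s => f' (- s))
   (fun s => - w (- s)) (fun s => w' (- s)) (-1 * l) (- T).
- by move=> t tT; exact: rev.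
- by move=> t tT; exact: rev.
- by move=> t tT; apply: fw; lra.
- by have := limP_Z (-1) wl; apply: (limP_ext (T := 0)) => s _; ring.
exists (-1 * m); apply/limN_P; have := limP_Z (-1) hm.
by apply: (limP_ext (T := 0)) => s _; ring.
Qed.

End Primitives.

(** * The power nonlinearity *)

Section Powers.
Variable R : realType.
Implicit Types (f g h : R -> R) (p x y c d e t M : R).

(** The difference quotient at [0] is [h] itself, so continuity is enough. It serves at the origin,
    where [pw p] need not be differentiable. *)
Lemma isD_mulid h : ctn h 0 -> isD (fun s => s * h s) 0 (h 0).
Proof.
move=> ch.
have H : (fun s : R => s^-1 *: ((fun s => s * h s) (s *: 1 + 0) - (fun s => s * h s) 0))
    @ 0^' --> h 0.
  apply/cvgrPdist_lt => e e0; have [d d0 hd] := ch e e0.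
  exists d => //= s; rewrite /= sub0r normrN => sd s0.
  rewrite mul0r subr0 /GRing.scale /= mulr1 addr0 mulrA mulVf // mul1r distrC.
  by apply: hd; rewrite subr0.
by split; [apply/cvg_ex; exists (h 0)|apply: cvg_lim => //].
Qed.

Definition pw p x : R := `|x| `^ p.
Definition npow p x : R := x * pw p x.
(** The function |x|^(p+2)/(p+2), a primitive of [npow p]. *)
Definition gpow p x : R := x ^+ 2 * pw p x / (p + 2).

Variable p : R.
Hypothesis p0 : 0 < p.

Lemma pw_ge0 x : 0 <= pw p x.
Proof. exact: powR_ge0. Qed.

Lemma pw_gt0 x : x != 0 -> 0 < pw p x.
Proof. by move=> x0; rewrite powR_gt0 // normr_gt0. Qed.

Lemma pw0 : pw p 0 = 0.
Proof. by rewrite /pw normr0 powR0 // gt_eqF. Qed.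

Lemma pwN x : pw p (- x) = pw p x.
Proof. by rewrite /pw normrN. Qed.

Lemma pwM x y : pw p (x * y) = pw p x * pw p y.
Proof. by rewrite /pw normrM powRM. Qed.

Lemma pw_le x y : `|x| <= `|y| -> pw p x <= pw p y.
Proof. by move=> xy; rewrite /pw ge0_ler_powR ?nnegrE // ltW. Qed.

Lemma pw_lt x y : `|x| < `|y| -> pw p x < pw p y.
Proof. by move=> xy; rewrite /pw gt0_ltr_powR ?nnegrE. Qed.

Lemma pw_expR t : pw p (expR t) = expR (p * t).
Proof. by rewrite /pw gtr0_norm ?expR_gt0 // /powR gt_eqF ?expR_gt0 // expRK. Qed.

Lemma pw_root c : 0 < c -> exists2 x, 0 < x & pw p x = c.
Proof.
move=> c0; exists (c `^ p^-1); first exact: powR_gt0.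
by rewrite /pw gtr0_norm ?powR_gt0 // -powRrM mulVf ?gt_eqF // powRr1 // ltW.
Qed.

Lemma pw_small e : 0 < e -> exists2 d, 0 < d & forall x, `|x| <= d -> pw p x < e.
Proof.
move=> e0; have [x x0 px] := pw_root e0; exists (x / 2); first lra.
by move=> y yx; rewrite -px pw_lt // (gtr0_norm x0); lra.
Qed.

Lemma npow0 : npow p 0 = 0. Proof. by rewrite /npow mul0r. Qed.

Lemma npowN x : npow p (- x) = - npow p x.
Proof. by rewrite /npow pwN mulNr. Qed.

Lemma npowM x y : npow p (x * y) = npow p x * npow p y.
Proof. by rewrite /npow pwM; ring. Qed.

Lemma isD_pw x : x != 0 -> isD (pw p) x (p * pw p x / x).
Proof.
have pos y : 0 < y -> isD (pw p) y (p * pw p y / y).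
  move=> y0; apply: (@near_isD _ (fun s => s `^ p)).
    exists y => // s; rewrite ltr_norml => /andP[ys _].
    by rewrite /pw gtr0_norm //; lra.
  apply: isD_eq; first exact: (is_derive1_powR p y0).
  rewrite /pw gtr0_norm // powRB; last by apply/implyP => _; rewrite gt_eqF.
  by rewrite powRr1 ?mulrA // ltW.
rewrite neq_lt => /orP[x0|]; last exact: pos.
apply: (@near_isD _ (fun s => pw p (- s))).
  by exists 1 => // s _; rewrite pwN.
have nx0 : 0 < - x by lra.
apply: isD_eq; first exact: (isD_comp (pos _ nx0) (isD_opp (isD_id x))).
by rewrite pwN invrN; ring.
Qed.

Lemma pw_cont x : ctn (pw p) x.
Proof.
have [->|x0] := eqVneq x 0; last exact: isD_cont (isD_pw x0).
move=> e e0; have [d d0 hd] := pw_small e0.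
exists d => // s; rewrite subr0 pw0 subr0 => sd.
by rewrite ger0_norm ?pw_ge0 // hd // ltW.
Qed.

Lemma isD_npow x : isD (npow p) x ((p + 1) * pw p x).
Proof.
have [->|x0] := eqVneq x 0.
  have D := isD_mulid (pw_cont 0); rewrite pw0 in D.
  by rewrite pw0 mulr0; exact: D.
apply: isD_eq; first exact: (isD_mul (isD_id x) (isD_pw x0)).
by rewrite /=; field.
Qed.

Lemma npow_lip M x y : `|x| <= M -> `|y| <= M ->
  `|npow p x - npow p y| <= (p + 1) * pw p M * `|x - y|.
Proof.
have hp := p0; wlog xy : x y / y <= x.
  move=> h xM yM; have [/h|/ltW/h] := leP y x; first exact.
  by rewrite distrC [`|y - x|]distrC; apply.
move=> xM yM; rewrite (ger0_norm (_ : 0 <= x - y)) ?subr_ge0 // mulrBr.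
apply: (lipD (f' := fun t => (p + 1) * pw p t) (w := fun t => (p + 1) * pw p M * t)
   (w' := fun t => (p + 1) * pw p M)) => // t.
- by move=> _; exact: isD_npow.
- move=> _; apply: isD_eq; first exact: (isD_mul (isD_cst _ _) (isD_id t)).
  by rewrite /=; ring.
- move=> /andP[yt tx]; rewrite ger0_norm; last by rewrite mulr_ge0 ?pw_ge0 //; lra.
  rewrite ler_wpM2l //; first lra.
  apply: pw_le; rewrite (le_trans _ (ler_norm M)) // ler_norml.
  move: xM yM; rewrite !ler_norml; lra.
Qed.

Lemma gpow_ge0 x : 0 <= gpow p x.
Proof.
have hp := p0; apply: divr_ge0; last lra.
by apply: mulr_ge0; [exact: sqr_ge0|exact: pw_ge0].
Qed.

Lemma gpow0 : gpow p 0 = 0. Proof. by rewrite /gpow pw0 mulr0 mul0r. Qed.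

Lemma isD_gpow x : isD (gpow p) x (npow p x).
Proof.
have [->|x0] := eqVneq x 0.
  apply: (@near_isD _ (fun s => s * ((p + 2)^-1 * npow p s))).
    by exists 1 => // s _; rewrite /gpow /npow; ring.
  apply: isD_eq; first apply: isD_mulid.
    exact: (isD_cont (isD_mul (isD_cst _ _) (isD_npow 0))).
  by rewrite npow0 mulr0.
have D1 := isD_pw x0; have D2 := isD_mul (isD_sqr (isD_id x)) D1.
apply: (isD_eq (isD_mul D2 (isD_cst _ x))).
have hp := p0; have p2 : p + 2 != 0 by rewrite gt_eqF //; lra.
by rewrite /npow; field; rewrite x0 p2.
Qed.

(* Freezing the nonlinearity outside [-M, M] makes it globally Lipschitz. *)
Definition clamp M x : R := Num.max (- M) (Num.min M x).

Lemma clamp_id M x : `|x| <= M -> clamp M x = x.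
Proof.
by rewrite ler_norml /clamp => /andP[h1 h2]; rewrite (min_idPr h2) (max_idPr h1).
Qed.

Lemma clamp_bound M x : 0 <= M -> `|clamp M x| <= M.
Proof.
move=> M0; rewrite ler_norml /clamp le_max lexx /= ge_max ge_min lexx /= andbT; lra.
Qed.

Lemma clamp_lip M x y : 0 <= M -> `|clamp M x - clamp M y| <= `|x - y|.
Proof.
move=> M0.
wlog xy : x y / y <= x.
  by move=> h; have [/h//|/ltW/h] := leP y x; rewrite distrC [`|y - x|]distrC.
have cc : clamp M y <= clamp M x.
  by rewrite /clamp ge_max le_max lexx /= le_max le_min !ge_min lexx xy /= orbT orbT.
rewrite !ger0_norm ?subr_ge0 // /clamp.
have [h1|h1] := leP M x; have [h2|h2] := leP M y; have [h3|h3] := leP (- M) x;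
  have [h4|h4] := leP (- M) y; have [h5|h5] := leP (- M) M; lra.
Qed.

Lemma npow_clamp_lip M x y : 0 <= M ->
  `|npow p (clamp M x) - npow p (clamp M y)| <= (p + 1) * pw p M * `|x - y|.
Proof.
have hp := p0; move=> M0; apply: le_trans (npow_lip (clamp_bound _ M0) (clamp_bound _ M0)) _.
rewrite ler_wpM2l ?clamp_lip // mulr_ge0 ?pw_ge0 //; lra.
Qed.

Lemma npow_clamp_cont M x : 0 <= M -> ctn (fun s => npow p (clamp M s)) x.
Proof.
move=> M0; move=> e e0.
have L0 : 0 < (p + 1) * pw p M + 1.
  have hp := p0; have p1 : 0 <= p + 1 by lra.
  by have := mulr_ge0 p1 (pw_ge0 M); lra.
exists (e / ((p + 1) * pw p M + 1)); first exact: divr_gt0.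
move=> s sx; apply: le_lt_trans (npow_clamp_lip _ _ M0) _.
rewrite (@le_lt_trans _ _ (((p + 1) * pw p M + 1) * `|s - x|)) //.
  by rewrite ler_wpM2r //; lra.
by rewrite mulrC -ltr_pdivlMr.
Qed.

End Powers.

(** * Damped linear equations on [-oo, T] *)

Section Volterra.
Variable R : realType.
Implicit Types (f g h z w W : R -> R) (a b c d e t l lam T : R).

(** [lipD] with its left end sent to [-oo]; the errors at a far point are absorbed in [e]. *)
Lemma limN_dom_bound f f' W W' l k T :
  (forall t, t <= T -> isD f t (f' t)) -> (forall t, t <= T -> isD W t (W' t)) ->
  (forall t, t <= T -> `|f' t| <= W' t) -> limN f l -> limN W k -> `|f T - l| <= W T - k.
Proof.
move=> df dW fW fl Wk; apply/ler_addgt0Pr => e e0.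
have [T1 h1] := fl (e / 2) ltac:(lra); have [T2 h2] := Wk (e / 2) ltac:(lra).
pose s := Num.min T (Num.min T1 T2).
have sT : s <= T by rewrite ge_min lexx.
have {}h1 : `|f s - l| < e / 2 by apply: h1; rewrite /s !ge_min lexx !orbT.
have {}h2 : `|W s - k| < e / 2 by apply: h2; rewrite /s !ge_min lexx !orbT.
have h : `|f T - f s| <= W T - W s.
  by apply: (lipD (f' := f') (w' := W')) => // t /andP[_ tT]; [exact: df|exact: dW|exact: fW].
have : `|f T - l| <= `|f T - f s| + `|f s - l|.
  by rewrite (le_trans _ (ler_normD _ _)) // addrA subrK.
by move: h2; rewrite ltr_norml => /andP[]; lra.
Qed.

Lemma limN_dom_ge0 W W' T : (forall t, t <= T -> isD W t (W' t)) ->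
  (forall t, t <= T -> 0 <= W' t) -> limN W 0 -> 0 <= W T.
Proof.
move=> dW W0 Wl.
have h0 t : t <= T -> `|0 : R| <= W' t by move=> tT; rewrite normr0 W0.
have := limN_dom_bound (fun t _ => isD_cst 0 t) dW h0 (limN_cst 0) Wl.
by rewrite !subr0 normr0.
Qed.

Lemma isD_lin c t : isD (fun s => c * s) t c.
Proof. by apply: (isD_eq (isD_mul (isD_cst c t) (isD_id t))); rewrite /= mul0r mulr1 add0r. Qed.

Lemma isD_explin c t : isD (fun s => expR (c * s)) t (c * expR (c * t)).
Proof. by apply: (isD_eq (isD_expR (isD_lin c t))); rewrite mulrC. Qed.

Lemma limN_exp_mul lam f : 0 <= lam -> limN f 0 -> limN (fun t => expR (lam * t) * f t) 0.
Proof.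
move=> lam0 fl e e0; have [T h] := fl e e0; exists (Num.min T 0) => t.
rewrite le_min => /andP[/h ft t0]; rewrite subr0 in ft; rewrite subr0 normrM.
rewrite (ger0_norm (expR_ge0 _)) (le_lt_trans _ ft) // ler_piMl // -expR0 ler_expR.
by rewrite mulr_ge0_le0.
Qed.

Lemma limN_exp lam : 0 < lam -> limN (fun t => expR (lam * t)) 0.
Proof.
move=> lam0 e e0; exists (ln (e / 2) / lam) => t tT.
rewrite subr0 ger0_norm ?expR_ge0 // (@le_lt_trans _ _ (e / 2)) //; last lra.
have e2 : 0 < e / 2 by lra.
by rewrite -[X in _ <= X]lnK ?posrE // ler_expR mulrC -ler_pdivlMr.
Qed.

(* For [z'' + 2 lam z' = g] the unknowns [2 lam z + z'] and [e^(2 lam t) z']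
   have derivatives [g] and [e^(2 lam t) g]. *)
Lemma damped_bound lam z w g W W' (z0 : R) T : 0 < lam ->
  (forall t, t <= T -> isD z t (w t)) ->
  (forall t, t <= T -> isD w t (g t - 2 * lam * w t)) ->
  (forall t, t <= T -> isD W t (W' t)) -> (forall t, t <= T -> `|g t| <= W' t) ->
  limN z z0 -> limN w 0 -> limN W 0 ->
  `|w T| <= W T /\ `|z T - z0| <= W T / lam.
Proof.
move=> lam0 dz dw dW gW zl wl Wl.
have W'0 t : t <= T -> 0 <= W' t by move=> /gW; apply: le_trans.
have W0 t : t <= T -> 0 <= W t.
  by move=> tT; apply: (limN_dom_ge0 (W' := W')) => // s st; [apply: dW|apply: W'0]; lra.
have hQ : `|(2 * lam * z T + w T) - (2 * lam * z0 + 0)| <= W T - 0.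
  apply: (limN_dom_bound (f := fun t => 2 * lam * z t + w t) (f' := g) (W' := W') _ dW gW _ Wl).
    move=> t tT; have D1 := dz t tT; have D2 := dw t tT.
    apply: isD_eq; first by isD_auto.
    by rewrite /=; ring.
  by apply: limN_D => //; exact: limN_Z.
have hw : `|w T| <= W T.
  have : `|expR (2 * lam * T) * w T - 0| <= expR (2 * lam * T) * W T - 0.
    apply: (limN_dom_bound (f := fun t => expR (2 * lam * t) * w t)
      (f' := fun t => expR (2 * lam * t) * g t)
      (W := fun t => expR (2 * lam * t) * W t)
      (W' := fun t => expR (2 * lam * t) * (2 * lam * W t + W' t))) => [t tT|t tT|t tT||].
    - have D1 := isD_explin (2 * lam) t; have D2 := dw t tT.
      isD_calc.
    - have D1 := isD_explin (2 * lam) t; have D2 := dW t tT.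
      isD_calc.
    - rewrite normrM ger0_norm ?expR_ge0 // ler_wpM2l ?expR_ge0 //.
      have := gW t tT; have := mulr_ge0 (ltW lam0) (W0 t tT); lra.
    - by apply: limN_exp_mul => //; lra.
    - by apply: limN_exp_mul => //; lra.
  by rewrite !subr0 normrM ger0_norm ?expR_ge0 // ler_pM2l ?expR_gt0.
split => //; rewrite ler_pdivlMr // mulrC -(ger0_norm (ltW lam0)) -normrM.
rewrite (_ : lam * (z T - z0) = (2 * lam * z T + w T - (2 * lam * z0 + 0) - w T) / 2);
  last by field.
rewrite normrM [`|2^-1|]ger0_norm ?invr_ge0 //.
have := ler_normB (2 * lam * z T + w T - (2 * lam * z0 + 0)) (w T); lra.
Qed.

(** The primitives [Q] of [g] and [J] of [e^(2 lam t) g] have limits [k] and [j] at [-oo].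
    Subtracting [j] selects the [w] that vanishes there, and [2 lam z + w] equal to [Q] up to a
    constant then determines [z]. *)
Lemma damped_solve lam g W W' (z0 : R) : 0 < lam -> (forall t, ctn g t) ->
  (forall t, isD W t (W' t)) -> (forall t, `|g t| <= W' t) -> limN W 0 ->
  exists z w, [/\ forall t, isD z t (w t), forall t, isD w t (g t - 2 * lam * w t),
    limN z z0 & limN w 0].
Proof.
move=> lam0 cg dW gW Wl.
have W'0 t : 0 <= W' t by apply: le_trans (gW t).
have W0 t : 0 <= W t by apply: (limN_dom_ge0 (W' := W')).
have dE t : isD (fun t => expR (2 * lam * t) * W t) t
    (expR (2 * lam * t) * (2 * lam * W t + W' t)).
  have D1 := isD_explin (2 * lam) t; have D2 := dW t.
  isD_calc.
have gE t : `|expR (2 * lam * t) * g t| <= expR (2 * lam * t) * (2 * lam * W t + W' t).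
  rewrite normrM ger0_norm ?expR_ge0 // ler_wpM2l ?expR_ge0 //.
  by have := gW t; have := mulr_ge0 (ltW lam0) (W0 t); lra.
have EWl : limN (fun t => expR (2 * lam * t) * W t) 0 by apply: limN_exp_mul => //; lra.
have [J dJ] : exists J, forall t, isD J t (expR (2 * lam * t) * g t).
  apply: primitive => t; apply: ctn_mul; last exact: cg.
  exact: isD_cont (isD_explin _ t).
have [j hj] := limN_dominated (T := 0) (fun t _ => dJ t) (fun t _ => dE t)
  (fun t _ => gE t) EWl.
have [Q dQ] := primitive cg.
have [k hk] := limN_dominated (T := 0) (fun t _ => dQ t) (fun t _ => dW t)
  (fun t _ => gW t) Wl.
pose w t := expR (- (2 * lam) * t) * (J t - j).
have dw t : isD w t (g t - 2 * lam * w t).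
  have D1 := isD_explin (- (2 * lam)) t; have D2 := dJ t.
  apply: isD_eq; first by rewrite /w; isD_auto.
  have e1 : expR (- (2 * lam) * t) * expR (2 * lam * t) = 1.
    by rewrite -expRD mulNr addNr expR0.
  by rewrite /w /= subr0 mulrA e1; ring.
have wW t : `|w t| <= W t.
  rewrite /w normrM ger0_norm ?expR_ge0 // mulNr expRN mulrC ler_pdivrMr ?expR_gt0 //.
  rewrite [W t * _]mulrC -[X in _ <= X]subr0.
  exact: (limN_dom_bound (f' := fun t => expR (2 * lam * t) * g t)
    (fun t _ => dJ t) (fun t _ => dE t) (fun t _ => gE t) hj EWl).
have wl : limN w 0.
  move=> e /Wl[T h]; exists T => t /h; rewrite !subr0.
  by move=> We; apply: le_lt_trans (wW t) (le_lt_trans (ler_norm _) We).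
exists (fun t => z0 + (2 * lam)^-1 * (Q t - k - w t)), w; split; [|exact: dw| |exact: wl].
  move=> t; have D1 := dQ t; have D2 := dw t.
  apply: isD_eq; first by isD_auto.
  by rewrite /=; field; rewrite gt_eqF //; lra.
rewrite -[X in limN _ X]addr0; apply: limN_D; first exact: limN_cst.
rewrite -(mulr0 (2 * lam)^-1); apply: limN_Z.
rewrite (_ : 0 = (k + -1 * k) + -1 * 0); last by ring.
have hQ := limN_D (limN_D hk (limN_cst (-1 * k))) (limN_Z (-1) wl).
by apply: (limN_ext (T := 0)) hQ => t _; ring.
Qed.

Lemma half_small c e : 0 < e -> exists k : nat, c * 2^-1 ^+ k < e.
Proof.
move=> e0; have [c0|c0] := leP c 0.
  by exists 0%N; rewrite expr0 mulr1 (le_lt_trans c0).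
have := archi_boundP (ltW (divr_gt0 c0 e0)); set k := Num.bound _ => hk.
exists k; rewrite exprVn ltr_pdivrMr ?exprn_gt0 // mulrC -ltr_pdivrMr //.
apply: lt_trans hk _; rewrite -natrX ltr_nat; exact: ltn_expl.
Qed.

(** The intervals of centre [u k] and radius [2 c 2^-k] are nested; the supremum of their left ends
    lies in all of them, which also gives the rate. *)
Lemma geometric_limit (u : nat -> R) c :
  (forall k, `|u k.+1 - u k| <= c * 2^-1 ^+ k) ->
  exists l, forall k, `|u k - l| <= 2 * c * 2^-1 ^+ k.
Proof.
move=> hu; pose r k := 2 * c * 2^-1 ^+ k.
have rS k : r k.+1 = r k - c * 2^-1 ^+ k by rewrite /r exprS; field.
have up j k : u (j + k)%N + r (j + k)%N <= u j + r j.
  elim: k => [|k IH]; first by rewrite addn0.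
  rewrite addnS rS; have := hu (j + k)%N; rewrite ler_norml => /andP[]; lra.
have lo j k : u j - r j <= u (j + k)%N - r (j + k)%N.
  elim: k => [|k IH]; first by rewrite addn0.
  rewrite addnS rS; have := hu (j + k)%N; rewrite ler_norml => /andP[]; lra.
have r0 k : 0 <= r k.
  have := hu k; have := normr_ge0 (u k.+1 - u k).
  rewrite /r -mulrA; set x := c * _; lra.
have cross j k : u j - r j <= u k + r k.
  have := up k j; have := lo j k; have := r0 (j + k)%N; rewrite addnC; lra.
pose S := [set u k - r k | k in [set: nat]].
have hS : has_sup S.
  by split; [exists (u 0%N - r 0%N), 0%N|exists (u 0%N + r 0%N) => _ [k _ <-]; exact: cross].
exists (sup S) => k.
have h1 : u k - r k <= sup S by apply: sup_upper_bound => //; exists k.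
have h2 : sup S <= u k + r k.
  by apply: sup_le_ub; [case: hS|move=> _ [j _ <-]; exact: cross].
by rewrite ler_norml -/(r k); lra.
Qed.

(** * Picard iteration with data at [-oo] *)

Section Picard.
Variables (lam L d : R) (om om' : R -> R) (G : R -> R -> R).
Hypotheses (lam0 : 0 < lam) (L0 : 0 < L).
Hypothesis dom : forall t, isD om t (om' t).
Hypothesis om'0 : forall t, 0 <= om' t.
Hypothesis oml : limN om 0.
Hypothesis G0 : forall t, G t 0 = 0.
Hypothesis GL : forall t x y, `|G t x - G t y| <= L * om' t * `|x - y|.
Hypothesis Gc : forall z : R -> R, (forall t, ctn z t) ->
  forall t, ctn (fun t => G t (z t)) t.

Let mu := 2 * L / lam.
(* Bielecki weight: in the corresponding norm the Volterra operator contracts by 1/2. *)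
Let E t := expR (mu * om t).

Let mu0 : 0 < mu.
Proof. by rewrite /mu divr_gt0 // mulr_gt0. Qed.

Let dE t : isD E t (mu * om' t * E t).
Proof.
have D1 := dom t; apply: isD_eq; first by rewrite /E; isD_auto.
by rewrite /E; ring.
Qed.

Let om_ge0 t : 0 <= om t.
Proof. by apply: (limN_dom_ge0 (W' := om')). Qed.

Let E1 t : 1 <= E t.
Proof. by rewrite /E -expR0 ler_expR mulr_ge0 // ltW. Qed.

Let Emono s t : s <= t -> E s <= E t.
Proof.
move=> st; rewrite /E ler_expR ler_wpM2l ?(ltW mu0) //.
by apply: (incrD (f' := om')).
Qed.

Let El : limN E 1.
Proof.
move=> e e0; have D := isD_explin mu 0; have := (isD_cont D) e e0.
move=> [r r0 hr]; have [T h] := oml r0; exists T => t /h omt.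
by have := hr (om t) omt; rewrite mulr0 expR0.
Qed.

Let adm (z : R -> R) := (forall t, ctn z t) /\
  exists2 C, 0 <= C & forall t, `|z t| <= C * E t.

(** The graph of the Volterra operator, kept as a relation because the operator is available only on
    admissible functions. *)
Let image (z zz ww : R -> R) := [/\ forall t, isD zz t (ww t),
  forall t, isD ww t (G t (z t) - 2 * lam * ww t), limN zz d & limN ww 0].

Let step z : adm z -> exists zz ww, image z zz ww.
Proof.
move=> [cz [C C0 zC]].
apply: (damped_solve (W := fun t => L * C / mu * (E t - 1)) (W' := fun t => L * C * om' t * E t)).
- exact: lam0.
- exact: Gc.
- move=> t; have D := dE t; apply: isD_eq; first by isD_auto.
  by rewrite /=; field; rewrite gt_eqF.
- move=> t; rewrite -[G t (z t)]subr0 -(G0 t); apply: le_trans (GL _ _ _) _.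
  rewrite subr0 (_ : L * C * _ * _ = L * om' t * (C * E t)); last by ring.
  by rewrite ler_wpM2l // mulr_ge0 // ltW.
- have := limN_Z (L * C / mu) (limN_D El (limN_cst (-1))).
  by rewrite subrr mulr0.
Qed.

(** The difference of the forces is at most [L c om' E], whose primitive vanishing at [-oo] is
    [(L c / mu)(E - 1)]. [damped_bound] divides it by [lam], and [mu = 2 L / lam] turns this into
    [c / 2]. *)
Let contract z1 zz1 ww1 z2 zz2 ww2 c : image z1 zz1 ww1 -> image z2 zz2 ww2 ->
  0 <= c -> (forall t, `|z1 t - z2 t| <= c * E t) ->
  forall t, `|zz1 t - zz2 t| <= c / 2 * (E t - 1).
Proof.
move=> [dz1 dw1 l1 k1] [dz2 dw2 l2 k2] c0 h t.
have [|||||||_ hb] := @damped_bound lam (fun t => zz1 t - zz2 t) (fun t => ww1 t - ww2 t)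
  (fun t => G t (z1 t) - G t (z2 t)) (fun t => L * c / mu * (E t - 1))
  (fun t => L * c * om' t * E t) 0 t lam0.
- by move=> s _; exact: (isD_add (dz1 s) (isD_opp (dz2 s))).
- move=> s _; apply: isD_eq; first exact: (isD_add (dw1 s) (isD_opp (dw2 s))).
  by ring.
- move=> s _; have D := dE s; apply: isD_eq; first by isD_auto.
  by rewrite /=; field; rewrite gt_eqF.
- move=> s _; apply: le_trans (GL _ _ _) _.
  rewrite (_ : L * c * _ * _ = L * om' s * (c * E s)); last by ring.
  by rewrite ler_wpM2l // mulr_ge0 // ltW.
- rewrite (_ : 0 = d + -1 * d); last by ring.
  have := limN_D l1 (limN_Z (-1) l2); apply: (limN_ext (T := 0)) => s _; ring.
- rewrite (_ : 0 = 0 + -1 * 0); last by ring.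
  have := limN_D k1 (limN_Z (-1) k2); apply: (limN_ext (T := 0)) => s _; ring.
- have := limN_Z (L * c / mu) (limN_D El (limN_cst (-1))).
  by rewrite subrr mulr0.
move: hb; rewrite subr0 (_ : L * c / mu * (E t - 1) / lam = c / 2 * (E t - 1)) //.
by rewrite /mu; field; rewrite !gt_eqF.
Qed.

(** Comparison with the constant [d], which is the image of the zero function since [G t 0 = 0]. *)
Let image_adm z zz ww : adm z -> image z zz ww -> adm zz.
Proof.
move=> [cz [C C0 zC]] I; split; first by case: I => dz _ _ _ t; exact: isD_cont (dz t).
have I0 : image (fun=> 0) (fun=> d) (fun=> 0).
  split => [t|t||]; [exact: isD_cst| |exact: limN_cst|exact: limN_cst].
  by apply: (isD_eq (isD_cst _ _)); rewrite G0; ring.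
exists (`|d| + C); first exact: addr_ge0.
move=> t; have := contract I I0 C0 (fun t => _) t.
have h s : `|z s - 0| <= C * E s by rewrite subr0.
move=> /(_ h) hz; rewrite -[zz t](subrK d) (le_trans (ler_normD _ _)) //.
have := E1 t; have := mulr_ge0 C0 (expR_ge0 (mu * om t)); rewrite -/(E t) => h1 h2.
have : `|d| <= `|d| * E t by rewrite ler_peMr.
by rewrite mulrDl; lra.
Qed.

(** The iterates from the constant [d] converge geometrically in the weighted norm, and their limit
    is a fixed point of the contraction. *)
Theorem picard : exists z w, [/\ forall t, isD z t (w t),
  forall t, isD w t (G t (z t) - 2 * lam * w t), limN z d & limN w 0].
Proof.
have [Phi hPhi] : exists Phi : (R -> R) -> (R -> R) * (R -> R),
    forall z, adm z -> image z (Phi z).1 (Phi z).2.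
  have /choice[Phi h] : forall z, exists p : (R -> R) * (R -> R), adm z -> image z p.1 p.2.
    move=> z; have [a|na] := pselect (adm z); last by exists (z, z).
    by have [zz [ww h]] := step a; exists (zz, ww).
  by exists Phi.
pose u k : R -> R := iter k (fun z => (Phi z).1) (fun=> d).
have au k : adm (u k).
  elim: k => [|k IH]; last by rewrite /u iterS; exact: image_adm IH (hPhi _ IH).
  split; first by move=> t; exact: ctn_cst.
  by exists `|d| => // t; rewrite ler_peMr.
have [C C0 hC] : exists2 C, 0 <= C & forall t, `|u 1%N t - u 0%N t| <= C * E t.
  have [_ [C C0 h]] := au 1%N; exists (C + `|d|); first exact: addr_ge0.
  move=> t; rewrite (le_trans (ler_normB _ _)) // mulrDl lerD //.
  by rewrite /u /= ler_peMr.
have hu k t : `|u k.+1 t - u k t| <= C * E t * 2^-1 ^+ k.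
  rewrite mulrAC; elim: k t => [|k IH] t; first by rewrite expr0 mulr1.
  have c0 : 0 <= C * 2^-1 ^+ k by rewrite mulr_ge0 // exprn_ge0 // invr_ge0.
  rewrite exprSr mulrA; apply: le_trans (contract (hPhi _ (au k.+1)) (hPhi _ (au k)) c0 IH t) _.
  by rewrite ler_wpM2l // ?mulr_ge0 ?invr_ge0 //; lra.
have /choice[z hz] : forall t, exists l, forall k, `|u k t - l| <= 2 * (C * E t) * 2^-1 ^+ k.
  by move=> t; apply: geometric_limit => k; exact: hu.
have az : adm z.
  split; last first.
    exists (`|d| + 2 * C); first by rewrite addr_ge0 // mulr_ge0.
    move=> t; have := hz t 0%N; rewrite expr0 mulr1 /u /= => h.
    rewrite -[z t](subKr d) (le_trans (ler_normB _ _)) // mulrDl lerD ?ler_peMr //.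
    by rewrite -mulrA.
  move=> t; move=> e e0.
  have e3 : 0 < e / 3 by lra.
  (* [E] is nondecreasing, so its value at [t + 1] makes the convergence uniform on a neighbourhood
     of [t]. *)
  have [k hk] := half_small (2 * (C * E (t + 1))) e3.
  have [r r0 hr] := ((au k).1 t) (e / 3) ltac:(lra).
  exists (Num.min r 1); first by rewrite lt_min r0 ltr01.
  move=> s; rewrite lt_min => /andP[sr s1].
  have bd x : x <= t + 1 -> `|u k x - z x| < e / 3.
    move=> xt; apply: le_lt_trans (hz x k) (le_lt_trans _ hk).
    rewrite ler_wpM2r ?exprn_ge0 ?invr_ge0 // ler_wpM2l // ler_wpM2l //.
    exact: Emono.
  have b1 := bd s ltac:(move: s1; rewrite ltr_norml; lra).
  have b2 := bd t ltac:(lra); have b3 := hr s sr.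
  rewrite (_ : z s - z t = - (u k s - z s) + (u k s - u k t) + (u k t - z t)); last by ring.
  apply: le_lt_trans (ler_normD _ _) _.
  by have := ler_normD (- (u k s - z s)) (u k s - u k t); rewrite normrN; lra.
have I := hPhi _ az.
(* Both sides are geometrically close to [u k.+1]: the left one by contraction, the right one by the
   rate of convergence. *)
have fix_z t : (Phi z).1 t = z t.
  apply/eqP; rewrite -subr_eq0 -normr_le0; apply/ler_addgt0Pr => e e0; rewrite add0r.
  have [k hk] := half_small (2 * C * E t) e0.
  have c0 : 0 <= 2 * C * 2^-1 ^+ k by rewrite !mulr_ge0 // exprn_ge0 // invr_ge0.
  have h s : `|z s - u k s| <= 2 * C * 2^-1 ^+ k * E s.
    by rewrite distrC (le_trans (hz s k)) // mulrA [X in _ <= X]mulrAC.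
  have h1 : `|(Phi z).1 t - u k.+1 t| <= 2 * C * 2^-1 ^+ k / 2 * (E t - 1).
    exact: contract I (hPhi _ (au k)) c0 h t.
  have h2 := hz t k.+1.
  have := ler_normD ((Phi z).1 t - u k.+1 t) (u k.+1 t - z t).
  rewrite addrA subrK => h3; apply: le_trans h3 _.
  rewrite exprS in h2.
  set x := 2^-1 ^+ k in h1 h2 hk c0.
  have e1 : 2 * C * x / 2 * (E t - 1) <= C * E t * x.
    rewrite (_ : _ / 2 * _ = C * E t * x - (2 * C * x) / 2); last by field.
    lra.
  have e2 : 2 * (C * E t) * (2^-1 * x) = C * E t * x by field.
  have e3 : 2 * C * E t * x = C * E t * x + C * E t * x by ring.
  lra.
exists z, (Phi z).2; have [I1 I2 I3 I4] := I; split => //.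
  by move=> t; apply: near_isD (I1 t); exists 1.
by apply: (limN_ext (T := 0)) I3 => t _; exact: fix_z.
Qed.

End Picard.

(** With [E = e^(L om / lam)] the barrier [B = (|z0| + e) E] satisfies [lam B' = L om' B], so
    [damped_bound] reproduces [B] minus its limit. The margin [e] makes the bound strict near [-oo],
    where the bootstrap starts, and is removed at the end. *)
Lemma damped_gronwall lam L om om' z w g (z0 : R) T : 0 < lam -> 0 <= L ->
  (forall t, isD om t (om' t)) -> (forall t, 0 <= om' t) -> limN om 0 ->
  (forall t, t <= T -> isD z t (w t)) ->
  (forall t, t <= T -> isD w t (g t - 2 * lam * w t)) ->
  (forall t, t <= T -> `|g t| <= L * om' t * `|z t|) ->
  limN z z0 -> limN w 0 ->
  `|z T| <= `|z0| * expR (L / lam * om T) /\ `|w T| <= lam * `|z0| * expR (L / lam * om T).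
Proof.
move=> lam0 L0 dom om'0 oml dz dw gz zl wl.
have om0 t : 0 <= om t by apply: (limN_dom_ge0 (W' := om')).
have Ll : 0 <= L / lam by rewrite divr_ge0 // ltW.
pose E t := expR (L / lam * om t).
have E1 t : 1 <= E t by rewrite /E -expR0 ler_expR mulr_ge0.
have dE t : isD E t (L / lam * om' t * E t).
  have D1 := dom t; apply: isD_eq; first by rewrite /E; isD_auto.
  by rewrite /E; ring.
have El : limN E 1.
  move=> e e0; have [r r0 hr] := (isD_cont (isD_explin (L / lam) 0)) e e0.
  have [T1 h] := oml r r0; exists T1 => t /h omt.
  by have := hr (om t) omt; rewrite mulr0 expR0.
have key e : 0 < e -> `|z T| <= (`|z0| + e) * E T /\ `|w T| <= lam * ((`|z0| + e) * E T).
  move=> e0; pose B t := (`|z0| + e) * E t.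
  have c0 : 0 < `|z0| + e by rewrite ltr_wpDl.
  have Bc t : `|z0| + e <= B t by rewrite /B ler_peMr // ltW.
  have VE t : t <= T -> (forall s, s <= t -> `|z s| <= B s) ->
      `|w t| <= lam * (B t - (`|z0| + e)) /\ `|z t - z0| <= B t - (`|z0| + e).
    move=> tT hB.
    have [|||||||h1 h2] := @damped_bound lam z w g (fun t => lam * (B t - (`|z0| + e)))
      (fun t => L * om' t * B t) z0 t lam0.
    - by move=> s st; apply: dz; lra.
    - by move=> s st; apply: dw; lra.
    - move=> s _; have D := dE s; apply: isD_eq; first by rewrite /B; isD_auto.
      by rewrite /B /=; field; rewrite gt_eqF.
    - move=> s st; rewrite (le_trans (gz s _)) //; first lra.
      by rewrite ler_wpM2l ?mulr_ge0 ?hB.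
    - exact: zl.
    - exact: wl.
    - have := limN_Z lam (limN_D (limN_Z (`|z0| + e) El) (limN_cst (- (`|z0| + e)))).
      by rewrite mulr1 subrr mulr0.
    by split => //; move: h2; rewrite mulrAC mulfV ?gt_eqF // mul1r.
  have [T0 hT0] := zl e e0.
  have near s : s <= T0 -> `|z s| < B s.
    move=> /hT0 h; rewrite (lt_le_trans _ (Bc s)) // -[z s](subrK z0).
    by rewrite (le_lt_trans (ler_normD _ _)) //; lra.
  have all t : t <= T -> `|z t| < B t.
    move=> tT; have [/near//|T0t] := leP t T0; rewrite -subr_lt0.
    apply: (@bootstrap _ (fun t => `|z t| - B t) T0 T).
    - move=> s /andP[_ sT].
      apply: ctn_sub; last exact: isD_cont (isD_mul (isD_cst _ s) (dE s)).
      exact: ctn_norm (isD_cont (dz s sT)).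
    - by rewrite subr_lt0 near.
    - move=> s /andP[T0s sT] hs; rewrite subr_lt0.
      have [|_] := VE s sT.
        move=> r rs; have [/near/ltW//|T0r] := leP r T0.
        by rewrite -subr_le0 hs // (ltW T0r).
      move=> h; rewrite -[z s](subrK z0) (le_lt_trans (ler_normD _ _)) //; lra.
    - by rewrite (ltW T0t).
  have [|h1 h2] := VE T (lexx T); first by move=> s sT; exact/ltW/all.
  split; first exact/ltW/all.
  by apply: le_trans h1 _; rewrite -/(B T) ler_pM2l // gerBl ltW.
have ET : 0 < E T by rewrite expR_gt0.
(* The margin is rescaled so that the excess after the amplification factor is exactly [e]. *)
split; apply/ler_addgt0Pr => e e0.
  have [] := key (e / E T) (divr_gt0 e0 ET).
  by rewrite mulrDl divfK ?gt_eqF.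
have [_] := key (e / (lam * E T)) (divr_gt0 e0 (mulr_gt0 lam0 ET)).
rewrite -/(E T) (_ : lam * _ = lam * `|z0| * E T + e) //.
by field; rewrite !gt_eqF.
Qed.

End Volterra.

(** * The equation in logarithmic time *)

(* [om] and [F] are primitives of integrable majorants at [-oo] and [+oo]. *)
Record emden_data (R : realType) (p l0 l1 gam kap t0 FL : R)
    (a b b1 om om1 F F1 : R -> R) : Prop := {
  p_gt0 : 0 < p; l0_gt0 : 0 < l0; gam_gt0 : 0 < gam; gam_lt : gam < l1; kap_gt0 : 0 < kap;
  a_cont : forall t, ctn a t;
  a_gt0 : forall t, 0 < a t;
  b_der : forall t, isD b t (b1 t);
  b1_cont : forall t, ctn b1 t;
  b_neg : forall t, t < t0 -> b t < 0;
  b_pos : forall t, t0 < t -> 0 < b t;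
  om_der : forall t, isD om t (om1 t);
  om1_ge : forall t, `|a t - l0 ^+ 2| + `|b t| * expR (p * l0 * t) <= om1 t;
  om_lim : limN om 0;
  a_lim : limP a (l1 ^+ 2);
  F_der : forall t, isD F t (F1 t);
  F1_ge : forall t, `|a t - l1 ^+ 2| <= F1 t;
  F_lim : limP F FL;
  b_lim : limP (fun t => b t * expR (p * gam * t)) kap }.

Lemma limN_deriv0 (R : realType) (z w : R -> R) (d k T : R) :
  (forall t, t <= T -> isD z t (w t)) -> limN z d -> limN w k -> k = 0.
Proof.
have pos (z' w' : R -> R) (d' k' : R) : (forall t, t <= T -> isD z' t (w' t)) ->
    limN z' d' -> limN w' k' -> k' <= 0.
  move=> dz zl wl; rewrite leNgt; apply/negP => k0.
  have [T1 h1] := zl 1 ltac:(lra); have [T2 h2] := wl (k' / 2) ltac:(lra).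
  pose S := Num.min T (Num.min T1 T2).
  have ST : S <= T by rewrite ge_min lexx.
  have S1 : S <= T1 by rewrite /S !ge_min lexx !orbT.
  have S2 : S <= T2 by rewrite /S !ge_min lexx !orbT.
  (* On an interval of length [4 / k'] a slope of at least [k' / 2] produces an increase of [2],
     whereas two values within [1] of [d'] differ by less. *)
  have k4 : 0 <= 4 / k' by rewrite divr_ge0 // ltW.
  have : k' / 2 * S - k' / 2 * (S - 4 / k') <= z' S - z' (S - 4 / k').
    suff : z' (S - 4 / k') - k' / 2 * (S - 4 / k') <= z' S - k' / 2 * S by lra.
    apply: (incrD (f := fun t => z' t - k' / 2 * t) (f' := fun t => w' t - k' / 2)); first lra.
      move=> t /andP[_ tS]; have D1 := dz t ltac:(lra); have D2 := isD_lin (k' / 2) t.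
      by apply: isD_add D1 (isD_opp D2).
    by move=> t /andP[_ tS]; have := h2 t ltac:(lra); rewrite ltr_norml => /andP[]; lra.
  have -> : k' / 2 * S - k' / 2 * (S - 4 / k') = 2 by field; rewrite gt_eqF.
  have := h1 S S1; have := h1 (S - 4 / k') ltac:(lra).
  by rewrite !ltr_norml => /andP[? ?] /andP[? ?]; lra.
move=> dz zl wl; apply/eqP; rewrite eq_le (pos z w d k) //=.
rewrite -oppr_le0 -mulN1r.
apply: (pos (fun t => -1 * z t) (fun t => -1 * w t) (-1 * d)); [|exact: limN_Z..].
move=> t tT; have D := dz t tT; isD_calc.
Qed.

Section Solutions.
Variables (R : realType) (p l0 l1 gam kap t0 FL : R) (a b b1 om om1 F F1 : R -> R).
Hypothesis H : emden_data p l0 l1 gam kap t0 FL a b b1 om om1 F F1.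
Implicit Types (y v z w : R -> R) (t T M d s : R).

Definition Rsol d y v := [/\ forall t, isD y t (v t),
  forall t, isD v t (a t * y t - b t * npow p (y t)) & limN (fun t => expR (- l0 * t) * y t) d].

(* [z = exp (- l0 t) y] satisfies [z'' + 2 l0 z' = force t z], and [force] is
   Lipschitz with a constant integrable at [-oo]. *)
Definition force t (z : R) := (a t - l0 ^+ 2) * z - b t * expR (p * l0 * t) * npow p z.
Definition tforce M t (z : R) :=
  (a t - l0 ^+ 2) * z - b t * expR (p * l0 * t) * npow p (clamp M z).

(** Only the truncated problem [tsol] includes the limit of [w]: R-solutions prescribe the limit of
    [z] alone, and [lsol_wlim] recovers the other. *)
Definition lsol T d z w := [/\ forall t, t <= T -> isD z t (w t),
  forall t, t <= T -> isD w t (force t (z t) - 2 * l0 * w t) & limN z d].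
Definition tsol M T d z w := [/\ forall t, t <= T -> isD z t (w t),
  forall t, t <= T -> isD w t (tforce M t (z t) - 2 * l0 * w t), limN z d & limN w 0].

Let p0 := p_gt0 H.
Let lam0 := l0_gt0 H.

Lemma om1_ge0 t : 0 <= om1 t.
Proof. by apply: le_trans (om1_ge H t); rewrite addr_ge0 // mulr_ge0 ?expR_ge0. Qed.

Lemma om_ge0 t : 0 <= om t.
Proof. by apply: (limN_dom_ge0 (W' := om1)) => [s _|s _|]; [exact: om_der H s|exact: om1_ge0|exact: om_lim H]. Qed.

Lemma om_mono s t : s <= t -> om s <= om t.
Proof. by move=> st; apply: (incrD st) => r _; [exact: om_der H r|exact: om1_ge0]. Qed.

Definition lip M := 1 + (p + 1) * pw p M.

Lemma lip_gt0 M : 0 < lip M.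
Proof.
have h1 : 0 <= p + 1 by have := p0; move=> ?; lra.
by have := mulr_ge0 h1 (pw_ge0 p M); rewrite /lip; lra.
Qed.

Lemma tforce_lip M t (x y : R) : 0 <= M -> `|tforce M t x - tforce M t y| <= lip M * om1 t * `|x - y|.
Proof.
move=> M0; have h := npow_clamp_lip p0 x y M0.
rewrite (_ : _ - _ = (a t - l0 ^+ 2) * (x - y)
  - b t * expR (p * l0 * t) * (npow p (clamp M x) - npow p (clamp M y))); last by rewrite /tforce; ring.
apply: le_trans (ler_normB _ _) _; rewrite !normrM (ger0_norm (expR_ge0 _)).
have := om1_ge H t; set A := `|a t - _|; set B := `|b t| * _ => hAB.
have A0 : 0 <= A by exact: normr_ge0.
have B0 : 0 <= B by rewrite mulr_ge0 ?expR_ge0.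
have X0 := normr_ge0 (x - y).
have c0 : 0 <= (p + 1) * pw p M by apply: mulr_ge0 (pw_ge0 _ _); have := p0; move=> ?; lra.
set X := `|x - y| in h X0 *; set N := `|npow _ _ - _| in h *.
apply: (@le_trans _ _ (A * X + B * ((p + 1) * pw p M * X))).
  by rewrite lerD2l ler_wpM2l.
rewrite (_ : A * X + _ = (A + B * ((p + 1) * pw p M)) * X); last by ring.
rewrite ler_wpM2r //.
have q1 : 0 <= A * ((p + 1) * pw p M) by exact: mulr_ge0.
have q2 : lip M * (A + B) <= lip M * om1 t by rewrite ler_wpM2l // ltW // lip_gt0.
by apply: le_trans q2; rewrite /lip; lra.
Qed.

Lemma tforce_cont M z : 0 <= M -> (forall t, ctn z t) ->
  forall t, ctn (fun t => tforce M t (z t)) t.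
Proof.
move=> M0 cz t.
have c1 : ctn (fun s => (a s - l0 ^+ 2) * z s) t.
  by apply: ctn_mul (cz t); apply: ctn_sub (a_cont H t) (ctn_cst _ _).
have c2 : ctn (fun s => b s * expR (p * l0 * s)) t.
  exact: isD_cont (isD_mul (b_der H t) (isD_explin _ t)).
have c3 : ctn (fun s => npow p (clamp M (z s))) t.
  exact: (ctn_comp (f := fun x => npow p (clamp M x)) (npow_clamp_cont p0 (z t) M0) (cz t)).
exact: ctn_sub c1 (ctn_mul c2 c3).
Qed.

Lemma tsol_exists M d : 0 <= M -> exists z w, forall T, tsol M T d z w.
Proof.
move=> M0; have [|||t x y|z zc|z [w [h1 h2 h3 h4]]] := @picard R l0 (lip M) d om om1 (tforce M) lam0 (lip_gt0 M) (om_der H).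
- exact: om1_ge0.
- exact: om_lim H.
- by move=> t; rewrite /tforce clamp_id ?normr0 // npow0 !mulr0 subr0.
- exact: tforce_lip.
- exact: tforce_cont.
by exists z, w => T; split => // t _.
Qed.

Definition amp M T := expR (lip M / l0 * om T).

Lemma amp_mono M s t : s <= t -> amp M s <= amp M t.
Proof.
move=> st; rewrite /amp ler_expR ler_wpM2l ?om_mono // divr_ge0 ?ltW //.
exact: lip_gt0.
Qed.

Lemma tsol_close M T d1 d2 z1 w1 z2 w2 : 0 <= M -> tsol M T d1 z1 w1 -> tsol M T d2 z2 w2 ->
  forall t, t <= T -> `|z1 t - z2 t| <= `|d1 - d2| * amp M t /\
    `|w1 t - w2 t| <= l0 * `|d1 - d2| * amp M t.
Proof.
move=> M0 [a1 a2 a3 a4] [c1 c2 c3 c4] t tT.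
apply: (@damped_gronwall R l0 (lip M) om om1 (fun t => z1 t - z2 t) (fun t => w1 t - w2 t)
  (fun t => tforce M t (z1 t) - tforce M t (z2 t)) (d1 - d2) t).
- exact: lam0.
- exact/ltW/lip_gt0.
- exact: om_der H.
- exact: om1_ge0.
- exact: om_lim H.
- by move=> s st; exact: isD_add (a1 s ltac:(lra)) (isD_opp (c1 s ltac:(lra))).
- move=> s st; apply: (isD_eq (isD_add (a2 s ltac:(lra)) (isD_opp (c2 s ltac:(lra))))).
  by ring.
- by move=> s _; exact: tforce_lip.
- have := limN_D a3 (limN_Z (-1) c3); rewrite mulN1r.
  by apply: (limN_ext (T := 0)) => s _; rewrite mulN1r.
- have := limN_D a4 (limN_Z (-1) c4); rewrite mulr0 addr0.
  by apply: (limN_ext (T := 0)) => s _; rewrite mulN1r.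
Qed.

(** [2 l0 z + w] has the derivative [force], which is integrable at [-oo] because [z] is bounded
    there. Hence [w] converges, and its limit is [0] because [z] converges too. *)
Lemma lsol_wlim T d z w : lsol T d z w -> limN w 0.
Proof.
move=> [dz dw zl].
have [T1 hM] := limN_bound zl; set M := `|d| + 1 in hM.
have M0 : 0 <= M by rewrite addr_ge0.
pose S := Num.min T T1.
have ST : S <= T by rewrite ge_min lexx.
have S1 : S <= T1 by rewrite ge_min lexx orbT.
have [||||Q0 hQ] := @limN_dominated R (fun t => 2 * l0 * z t + w t) (fun t => force t (z t))
  (fun t => lip M * M * om t) (fun t => lip M * M * om1 t) (lip M * M * 0) S.
- move=> t tS; have D1 := dz t ltac:(lra); have D2 := dw t ltac:(lra); isD_calc.
- by move=> t _; have D := om_der H t; isD_calc.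
- move=> t tS; have zM := hM t ltac:(lra).
  have := tforce_lip t (z t) 0 M0.
  rewrite /tforce !clamp_id ?normr0 // npow0 !mulr0 !subr0 -/(force t (z t)) => h.
  apply: le_trans h _; rewrite mulrAC ler_wpM2r ?om1_ge0 // ler_wpM2l //.
  exact/ltW/lip_gt0.
- exact: limN_Z (om_lim H).
have wl : limN w (Q0 + - (2 * l0) * d).
  have := limN_D hQ (limN_Z (- (2 * l0)) zl).
  by apply: (limN_ext (T := 0)) => t _; ring.
by rewrite -(limN_deriv0 dz zl wl).
Qed.

Lemma lsol_tsol M T d z w : lsol T d z w -> (forall t, t <= T -> `|z t| <= M) -> tsol M T d z w.
Proof.
move=> S hM; have wl := lsol_wlim S; have [dz dw zl] := S; split => // t tT.
by rewrite /tforce clamp_id ?hM //; exact: dw.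
Qed.

Lemma tsol_lsol M T d z w : tsol M T d z w -> (forall t, t <= T -> `|z t| <= M) -> lsol T d z w.
Proof.
move=> [dz dw zl wl] hM; split => // t tT.
by have := dw t tT; rewrite /tforce clamp_id ?hM.
Qed.

Lemma lsol_bounded T d z w : lsol T d z w -> exists2 M, 0 <= M & forall t, t <= T -> `|z t| <= M.
Proof.
move=> [dz _ zl]; have [T1 h1] := limN_bound zl.
have [M M0 hM] := @cont_bounded _ z T1 T (fun t h => isD_cont (dz t ltac:(lra))).
exists (`|d| + 1 + M); first by have := normr_ge0 d; lra.
move=> t tT; have [/h1|/ltW T1t] := leP t T1; first lra.
by have := hM t; rewrite T1t tT => /(_ isT); have := normr_ge0 d; lra.
Qed.

Lemma lsol_le T T' d z w : T' <= T -> lsol T d z w -> lsol T' d z w.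
Proof. by move=> TT [dz dw zl]; split=> // t tT; [apply: dz|apply: dw]; lra. Qed.

(** Both solutions are bounded, so they solve one truncated problem, to which the Gronwall bound
    applies with equal data. *)
Lemma lsol_uniq T d z1 w1 z2 w2 : lsol T d z1 w1 -> lsol T d z2 w2 ->
  forall t, t <= T -> z1 t = z2 t /\ w1 t = w2 t.
Proof.
move=> S1 S2; have [M1 M10 h1] := lsol_bounded S1; have [M2 M20 h2] := lsol_bounded S2.
have M0 : 0 <= M1 + M2 by lra.
have T1 : tsol (M1 + M2) T d z1 w1 by apply: lsol_tsol => // t /h1; lra.
have T2 : tsol (M1 + M2) T d z2 w2 by apply: lsol_tsol => // t /h2; lra.
move=> t tT; have [] := tsol_close M0 T1 T2 tT.
rewrite subrr normr0 mulr0 mul0r !normr_le0 !subr_eq0.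
by move=> /eqP-> /eqP->.
Qed.

Lemma scaled_lsol T d y v : (forall t, t <= T -> isD y t (v t)) ->
  (forall t, t <= T -> isD v t (a t * y t - b t * npow p (y t))) ->
  limN (fun t => expR (- l0 * t) * y t) d ->
  lsol T d (fun t => expR (- l0 * t) * y t) (fun t => expR (- l0 * t) * (v t - l0 * y t)).
Proof.
move=> dy dv yl; split=> [t tT|t tT|]; [| |exact: yl]; have D1 := isD_explin (- l0) t; have D2 := dy t tT;
  have D3 := dv t tT; first by apply: isD_eq; [isD_auto|rewrite /=; ring].
apply: isD_eq; first by isD_auto.
rewrite /force /= npowM /npow (pw_expR p) -/(npow p (y t)).
have e1 : expR (p * l0 * t) * expR (p * (- l0 * t)) = 1.
  by rewrite -expRD (_ : _ + _ = 0) ?expR0 //; ring.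
have -> : b t * expR (p * l0 * t) * (expR (- l0 * t) * expR (p * (- l0 * t)) * npow p (y t)) =
  (expR (p * l0 * t) * expR (p * (- l0 * t))) * (b t * expR (- l0 * t) * npow p (y t)) by ring.
by rewrite e1; rewrite /npow; ring.
Qed.

Lemma Rsol_lsol d y v : Rsol d y v ->
  forall T, lsol T d (fun t => expR (- l0 * t) * y t) (fun t => expR (- l0 * t) * (v t - l0 * y t)).
Proof. by move=> [dy dv yl] T; exact: scaled_lsol. Qed.

Lemma lsol_der T d z w : lsol T d z w -> forall t, t <= T ->
  isD (fun t => expR (l0 * t) * z t) t (expR (l0 * t) * (w t + l0 * z t)) /\
  isD (fun t => expR (l0 * t) * (w t + l0 * z t)) t
    (a t * (expR (l0 * t) * z t) - b t * npow p (expR (l0 * t) * z t)).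
Proof.
move=> [dz dw zl] t tT; have D1 := isD_explin l0 t; have D2 := dz t tT; have D3 := dw t tT.
split; first by isD_calc.
apply: isD_eq; first by isD_auto.
rewrite /force /= npowM {2}/npow (pw_expR p) (_ : p * (l0 * t) = p * l0 * t); last by ring.
by ring.
Qed.

(** By uniqueness the local solutions agree. At time [t] the one living up to [t + 1] is used, which
    leaves room to differentiate on both sides. *)
Lemma Rsol_glue d : (forall T, exists z w, lsol T d z w) -> exists y v, Rsol d y v.
Proof.
move=> /choice[Z] /choice[W S].
pose zz t := Z (t + 1) t; pose ww t := W (t + 1) t.
have same t s : `|s - t| < 1 -> zz s = Z (t + 2) s /\ ww s = W (t + 2) s.
  rewrite ltr_norml => /andP[h1 h2].
  have S1 : lsol s d (Z (s + 1)) (W (s + 1)) by apply: (lsol_le _ (S (s + 1))); lra.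
  have S2 : lsol s d (Z (t + 2)) (W (t + 2)) by apply: (lsol_le _ (S (t + 2))); lra.
  have h := lsol_uniq S1 S2 (lexx s).
  by [].
have SS T : lsol T d zz ww.
  have [_ _ zl] := S 0.
  split => [t _|t _|]; last first.
  - apply: (limN_ext (T := -2)) zl => t t1; rewrite /zz.
    by have [] := lsol_uniq (T := t) (lsol_le _ (S 0)) (lsol_le _ (S (t + 1))) (lexx t); lra.
  - have [dz dw _] := S (t + 2).
    apply: (@near_isD _ (W (t + 2))); first by exists 1 => // s /same[_ ->].
    have [-> ->] := same t t ltac:(by rewrite subrr normr0).
    by apply: dw; lra.
  - have [dz dw _] := S (t + 2).
    apply: (@near_isD _ (Z (t + 2))); first by exists 1 => // s /same[->].
    have [_ ->] := same t t ltac:(by rewrite subrr normr0).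
    by apply: dz; lra.
exists (fun t => expR (l0 * t) * zz t), (fun t => expR (l0 * t) * (ww t + l0 * zz t)).
split=> [t|t|].
- by have [] := lsol_der (SS t) (lexx t).
- by have [] := lsol_der (SS t) (lexx t).
have [_ _ zl] := SS 0; apply: (limN_ext (T := 0)) zl => t _.
by rewrite mulrA -expRD mulNr addNr expR0 mul1r.
Qed.

(** The truncated solution is global, agrees with [z] up to [t0] and stays below its truncation
    level for a while. This step past [t0] is needed because the energy is controlled only where [b]
    has a positive lower bound. *)
Lemma lsol_step d z w : lsol t0 d z w -> exists2 tau, t0 < tau & exists z1 w1, lsol tau d z1 w1.
Proof.
move=> S; have [M M0 hM] := lsol_bounded S.
have M1 : 0 <= M + 1 by lra.
have [z1 [w1 S1]] := tsol_exists d M1.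
have S' : tsol (M + 1) t0 d z w by apply: lsol_tsol => // t /hM; lra.
have e t : t <= t0 -> z1 t = z t.
  move=> tt; have [h _] := tsol_close M1 (S1 t0) S' tt.
  by move: h; rewrite subrr normr0 mul0r normr_le0 subr_eq0 => /eqP.
have [dz1 _ _ _] := S1 (t0 + 1).
have [r r0 hr] := (isD_cont (dz1 t0 ltac:(lra))) 1 ltr01.
exists (t0 + r / 2); first lra.
exists z1, w1; apply: tsol_lsol (S1 _) _ => t tt.
have [h|h] := leP t t0; first by rewrite e //; have := hM t h; lra.
have := hr t; rewrite gtr0_norm; last by lra.
move=> /(_ ltac:(lra)) h1; have := hM t0 (lexx _); rewrite -(e t0) // => h2.
by rewrite -[z1 t](subrK (z1 t0)) (le_trans (ler_normD _ _)) //; lra.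
Qed.

(* The energy [v^2/2 + b |y|^(p+2)/(p+2) + y^2/2] grows at most exponentially where [b > 0]. *)
Lemma lsol_energy tau T d z1 w1 : t0 < tau -> tau <= T -> lsol tau d z1 w1 ->
  exists2 M, 0 <= M & forall t z w, tau <= t <= T -> lsol t d z w -> `|z t| <= M.
Proof.
move=> t0tau tauT S1.
pose e x z w := let y := expR (l0 * x) * z x in let v := expR (l0 * x) * (w x + l0 * z x) in
  v ^+ 2 / 2 + b x * gpow p y + y ^+ 2 / 2.
have [A A0 hA] := cont_bounded (a := tau) (b := T) (fun t _ => a_cont H t).
have [B B0 hB] := cont_bounded (a := tau) (b := T) (fun t _ => b1_cont H t).
have [m m0 hm] := cont_pos_min tauT (fun t _ => isD_cont (b_der H t))
  (fun t h => b_pos H (lt_le_trans t0tau (proj1 (andP h)))).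
(* [A + 1] absorbs the term [(a + 1) y v], and [B / m] absorbs the derivative of [b] in the
   potential energy. *)
pose C := A + 1 + B / m.
have Bm : 0 <= B / m by rewrite divr_ge0 // ltW.
have C0 : 0 <= C by rewrite /C; lra.
have e_ge0 x z w : tau <= x <= T -> (expR (l0 * x) * z x) ^+ 2 / 2 <= e x z w.
  move=> xT; have := hm x xT => bx.
  have h1 := sqr_ge0 (expR (l0 * x) * (w x + l0 * z x)).
  have h2 : 0 <= b x * gpow p (expR (l0 * x) * z x) by rewrite mulr_ge0 ?gpow_ge0 //; lra.
  by rewrite /e; lra.
have grow t z w : tau <= t <= T -> lsol t d z w -> e t z w * expR (- C * t) <= e tau z w * expR (- C * tau).
  move=> /andP[taut tT] S; rewrite -lerN2.
  apply: (incrD (f := fun x => - (e x z w * expR (- C * x)))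
    (f' := fun x => let y := expR (l0 * x) * z x in let v := expR (l0 * x) * (w x + l0 * z x) in
       expR (- C * x) * (C * e x z w - ((a x + 1) * (y * v) + b1 x * gpow p y))) taut) => x /andP[taux xt].
    have [D1 D2] := lsol_der S xt; rewrite /e.
    set y := fun x => expR (l0 * x) * z x in D1 D2 *.
    set v := fun x => expR (l0 * x) * (w x + l0 * z x) in D1 D2 *.
    have D3 : isD (fun s => gpow p (y s)) x (npow p (y x) * v x).
      exact: isD_comp (isD_gpow p0 _) D1.
    have D4 := b_der H x; have D5 := isD_explin (- C) x.
    have D6 : isD (fun x => v x ^+ 2 / 2) x (v x * (a x * y x - b x * npow p (y x))).
      by apply: isD_eq; [isD_auto|rewrite /y /v /=; field].
    have D7 : isD (fun x => y x ^+ 2 / 2) x (y x * v x).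
      by apply: isD_eq; [isD_auto|rewrite /y /v /=; field].
    have D8 : isD (fun s => b s * gpow p (y s)) x (b1 x * gpow p (y x) + b x * (npow p (y x) * v x)).
      by isD_calc.
    have D9 := isD_add (isD_add D6 D8) D7.
    by apply: (isD_eq (isD_opp (isD_mul D9 D5))); rewrite /y /v /=; ring.
  cbv zeta; apply: mulr_ge0; first exact: expR_ge0.
  rewrite /e; set y := expR (l0 * x) * z x; set v := expR (l0 * x) * (w x + l0 * z x).
  have xT : tau <= x <= T by rewrite taux (le_trans xt).
  have g0 := gpow_ge0 p0 y.
  have h1 : (a x + 1) * (y * v) <= (A + 1) * ((y ^+ 2 + v ^+ 2) / 2).
    apply: le_trans (ler_norm _) _; rewrite normrM; apply: ler_pM => //.
      by rewrite (le_trans (ler_normD _ _)) // normr1; have := hA x xT; lra.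
    by rewrite ler_norml; have := sqr_ge0 (y + v); have := sqr_ge0 (y - v); rewrite !expr2; lra.
  have h2 : b1 x * gpow p y <= B / m * (b x * gpow p y).
    rewrite [X in _ <= X]mulrA ler_wpM2r //; have := hB x xT; have := ler_norm (b1 x).
    have : B <= B / m * b x by rewrite mulrAC ler_pdivlMr // ler_wpM2l ?hm // ltW.
    lra.
  have bg : 0 <= b x * gpow p y by rewrite mulr_ge0 //; have := hm x xT; lra.
  have q1 := sqr_ge0 y; have q2 := sqr_ge0 v.
  have q3 : 0 <= A * (b x * gpow p y) by rewrite mulr_ge0 // ltW.
  have q4 : 0 <= B / m * ((y ^+ 2 + v ^+ 2) / 2) by apply: mulr_ge0 => //; lra.
  rewrite /C.
  rewrite (_ : _ * (_ + _ + _) = (A + 1) * ((y ^+ 2 + v ^+ 2) / 2) + B / m * (b x * gpow p y)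
    + b x * gpow p y + A * (b x * gpow p y) + B / m * ((y ^+ 2 + v ^+ 2) / 2)); last by ring.
  lra.
pose K := e tau z1 w1 * expR (C * (T - tau)).
exists (expR (- l0 * tau) * Num.sqrt (2 * K)); first by rewrite mulr_ge0 ?expR_ge0 ?sqrtr_ge0.
move=> t z w tT S; have /andP[taut tT'] := tT.
have [z1e w1e] : z1 tau = z tau /\ w1 tau = w tau by have h := lsol_uniq S1 (lsol_le taut S) (lexx tau).
have h1 := grow t z w tT S; have h2 := e_ge0 t z w tT.
have e1 : e tau z w = e tau z1 w1 by rewrite /e z1e w1e.
have etau0 : 0 <= e tau z1 w1.
  by apply: le_trans (e_ge0 tau z1 w1 _); rewrite ?lexx ?tauT // divr_ge0 // sqr_ge0.
have h3 : e t z w <= K.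
  rewrite -(ler_pM2r (expR_gt0 (- C * t))) (le_trans h1) // e1 /K -mulrA -expRD ler_wpM2l //.
  rewrite ler_expR (_ : C * (T - tau) + - C * t = - C * tau + C * (T - t)); last by ring.
  by rewrite lerDl mulr_ge0 // subr_ge0.
have h4 : expR (l0 * t) * `|z t| <= Num.sqrt (2 * K).
  rewrite -(ger0_norm (expR_ge0 _)) -normrM -sqrtr_sqr ler_wsqrtr //; lra.
have -> : `|z t| = expR (- l0 * t) * (expR (l0 * t) * `|z t|).
  by rewrite mulrA -expRD mulNr addNr expR0 mul1r.
apply: ler_pM; rewrite ?expR_ge0 ?mulr_ge0 ?expR_ge0 // ler_expR !mulNr lerN2.
by rewrite ler_wpM2l // ltW.
Qed.

(** The equation is truncated above the energy bound. As long as the truncation is inactive that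
    bound applies, so by the bootstrap it never becomes active. *)
Lemma lsol_extend d z w : lsol t0 d z w -> exists y v, Rsol d y v.
Proof.
move=> /lsol_step[tau t0tau [z1 [w1 S1]]]; apply: Rsol_glue => T.
have [Ttau|/ltW tauT] := leP T tau; first by exists z1, w1; exact: lsol_le S1.
have [M M0 hM] := lsol_energy t0tau tauT S1.
have [M1 M10 hM1] := lsol_bounded S1.
pose N := M + M1 + 1; have N0 : 0 <= N by rewrite /N; lra.
have [zz [ww SS]] := tsol_exists d N0.
have S1' : tsol N tau d z1 w1 by apply: lsol_tsol => // t /hM1; rewrite /N; lra.
have below t : t <= tau -> `|zz t| <= M1.
  move=> tt; have [h _] := tsol_close N0 (SS tau) S1' tt.
  by move: h; rewrite subrr normr0 mul0r normr_le0 subr_eq0 => /eqP->; exact: hM1.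
have cz t : ctn zz t by have [dz _ _ _] := SS t; exact: isD_cont (dz t (lexx t)).
have above t : tau <= t <= T -> `|zz t| - N < 0.
  apply: (@bootstrap _ (fun t => `|zz t| - N)).
  - by move=> s _; apply: ctn_sub (ctn_norm (cz s)) (ctn_cst _ _).
  - by have := below tau (lexx _); rewrite /N; lra.
  - move=> s /andP[taus sT] hs.
    have : lsol s d zz ww.
      apply: tsol_lsol (SS s) _ => r rs; have [/below|/ltW taur] := leP r tau; first by rewrite /N; lra.
      by have := hs r; rewrite taur rs => /(_ isT); lra.
    by move=> /(hM s zz ww _); rewrite (ltW taus) sT => /(_ isT); rewrite /N; lra.
exists zz, ww; apply: tsol_lsol (SS T) _ => t tT; have [/below|/ltW taut] := leP t tau.
  by rewrite /N; lra.
by have := above t; rewrite taut tT => /(_ isT); lra.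
Qed.

Lemma Rsol_uniq d y1 v1 y2 v2 : Rsol d y1 v1 -> Rsol d y2 v2 -> forall t, y1 t = y2 t /\ v1 t = v2 t.
Proof.
move=> /Rsol_lsol S1 /Rsol_lsol S2 t; have [] := lsol_uniq (S1 t) (S2 t) (lexx t).
move/(mulfI (negbT (gt_eqF (expR_gt0 _)))) => e1 /(mulfI (negbT (gt_eqF (expR_gt0 _)))).
by rewrite e1 => e2; split => //; lra.
Qed.

(** Existence for nearby [d'] is part of the claim. The truncated solution stays close to the given
    one up to a time beyond [t0], hence below its truncation level, and after [t0] it always
    extends. *)
Lemma Rsol_close d y0 v0 T e : Rsol d y0 v0 -> 0 < e ->
  exists2 r, 0 < r & forall d', `|d' - d| < r -> exists y v, Rsol d' y v /\
    forall t, t <= T -> `|y t - y0 t| < e /\ `|v t - v0 t| < e.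
Proof.
mark; move=> S0 e0; pose T' := Num.max T t0.
have TT : T <= T' by rewrite le_max lexx.
have tT' : t0 <= T' by rewrite le_max lexx orbT.
have L0 := Rsol_lsol S0 T'; have [M M0 hM] := lsol_bounded L0.
have M1 : 0 <= M + 1 by lra.
have S0' := lsol_tsol L0 (fun t h => le_trans (hM t h) (_ : M <= M + 1)).
have {}S0' := S0' ltac:(lra).
set z0 := (fun t => expR (- l0 * t) * y0 t) in L0 hM S0'.
set w0 := (fun t => expR (- l0 * t) * (v0 t - l0 * y0 t)) in L0 S0'.
pose A := amp (M + 1) T'; have A0 : 0 < A by exact: expR_gt0.
pose X := expR (l0 * T'); have X0 : 0 < X by exact: expR_gt0.
(* The first bound keeps the truncation inactive; the second pays for the return from [z, w] to
   [y, v]. *)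
pose r := Num.min (1 / A) (e / (2 * X * A * (1 + 2 * l0))).
have c0 : 0 < 2 * X * A * (1 + 2 * l0) by rewrite !mulr_gt0 //; have := lam0; lra.
exists r; first by rewrite lt_min !divr_gt0.
move=> d'; rewrite lt_min => /andP[d1 d2].
have [z [w S]] := tsol_exists d' M1.
have cl t : t <= T' -> `|z t - z0 t| <= `|d' - d| * A /\ `|w t - w0 t| <= l0 * `|d' - d| * A.
  move=> tT; have [h1 h2] := tsol_close M1 (S T') S0' tT.
  have h3 := amp_mono (M + 1) tT.
  split; [apply: le_trans h1 _|apply: le_trans h2 _]; rewrite ler_wpM2l //.
  by rewrite mulr_ge0 // ltW.
have Sl : lsol T' d' z w.
  apply: tsol_lsol (S T') _ => t tT; have [h _] := cl t tT.
  have : `|d' - d| * A < 1 by rewrite -ltr_pdivlMr.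
  by have := hM t tT; have := ler_normD (z t - z0 t) (z0 t); rewrite subrK; lra.
have [y [v Sy]] := lsol_extend (lsol_le tT' Sl).
exists y, v; split => // t tT.
have tT1 : t <= T' by lra.
have [ez ew] := lsol_uniq (Rsol_lsol Sy T') Sl tT1.
have [h1 h2] := cl t tT1; rewrite -ez /z0 in h1; rewrite -ew /w0 in h2.
have Xt : expR (l0 * t) <= X by rewrite ler_expR ler_wpM2l // ltW.
have inv : expR (l0 * t) * expR (- l0 * t) = 1 by rewrite -expRD mulNr addrN expR0.
have dA : `|d' - d| * A * (2 * X * (1 + 2 * l0)) < e.
  by move: d2; rewrite ltr_pdivlMr //; rewrite (_ : _ * (_ * _) = `|d' - d| * A * (2 * X * (1 + 2 * l0))) //; ring.
have N0 : 0 <= `|d' - d| * A by rewrite mulr_ge0 // ltW.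
have scal x c : `|expR (- l0 * t) * x| <= c -> `|x| <= X * c.
  move=> h; rewrite -[x]mul1r -inv -mulrA normrM (ger0_norm (expR_ge0 _)).
  by apply: ler_pM; rewrite ?expR_ge0.
rewrite -mulrBr in h1; rewrite -mulrBr in h2.
have {}h1 := scal _ _ h1; have {}h2 := scal _ _ h2.
set D := `|d' - d| * A in dA N0 h1 h2.
have e1 : D * (2 * X * (1 + 2 * l0)) = X * D + X * D + 4 * (l0 * (X * D)) by ring.
have e2 : X * (l0 * `|d' - d| * A) = l0 * (X * D) by rewrite /D; ring.
have XD : 0 <= X * D by rewrite mulr_ge0 // ltW.
have lXD : 0 <= l0 * (X * D) by rewrite mulr_ge0 // ltW.
rewrite e2 in h2; rewrite e1 in dA.
have XD' : X * D < e by lraf dA XD lXD.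
split; first by apply: le_lt_trans h1 _.
rewrite (_ : v t - v0 t = (v t - l0 * y t - (v0 t - l0 * y0 t)) + l0 * (y t - y0 t)); last by ring.
apply: le_lt_trans (ler_normD _ _) _; rewrite normrM (ger0_norm (ltW lam0)).
have : l0 * `|y t - y0 t| <= l0 * (X * D) by rewrite ler_wpM2l // ltW.
by lraf h2 dA XD lXD.
Qed.

(** The common bound up to [t0] prevents blow-up in the limit: it passes to the solution truncated
    at [M], which therefore solves the true equation. *)
Lemma Rsol_closed d M : 0 <= M -> (forall e, 0 < e -> exists d' y v, [/\ `|d' - d| < e, Rsol d' y v &
    forall t, t <= t0 -> `|expR (- l0 * t) * y t| <= M]) -> exists y v, Rsol d y v.
Proof.
move=> M0 h; have [z [w S]] := tsol_exists d M0.
apply: (@lsol_extend d z w); apply: tsol_lsol (S t0) _ => t tt.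
apply/ler_addgt0Pr => e e0; have A0 : 0 < amp M t by exact: expR_gt0.
have [d' [y [v [d'd Sy yM]]]] := h (e / amp M t) (divr_gt0 e0 A0).
have [h1 _] := tsol_close M0 (S t0) (lsol_tsol (Rsol_lsol Sy t0) yM) tt.
have := yM t tt; set x := _ * y t in h1 *.
have h2 : `|d - d'| * amp M t < e by rewrite distrC -ltr_pdivlMr.
by have := ler_normD (z t - x) x; rewrite subrK; lra.
Qed.

(** A double zero propagates to the left, since [(y^2 + v^2) e^(C s)] is nondecreasing on each
    compact interval for a suitable [C]; then the limit [d] would be [0]. *)
Lemma Rsol_nontrivial d y v : Rsol d y v -> d != 0 -> forall t, y t = 0 -> v t != 0.
Proof.
move=> [dy dv yl] d0 t yt0; apply/eqP => vt0; move/eqP: d0; apply.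
apply: limN_uniq yl _; apply: (limN_ext (f := fun=> 0) (T := t)); last exact: limN_cst.
move=> s st; suff -> : y s = 0 by rewrite mulr0.
have cy r : ctn y r := isD_cont (dy r).
have cm : forall r, ctn (fun r => 1 + a r - b r * pw p (y r)) r.
  move=> r; apply: ctn_sub (ctn_add (ctn_cst 1 r) (a_cont H r)) _.
  apply: ctn_mul (isD_cont (b_der H r)) _.
  exact: ctn_comp (pw_cont p0 (y r)) (cy r).
have [C C0 hC] := cont_bounded (a := s) (b := t) (fun r _ => cm r).
have : (y s ^+ 2 + v s ^+ 2) * expR (C * s) <= (y t ^+ 2 + v t ^+ 2) * expR (C * t).
  apply: (incrD (f := fun r => (y r ^+ 2 + v r ^+ 2) * expR (C * r))
    (f' := fun r => expR (C * r) * (C * (y r ^+ 2 + v r ^+ 2)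
      + (1 + a r - b r * pw p (y r)) * (2 * (y r * v r))))) => // r srt.
    have D1 := dy r; have D2 := dv r; have D3 := isD_explin C r.
    apply: isD_eq; first by isD_auto.
    by rewrite /npow /=; ring.
  rewrite mulr_ge0 ?expR_ge0 //.
  have h : `|(1 + a r - b r * pw p (y r)) * (2 * (y r * v r))| <= C * (y r ^+ 2 + v r ^+ 2).
    rewrite normrM ler_pM ?hC // ler_norml.
    by have := sqr_ge0 (y r + v r); have := sqr_ge0 (y r - v r); rewrite !expr2; lra.
  by move: h; rewrite ler_norml => /andP[]; lra.
rewrite yt0 vt0 expr0n /= addr0 mul0r pmulr_lle0 ?expR_gt0 // => h.
apply/eqP; rewrite -sqrf_eq0 eq_le sqr_ge0 andbT.
by have := sqr_ge0 (v s); lra.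
Qed.

End Solutions.

(** * Counting zeros *)

Section CountingZeros.
Variable R : realType.
Implicit Types (y : R -> R) (T t c : R) (k : nat).

Definition cnt_upto y T k := exists zs : seq R,
  [/\ uniq zs, size zs = k & forall t, (t \in zs) = (t <= T) && (y t == 0)].
Definition cnt y k := exists zs : seq R,
  [/\ uniq zs, size zs = k & forall t, (t \in zs) = (y t == 0)].
Definition atleast_below y T k := exists zs : seq R,
  [/\ uniq zs, size zs = k & forall t, t \in zs -> t < T /\ y t = 0].
Definition atleast y k := exists zs : seq R,
  [/\ uniq zs, size zs = k & forall t, t \in zs -> y t = 0].

Lemma cnt_atleast y j k : cnt y j -> atleast y k -> (k <= j)%N.
Proof.
move=> [zs [u <- h]] [ws [u' <- h']]; apply: uniq_leq_size u' _ => t /h' yt.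
by rewrite h yt.
Qed.

(** A list of zeros of maximal length contains every zero. *)
Lemma not_atleast_cnt y k : ~ atleast y k -> exists2 j, (j < k)%N & cnt y j.
Proof.
elim: k => [[]|k IH hk]; first by exists [::].
have [[zs [u s h]]|/IH[j jk cj]] := pselect (atleast y k); last by exists j => //; exact: ltnW.
exists k => //; exists zs; split => // t; apply/idP/eqP; first exact: h.
move=> yt; apply/negPn/negP => tzs; apply: hk; exists (t :: zs); split; rewrite /= ?tzs ?s //.
by move=> r; rewrite inE => /orP[/eqP->|/h].
Qed.

Lemma seq_bound (zs : seq R) : exists T, forall t, t \in zs -> t < T.
Proof.
elim: zs => [|z zs [T h]]; first by exists 0.
exists (Num.max (z + 1) T) => t; rewrite inE lt_max => /orP[/eqP->|/h ->].
  by rewrite ltrDl ltr01.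
by rewrite orbT.
Qed.

Lemma seq_max (zs : seq R) : (0 < size zs)%N ->
  exists2 c, c \in zs & forall t, t \in zs -> t <= c.
Proof.
elim: zs => // z [|z' zs] IH _.
  by exists z; rewrite ?inE // => t; rewrite inE => /eqP->.
have [//|c cz h] := IH; have [zc|cz'] := leP z c.
  exists c; first by rewrite inE cz orbT.
  by move=> t; rewrite inE => /orP[/eqP->|/h].
exists z; first by rewrite inE eqxx.
by move=> t; rewrite inE => /orP[/eqP->//|/h tc]; rewrite (le_trans tc) // ltW.
Qed.

(** Splits off the last zero with a gap before it, for inductions that remove zeros from the
    right. *)
Lemma seq_split_max (zs : seq R) k : uniq zs -> size zs = k.+1 ->
  exists c zs', [/\ uniq zs', size zs' = k, zs =i c :: zs', c \notin zs' &
    exists2 g, 0 < g & forall t, t \in zs' -> t < c - g].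
Proof.
move=> u s; have [|c cz h] := @seq_max zs; first by rewrite s.
have u' : uniq (rem c zs) by rewrite rem_uniq.
have cn : c \notin rem c zs by rewrite mem_rem_uniqF.
exists c, (rem c zs); split => //.
- by rewrite size_rem // s.
- by move=> t; rewrite (perm_mem (perm_to_rem cz)).
have {}h t : t \in rem c zs -> t < c.
  move=> tz; rewrite lt_neqAle (h t (mem_rem tz)) andbT.
  by apply/eqP => tc; move: tz; rewrite tc (negbTE cn).
elim: (rem c zs) h => [|z ws IH] h; first by exists 1.
have [g g0 hg] := IH (fun t tw => h t (mem_behead (s := z :: ws) tw)).
have zc := h z (mem_head _ _).
exists (Num.min g ((c - z) / 2)); first by rewrite lt_min g0; lra.
move=> t; rewrite inE => /orP[/eqP->|/hg tg].
  have : Num.min g ((c - z) / 2) <= (c - z) / 2 by rewrite ge_min lexx orbT.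
  lra.
have : Num.min g ((c - z) / 2) <= g by rewrite ge_min lexx.
lra.
Qed.

Lemma cnt_upto_extend0 y T T' k : T <= T' -> cnt_upto y T k ->
  (forall t, T < t <= T' -> y t != 0) -> cnt_upto y T' k.
Proof.
move=> TT [zs [u s h]] h'; exists zs; split => // t; rewrite h.
have [tT|Tt] /= := leP t T; first by rewrite (le_trans tT TT).
by have [tT'|//] := leP t T'; rewrite (negbTE (h' t _)) // Tt.
Qed.

Lemma cnt_upto_extend1 y T T' c k : cnt_upto y T k -> T < c <= T' -> y c = 0 ->
  (forall t, T < t <= T' -> y t = 0 -> t = c) -> cnt_upto y T' k.+1.
Proof.
move=> [zs [u s h]] /andP[Tc cT] yc h'; exists (c :: zs); split.
- by rewrite /= u h leNgt Tc.
- by rewrite /= s.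
move=> t; rewrite inE h; have [->|tc] /= := eqVneq t c; first by rewrite cT yc eqxx.
have [tT|Tt] /= := leP t T; first by rewrite (le_trans tT (le_trans (ltW Tc) cT)).
have [tT'|//] := leP t T'; symmetry; apply/negbTE/eqP => yt; move/eqP: tc; apply.
by apply: h'; rewrite ?Tt.
Qed.

Lemma cnt_upto_cnt y T k : cnt_upto y T k -> (forall t, T < t -> y t != 0) -> cnt y k.
Proof.
move=> [zs [u s h]] h'; exists zs; split => // t; rewrite h.
by have [//|Tt] := leP t T; rewrite (negbTE (h' t Tt)).
Qed.

Lemma cnt_cnt_upto y k : cnt y k ->
  exists T0, forall T, T0 <= T -> cnt_upto y T k /\ forall t, T <= t -> y t != 0.
Proof.
move=> [zs [u s h]]; have [T0 h0] := seq_bound zs; exists T0 => T T0T; split.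
  exists zs; split => // t; rewrite -h; have [//|Tt] := leP t T.
  by apply/negbTE/negP => /h0; lra.
by move=> t Tt; rewrite -h; apply/negP => /h0; lra.
Qed.

End CountingZeros.

(** * Stability of the zeros under a change of [d] *)

Section StableZeros.
Variables (R : realType) (p l0 l1 gam kap t0 FL : R) (a b b1 om om1 F F1 : R -> R).
Hypothesis H : emden_data p l0 l1 gam kap t0 FL a b b1 om om1 F F1.
Implicit Types (y v z w : R -> R) (t T M d s : R) (k : nat).
Let Rsol := Rsol p l0 a b.

Lemma Rsol_near d y0 v0 T e : Rsol d y0 v0 -> 0 < e ->
  exists2 r, 0 < r & forall d' y v, `|d' - d| < r -> Rsol d' y v ->
    forall t, t <= T -> `|y t - y0 t| < e /\ `|v t - v0 t| < e.
Proof.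
move=> S e0; have [r r0 h] := Rsol_close H T S e0; exists r => // d' y v d'd S'.
have [y' [v' [S'' h']]] := h d' d'd => t tT.
by have [-> ->] := Rsol_uniq H S' S'' t; exact: h'.
Qed.

Lemma b_t0_le0 : b t0 <= 0.
Proof.
rewrite leNgt; apply/negP => bt.
have [r r0 hr] := isD_cont (b_der H t0) bt.
have := hr (t0 - r / 2); rewrite (_ : t0 - r / 2 - t0 = - (r / 2)); last by ring.
rewrite normrN gtr0_norm; last by lra.
move=> /(_ ltac:(lra)); rewrite ltr_norml => /andP[h _].
by have := b_neg H (_ : t0 - r / 2 < t0) => /(_ ltac:(lra)); lra.
Qed.

Lemma b_le0 t : t <= t0 -> b t <= 0.
Proof. by rewrite le_eqVlt => /predU1P[->|/(b_neg H)/ltW//]; exact: b_t0_le0. Qed.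

(* Left of [t0] both terms of [y'' = (a - b |y|^p) y] push the solution away from zero. *)
Lemma Rsol_pos_left d y v : 0 < d -> Rsol d y v -> forall t, t <= t0 -> 0 < y t /\ 0 < v t.
Proof.
move=> d0 S; have S1 := Rsol_lsol S t0; have wl := lsol_wlim H S1.
have [dy dv zl] := S; have [_ _ zl'] := S1; have lam0 := l0_gt0 H.
have [T1 h1] := zl' (d / 4) ltac:(lra).
have [T2 h2] := wl (l0 * d / 4) ltac:(by rewrite divr_gt0 // mulr_gt0).
pose T := Num.min t0 (Num.min T1 T2).
have far t : t <= T -> 0 < y t /\ 0 < v t.
  rewrite /T !le_min => /and3P[tt /h1 z1 /h2 w1].
  move: z1 w1; set z := _ * y t; set w := expR _ * _; rewrite !ltr_norml subr0 => /andP[z1 z2] /andP[w1 w2].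
  have z0 : 0 < z by lra.
  have w0 : 0 < w + l0 * z.
    have : l0 * (d - d / 4) < l0 * z by rewrite ltr_pM2l //; lra.
    by have := mulr_gt0 lam0 d0; lra.
  split; first by move: z0; rewrite /z pmulr_rgt0 ?expR_gt0.
  have : w + l0 * z = expR (- l0 * t) * v t by rewrite /w /z; ring.
  by move=> e; move: w0; rewrite e pmulr_rgt0 ?expR_gt0.
have mid t : T <= t <= t0 -> - v t < 0.
  have [y0 v0] := far T (lexx _).
  have TT : T <= t0 by rewrite ge_min lexx.
  apply: (@bootstrap _ (fun t => - v t)).
  - by move=> s _; exact: isD_cont (isD_opp (dv s)).
  - by rewrite oppr_lt0.
  move=> s /andP[Ts st] hs.
  have ypos r : T <= r <= s -> 0 < y r.
    move=> /andP[Tr rs]; apply: lt_le_trans y0 _; apply: (incrD Tr) => x hx; first exact: dy.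
    by have := hs x; rewrite oppr_le0; apply; lra.
  rewrite oppr_lt0; apply: lt_le_trans v0 _.
  apply: (incrD (ltW Ts)) => r hr; first exact: dv.
  rewrite /npow (_ : _ - _ = (a r + - b r * pw p (y r)) * y r); last by ring.
  rewrite mulr_ge0 //; last exact/ltW/ypos.
  rewrite addr_ge0 //; first exact/ltW/(a_gt0 H).
  by rewrite mulr_ge0 ?pw_ge0 // oppr_ge0 b_le0 //; lra.
have v0 t : t <= t0 -> 0 < v t.
  move=> tt; have [/far[]//|/ltW Tt] := leP t T.
  by have := mid t; rewrite Tt tt oppr_lt0 => /(_ isT).
move=> t tt; split; last exact: v0.
have [/far[]//|/ltW Tt] := leP t T.
apply: lt_le_trans (far T (lexx _)).1 _; apply: (incrD Tt) => x hx; first exact: dy.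
by apply/ltW/v0; lra.
Qed.

(** Zeros are simple, so [v0] keeps at least half of its size near [c]. Multiplying by [v0 c] treats
    both crossing directions at once. *)
Lemma zero_local d y0 v0 c g : Rsol d y0 v0 -> d != 0 -> y0 c = 0 -> 0 < g ->
  exists h, [/\ 0 < h < g, forall t, c - h <= t <= c + h -> v0 c ^+ 2 / 2 <= v0 t * v0 c,
    y0 (c - h) * v0 c < 0 & 0 < y0 (c + h) * v0 c].
Proof.
mark; move=> S d0 yc g0; have vc := Rsol_nontrivial H S d0 yc; have [dy dv _] := S.
have vc0 : 0 < `|v0 c| / 2 by rewrite divr_gt0 ?normr_gt0.
have [r r0 hr] := isD_cont (dv c) vc0.
pose h := Num.min r g / 2.
have m0 : 0 < Num.min r g by rewrite lt_min r0.
have mr : Num.min r g <= r by rewrite ge_min lexx.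
have mg : Num.min r g <= g by rewrite ge_min lexx orbT.
have vv t : c - h <= t <= c + h -> v0 c ^+ 2 / 2 <= v0 t * v0 c.
  move=> th; have /hr : `|t - c| < r by rewrite ltr_norml; move: th; rewrite /h; lra.
  move=> hv; have : `|(v0 t - v0 c) * v0 c| <= `|v0 c| / 2 * `|v0 c|.
    by rewrite normrM ler_wpM2r // ltW.
  have e2 : `|v0 c| * `|v0 c| = v0 c ^+ 2 by rewrite -expr2 real_normK ?num_real.
  by rewrite mulrAC e2 ler_norml => /andP[h1 _]; move: h1; rewrite mulrBl -expr2; lra.
have sq : 0 < v0 c ^+ 2 by rewrite exprn_even_gt0.
have mono s t : c - h <= s -> s < t -> t <= c + h -> y0 s * v0 c < y0 t * v0 c.
  move=> cs st tc; apply: (incrSD (f := fun t => y0 t * v0 c) (f' := fun t => v0 t * v0 c) st).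
    by move=> x _; have D := dy x; isD_calc.
  by move=> x hx; have := vv x; move=> /(_ ltac:(lraf hx cs tc)); lraf sq.
have h0 : 0 < h by rewrite /h; lra.
exists h; split => //.
- by rewrite h0 /h; lra.
- by have := mono (c - h) c; rewrite yc mul0r; apply; lraf h0.
- by have := mono c (c + h); rewrite yc mul0r; apply; lraf h0.
Qed.

Lemma close_sign (x y e : R) : `|y - x| < e -> e <= `|x| -> 0 < y * x.
Proof.
move=> h1 h2; have xe : `|y - x| < `|x| by exact: lt_le_trans h1 h2.
have [x0|x0|e0] := ltgtP x 0.
- rewrite (ltr0_norm x0) in xe; have := le_lt_trans (ler_norm _) xe.
  by move=> ?; rewrite nmulr_lgt0 //; lra.
- rewrite (gtr0_norm x0) -normrN in xe; have := le_lt_trans (ler_norm _) xe.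
  by move=> ?; rewrite pmulr_lgt0 //; lra.
- by move: xe; rewrite e0 normr0 ltNge normr_ge0.
Qed.

Lemma close_sign_gt (x y s e : R) : `|y - x| < e -> e <= `|x| -> 0 < x * s -> 0 < y * s.
Proof.
move=> h1 h2 xs; have yx := close_sign h1 h2.
have x0 : x != 0 by apply: contraTneq xs => ->; rewrite mul0r ltxx.
have : 0 < (y * x) * (x * s) by rewrite mulr_gt0.
rewrite (_ : y * x * (x * s) = x ^+ 2 * (y * s)); last by ring.
by rewrite pmulr_rgt0 // exprn_even_gt0.
Qed.

Lemma close_sign_lt (x y s e : R) : `|y - x| < e -> e <= `|x| -> x * s < 0 -> y * s < 0.
Proof.
move=> h1 h2 xs; rewrite -oppr_gt0 -mulrN; apply: close_sign_gt h1 h2 _.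
by rewrite mulrN oppr_gt0.
Qed.

(** The sign change at the last zero [c] survives a small perturbation; the remaining zeros lie
    below [c - hh] and are treated by induction. *)
Lemma atleast_open d y0 v0 T k : Rsol d y0 v0 -> d != 0 -> atleast_below y0 T k ->
  exists2 r, 0 < r & forall d' y v, `|d' - d| < r -> Rsol d' y v -> atleast_below y T k.
Proof.
mark; move=> S d0; elim: k T => [|k IH] T [zs [u s h]].
  by exists 1 => // d' y v _ _; exists [::].
have [c [zs' [u' s' e cn [g g0 hg]]]] := seq_split_max u s.
have [cT yc] : c < T /\ y0 c = 0 by apply: h; rewrite e mem_head.
pose g' := Num.min g (T - c).
have g'0 : 0 < g' by rewrite lt_min g0 subr_gt0.
have gg : g' <= g by rewrite ge_min lexx.
have gT : g' <= T - c by rewrite ge_min lexx orbT.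
have [hh [/andP[h0 hg'] vv ym yp]] := zero_local S d0 yc g'0.
have [|r1 r10 hr1] := IH (c - hh).
  exists zs'; split => // t tz; split; first by have := hg t tz; lraf hg' gg.
  by have [] := h t; rewrite ?e ?inE ?tz ?orbT.
have ny : 0 < `|y0 (c - hh)| by rewrite normr_gt0; apply: contraTneq ym => ->; rewrite mul0r ltxx.
have py : 0 < `|y0 (c + hh)| by rewrite normr_gt0; apply: contraTneq yp => ->; rewrite mul0r ltxx.
pose eps := Num.min `|y0 (c - hh)| `|y0 (c + hh)|.
have eps0 : 0 < eps by rewrite lt_min ny.
have [r2 r20 hr2] := Rsol_near (c + hh) S eps0.
exists (Num.min r1 r2); first by rewrite lt_min r10.
move=> d' y v; rewrite lt_min => /andP[dr1 dr2] S'.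
have [ws [uw sw hw]] := hr1 d' y v dr1 S'.
have [dy _ _] := S'.
have n1 := (hr2 d' y v dr2 S' (c - hh) ltac:(lraf h0)).1.
have n2 := (hr2 d' y v dr2 S' (c + hh) (lexx _)).1.
have e1 : eps <= `|y0 (c - hh)| by rewrite ge_min lexx.
have e2 : eps <= `|y0 (c + hh)| by rewrite ge_min lexx orbT.
have s1 := close_sign_lt n1 e1 ym; have s2 := close_sign_gt n2 e2 yp.
have [|c' c'h yc'] := @IVTD _ y (c - hh) (c + hh) ltac:(lraf h0) (fun t _ => isD_cont (dy t)).
  have : (y (c - hh) * v0 c) * (y (c + hh) * v0 c) <= 0 by rewrite nmulr_rle0 // ltW.
  rewrite (_ : _ * _ * (_ * _) = v0 c ^+ 2 * (y (c - hh) * y (c + hh))); last by ring.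
  by rewrite pmulr_rle0 // exprn_even_gt0 //= (Rsol_nontrivial H S d0 yc).
exists (c' :: ws); split.
- by rewrite /= uw andbT; apply/negP => /hw[]; lraf c'h.
- by rewrite /= sw.
move=> t; rewrite inE => /orP[/eqP->|/hw[]]; last by move=> tc ->; split => //; lraf tc h0 cT.
by split => //; lraf c'h gT hg'.
Qed.

(** No zero is created: left of [t0] solutions with positive [d] are positive, away from the zeros
    |y0| has a positive minimum, and near a zero the perturbed solution is strictly monotone. The
    first point replaces compactness at [-oo]. *)
Lemma cnt_upto_stable d y0 v0 T k : Rsol d y0 v0 -> 0 < d -> y0 T != 0 -> cnt_upto y0 T k ->
  exists2 r, 0 < r & forall d' y v, `|d' - d| < r -> Rsol d' y v ->
    cnt_upto y T k /\ 0 < y T * y0 T.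
Proof.
have aux (X Y C : R) : - (C / 4) <= X - Y -> C / 2 <= Y -> 0 < C -> 0 < X by lra.
mark; move=> S d0; have [dy0 dv0 _] := S; elim: k T => [|k IH] T yT [zs [u s h]].
  have y0n t : t <= T -> y0 t != 0.
    move=> tT; have := h t; rewrite (size0nil s) inE tT /= => /esym/negbT; exact.
  have pos := Rsol_pos_left d0 S.
  have y0p t : t <= T -> 0 < y0 t.
    move=> tT; have [/pos[]//|t0t] := leP t t0.
    rewrite ltNge; apply/negP => yt.
    have [|c cc yc] := @IVTD _ y0 t0 t (ltW t0t) (fun s _ => isD_cont (dy0 s)).
      by rewrite pmulr_rle0 // (pos t0 (lexx _)).1.
    by have := y0n c; rewrite yc eqxx => /(_ ltac:(lraf cc tT)).
  pose T1 := Num.min t0 T.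
  have T1T : T1 <= T by rewrite ge_min lexx orbT.
  have T1t : T1 <= t0 by rewrite ge_min lexx.
  have [m m0 hm] := cont_pos_min T1T (fun t _ => isD_cont (dy0 t))
    (fun t ht => y0p t (proj2 (andP ht))).
  have [r r0 hr] := Rsol_near T S m0.
  (* The bound by [d] keeps [d'] positive, as positivity left of [t0] requires. *)
  exists (Num.min r d); first by rewrite lt_min r0.
  move=> d' y v; rewrite lt_min => /andP[dr dd] S'.
  have d'0 : 0 < d' by move: dd; rewrite ltr_norml; lraf.
  have yp t : t <= T -> 0 < y t.
    move=> tT; have [/(Rsol_pos_left d'0 S')[]//|t0t] := leP t t0.
    have [h1 _] := hr d' y v dr S' t tT; have := hm t; rewrite tT (le_trans T1t (ltW t0t)).
    by move=> /(_ isT); move: h1; rewrite ltr_norml => /andP[]; lraf.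
  split; last by rewrite mulr_gt0 ?yp ?y0p.
  exists [::]; split => // t; rewrite in_nil; have [tT|//] := leP t T.
  by rewrite gt_eqF ?yp.
have [c [zs' [u' s' e cn [g g0 hg]]]] := seq_split_max u s.
have : c \in zs by rewrite e mem_head.
rewrite h => /andP[cT /eqP yc].
have {}cT : c < T by rewrite lt_neqAle cT andbT; apply: contraNneq yT => <-; rewrite yc.
pose g' := Num.min g (T - c).
have g'0 : 0 < g' by rewrite lt_min g0 subr_gt0.
have gg : g' <= g by rewrite ge_min lexx.
have gT : g' <= T - c by rewrite ge_min lexx orbT.
have dn0 : d != 0 by rewrite gt_eqF.
have [hh [/andP[h0 hg'] vv ym yp]] := zero_local S dn0 yc g'0.
have vc := Rsol_nontrivial H S dn0 yc.
have ny : 0 < `|y0 (c - hh)| by rewrite normr_gt0; apply: contraTneq ym => ->; rewrite mul0r ltxx.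
have py : 0 < `|y0 (c + hh)| by rewrite normr_gt0; apply: contraTneq yp => ->; rewrite mul0r ltxx.
have [||r1 r10 hr1] := IH (c - hh).
- by rewrite -normr_gt0.
- exists zs'; split => // t; apply/idP/idP.
    move=> tz; have : t \in zs by rewrite e inE tz orbT.
    by rewrite h => /andP[_ ->]; rewrite andbT; have := hg t tz; lraf hg' gg.
  move=> /andP[tc yt]; have : t \in zs by rewrite h yt andbT; lraf tc h0 cT.
  by rewrite e inE => /orP[/eqP tc'|//]; lraf tc tc' h0.
have tail0 t : c + hh <= t <= T -> 0 < `|y0 t|.
  move=> /andP[ct tT]; rewrite normr_gt0; apply/negP => yt.
  have : t \in zs by rewrite h tT.
  by rewrite e inE => /orP[/eqP tc|/hg]; [lraf tc ct h0|lraf ct h0 g0].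
have cT' : c + hh <= T by lraf hg' gT.
have [m m0 hm] := cont_pos_min cT' (fun t _ => ctn_norm (isD_cont (dy0 t))) tail0.
have vc0 : 0 < `|v0 c| / 4 by rewrite divr_gt0 ?normr_gt0.
(* The three tolerances keep the sign before the zero, the sign from [c + hh] on, and the
   monotonicity in between. *)
pose eps := Num.min (Num.min `|y0 (c - hh)| m) (`|v0 c| / 4).
have eps0 : 0 < eps by rewrite !lt_min ny m0.
have [r2 r20 hr2] := Rsol_near T S eps0.
exists (Num.min r1 r2); first by rewrite lt_min r10.
move=> d' y v; rewrite lt_min => /andP[dr1 dr2] S'.
have [cu _] := hr1 d' y v dr1 S'; have [dy _ _] := S'.
have nr := hr2 d' y v dr2 S'.
have e1 : eps <= `|y0 (c - hh)| by rewrite !ge_min lexx.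
have e2 : eps <= m by rewrite !ge_min lexx orbT.
have e3 : eps <= `|v0 c| / 4 by rewrite ge_min lexx orbT.
have s1 := close_sign_lt (nr (c - hh) ltac:(lraf cT h0)).1 e1 ym.
have tl t : c + hh <= t <= T -> 0 < y t * y0 t.
  move=> ht; have tT : t <= T by have /andP[] := ht.
  have [n1 _] := nr t tT; have n2 := le_trans e2 (hm t ht).
  exact: close_sign n1 n2.
have s2 : 0 < y (c + hh) * v0 c.
  have [n1 _] := nr (c + hh) cT'.
  have n2 : eps <= `|y0 (c + hh)| by apply: le_trans e2 (hm _ _); rewrite lexx.
  exact: close_sign_gt n1 n2 yp.
have sq : 0 < v0 c ^+ 2 by rewrite exprn_even_gt0.
have mono x1 x2 : c - hh <= x1 -> x1 < x2 -> x2 <= c + hh -> y x1 * v0 c < y x2 * v0 c.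
  move=> cs st tc; apply: (incrSD (f := fun t => y t * v0 c) (f' := fun t => v t * v0 c) st).
    by move=> x _; have D := dy x; isD_calc.
  move=> x /andP[sx xt].
  have v1 : v0 c ^+ 2 / 2 <= v0 x * v0 c by apply: vv; rewrite (le_trans cs sx) (le_trans xt tc).
  have [_ v2] := nr x (le_trans (le_trans xt tc) cT').
  have : `|(v x - v0 x) * v0 c| <= `|v0 c| / 4 * `|v0 c|.
    by rewrite normrM ler_wpM2r // ltW // (lt_le_trans v2).
  have e4 : `|v0 c| * `|v0 c| = v0 c ^+ 2 by rewrite -expr2 real_normK ?num_real.
  by rewrite mulrAC e4 ler_norml mulrBl => /andP[h1 _]; exact: aux h1 v1 sq.
have [|c' c'h yc'] := @IVTD _ y (c - hh) (c + hh) ltac:(lraf h0) (fun t _ => isD_cont (dy t)).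
  have : (y (c - hh) * v0 c) * (y (c + hh) * v0 c) <= 0 by rewrite nmulr_rle0 // ltW.
  rewrite (_ : _ * _ * (_ * _) = v0 c ^+ 2 * (y (c - hh) * y (c + hh))); last by ring.
  by rewrite pmulr_rle0.
have c'1 : c - hh < c'.
  rewrite lt_neqAle; have /andP[-> _] := c'h; rewrite andbT.
  by apply: contraTneq s1 => ->; rewrite yc' mul0r ltxx.
split; last by apply: tl; rewrite cT' lexx.
have /andP[_ c'2] := c'h.
apply: (cnt_upto_extend1 (c := c') cu) => //; first by rewrite c'1 (le_trans c'2).
move=> t /andP[ct tT] yt.
have [ht|ht] := leP t (c + hh); last first.
  by have := tl t; rewrite yt mul0r ltxx (ltW ht) tT => /(_ isT).
apply/eqP/negPn/negP; rewrite neq_lt => /orP[] hlt.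
  by have := mono t c' (ltW ct) hlt c'2; rewrite yt yc' ltxx.
by have := mono c' t (ltW c'1) hlt ht; rewrite yt yc' ltxx.
Qed.

End StableZeros.

(** * Large solutions oscillate *)

Section Windows.
Variable R : realType.
Implicit Types (y v : R -> R) (s t d A Y : R).

(** Sturm comparison with [sin (m (t - s))], [m = pi / d]: the Wronskian [m y cos - v sin] would be
    nondecreasing, but it goes from [m y(s) > 0] to [- m y(s + d) < 0]. *)
Lemma sturm_window y v (c : R -> R) s d : 0 < d ->
  (forall t, s <= t <= s + d -> isD y t (v t)) ->
  (forall t, s <= t <= s + d -> isD v t (c t * y t)) ->
  (forall t, s <= t <= s + d -> 0 < y t) ->
  ~ (forall t, s <= t <= s + d -> c t <= - (pi / d) ^+ 2).
Proof.
move=> d0 dy dv y0 hc; pose m := pi / d.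
have m0 : 0 < m by rewrite divr_gt0 ?pi_gt0.
have dsin t : isD (fun t => sin (m * (t - s))) t (cos (m * (t - s)) * m).
  have D : isD (fun t => m * (t - s)) t m by isD_calc.
  by apply: (isD_comp (f := @sin R)) D; exact: is_derive_sin.
have dcos t : isD (fun t => cos (m * (t - s))) t (- sin (m * (t - s)) * m).
  have D : isD (fun t => m * (t - s)) t m by isD_calc.
  by apply: (isD_comp (f := @cos R)) D; exact: is_derive_cos.
have ss : s <= s + d by lra.
have := @incrD R (fun t => m * y t * cos (m * (t - s)) - v t * sin (m * (t - s)))
  (fun t => - (c t + m ^+ 2) * (y t * sin (m * (t - s)))) s (s + d) ss.
rewrite subrr mulr0 cos0 sin0 (_ : m * (s + d - s) = pi); last by rewrite /m; field; rewrite gt_eqF.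
rewrite cospi sinpi !mulr0 !subr0 mulr1 mulrN1 => h.
have : m * y s <= - (m * y (s + d)).
  apply: h => t ht.
    have D1 := dy t ht; have D2 := dv t ht; have D3 := dsin t; have D4 := dcos t.
    isD_calc.
  have hs : 0 <= sin (m * (t - s)).
    have ts : 0 <= t - s by lra.
    apply: sin_ge0_pi; rewrite mulr_ge0 ?(ltW m0) //=.
    by rewrite /m mulrAC ler_pdivrMr // ler_wpM2l ?pi_ge0 //; lra.
  apply: mulr_ge0; first by have := hc t ht; rewrite -/m; lra.
  by rewrite mulr_ge0 // ltW ?y0.
have y1 : 0 < m * y s by rewrite mulr_gt0 // y0 ?lexx.
have y2 : 0 < m * y (s + d) by rewrite mulr_gt0 // y0 ?lexx ?andbT.
lra.
Qed.

(* A nonnegative solution passes through a bounded part of the phase plane,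
   with a bound that does not depend on the solution. *)
Lemma apriori_window p y v (a b : R -> R) s d A (b0 : R) Y : 0 < p -> 0 < d -> 0 <= A -> 0 < b0 -> 0 < Y ->
  A - b0 * pw p Y <= - (pi / d) ^+ 2 ->
  (forall t, s <= t <= s + 3 * d -> isD y t (v t)) ->
  (forall t, s <= t <= s + 3 * d -> isD v t ((a t - b t * pw p (y t)) * y t)) ->
  (forall t, s <= t <= s + 3 * d -> 0 <= y t) ->
  (forall t, s <= t <= s + 3 * d -> a t <= A) ->
  (forall t, s <= t <= s + 3 * d -> b0 <= b t) ->
  (forall t, s <= t <= s + 3 * d -> (a t - b t * pw p (y t)) * y t <= A * Y) /\
  exists2 t, s + d <= t <= s + 2 * d & y t < Y /\ `|v t| <= Y / d + A * Y * d.
Proof.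
mark; move=> p0 d0 A0 b00 Y0 hY dy dv y0 aA bb.
have sq : 0 <= (pi / d) ^+ 2 := sqr_ge0 _.
have big t : s <= t <= s + 3 * d -> Y <= y t -> a t - b t * pw p (y t) <= - (pi / d) ^+ 2.
  move=> ht hy; apply: le_trans hY; apply: lerB; first exact: aA.
  apply: ler_pM; [exact: ltW|exact: pw_ge0|exact: bb|].
  by apply: pw_le => //; rewrite !ger0_norm ?(ltW Y0) ?(le_trans (ltW Y0) hy).
have up t : s <= t <= s + 3 * d -> (a t - b t * pw p (y t)) * y t <= A * Y.
  move=> ht; have yt := y0 t ht; have AY : 0 <= A * Y by rewrite mulr_ge0 // ltW.
  have [hy|/ltW hy] := leP Y (y t).
    by apply: le_trans AY; apply: mulr_le0_ge0 => //; have := big t ht hy; lraf sq.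
  apply: (@le_trans _ _ (A * y t)); last by rewrite ler_wpM2l.
  rewrite ler_wpM2r //; have : 0 <= b t * pw p (y t).
    by rewrite mulr_ge0 ?pw_ge0 // (le_trans (ltW b00)) ?bb.
  by have := aA t ht; lra.
split => //.
(* If [Y <= y] on the whole middle third, the coefficient there is at most [- (pi / d)^2], against
   Sturm. *)
have [t ht yt] : exists2 t, s + d <= t <= s + 2 * d & y t < Y.
  apply: contrapT => hn.
  have yY t : s + d <= t <= s + d + d -> Y <= y t.
    by move=> ht; rewrite leNgt; apply/negP => hy; apply: hn; exists t => //; lraf ht.
  apply: (@sturm_window y v (fun t => a t - b t * pw p (y t)) (s + d) d d0).
  - by move=> t ht; apply: dy; lraf ht d0.
  - by move=> t ht; apply: dv; lraf ht d0.
  - by move=> t /yY; lraf Y0.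
  - by move=> t ht; apply: big; [lraf ht d0|exact: yY].
exists t => //; split => //.
have /andP[ht1 ht2] := ht.
have vmono x1 x2 : s <= x1 -> x1 <= x2 -> x2 <= s + 3 * d -> v x2 - v x1 <= A * Y * (x2 - x1).
  move=> h1 h2 h3.
  have : A * Y * x1 - v x1 <= A * Y * x2 - v x2.
    apply: (incrD (f := fun x => A * Y * x - v x)
      (f' := fun x => A * Y - (a x - b x * pw p (y x)) * y x) h2) => x hx.
      have D1 := isD_lin (A * Y) x; have D2 : isD v x ((a x - b x * pw p (y x)) * y x).
        by apply: dv; lraf hx h1 h3.
      exact: isD_add D1 (isD_opp D2).
    by rewrite subr_ge0 up //; lraf hx h1 h3.
  by lraf.
have AYd x : 0 <= x <= d -> A * Y * x <= A * Y * d.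
  by move=> /andP[_ xd]; rewrite ler_wpM2l // mulr_ge0 // ltW.
(* Since [0 <= y] and [y t < Y], the mean slope after [t] exceeds [- Y / d] and the one before [t]
   is below [Y / d]; [v] grows at rate at most [A Y], which carries both bounds to [t]. *)
have [c /andP[c1 c2] ec] := @MVTD _ y v t (t + d) ltac:(lraf d0) (fun x hx => dy x ltac:(lraf hx ht d0)).
have [e /andP[e1 e2] ee] := @MVTD _ y v (t - d) t ltac:(lraf d0) (fun x hx => dy x ltac:(lraf hx ht d0)).
have w1 := vmono t c ltac:(lraf ht d0) c1 ltac:(lraf ht d0 c2); have w2 := vmono e t ltac:(lraf ht e1 d0) e2 ltac:(lraf ht d0).
have q1 := AYd (c - t) ltac:(lraf c1 c2); have q2 := AYd (t - e) ltac:(lraf e1 e2).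
have z1 : 0 <= y (t + d) by apply: y0; lraf ht d0.
have z2 : 0 <= y (t - d) by apply: y0; lraf ht d0.
have f1 : - (Y / d) <= v c.
  rewrite -mulNr ler_pdivrMr //; move: ec; rewrite (_ : t + d - t = d); last by ring.
  by lraf z1 yt.
have f2 : v e <= Y / d.
  rewrite ler_pdivlMr //; move: ee; rewrite (_ : t - (t - d) = d); last by ring.
  by lraf z2 yt.
by rewrite ler_norml; apply/andP; split; [lraf f1 w1 q1|lraf f2 w2 q2].
Qed.

End Windows.

(** * A large phase at [t0] forces many zeros *)

Section ManyZeros.
Variables (R : realType) (p l0 l1 gam kap t0 FL : R) (a b b1 om om1 F F1 : R -> R).
Hypothesis H : emden_data p l0 l1 gam kap t0 FL a b b1 om om1 F F1.
Implicit Types (y v z w : R -> R) (t T M d s : R) (k : nat).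

Definition sol s y v := forall t, s <= t ->
  isD y t (v t) /\ isD v t (a t * y t - b t * npow p (y t)).

Lemma solN s y v : sol s y v -> sol s (fun t => - y t) (fun t => - v t).
Proof.
move=> S t /S[D1 D2]; split; first exact: isD_opp.
by apply: (isD_eq (isD_opp D2)); rewrite npowN; ring.
Qed.

Lemma sol_le s s' y v : s <= s' -> sol s y v -> sol s' y v.
Proof. by move=> ss S t st; apply: S; lra. Qed.

Lemma sol_factor s y v : sol s y v ->
  forall t, s <= t -> isD v t ((a t - b t * pw p (y t)) * y t).
Proof. by move=> S t /S[_ D]; apply: (isD_eq D); rewrite /npow; ring. Qed.

Lemma pos_after s y v : sol s y v -> 0 <= y s -> 0 <= v s -> 0 < y s + v s ->
  exists2 e, 0 < e & forall t, s < t <= s + e -> 0 < y t.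
Proof.
move=> S ys vs yv; have [D1 D2] := S s (lexx s).
have [y0|y0] := eqVneq (y s) 0; last first.
  have y1 : 0 < y s by rewrite lt_neqAle eq_sym y0.
  have [r r0 hr] := isD_cont D1 y1; exists (r / 2); first lra.
  move=> t ht; have := hr t; rewrite ltr_norml => /(_ ltac:(lra)).
  by rewrite ltr_norml; lra.
have v1 : 0 < v s by rewrite y0 in yv; lra.
have [r r0 hr] := isD_cont D2 v1; exists (r / 2); first lra.
move=> t /andP[st ht]; rewrite -y0; apply: (incrSD (f' := v) st) => x hx.
  by have [] := S x ltac:(lra).
have := hr x; rewrite ltr_norml => /(_ ltac:(lra)).
by rewrite ltr_norml; lra.
Qed.

(** The start may itself be a zero with positive slope, as when zeros are found one after another,
    so the search begins slightly later. *)
Lemma first_zero s y v T : sol s y v -> 0 <= y s -> 0 <= v s -> 0 < y s + v s ->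
  (forall t, s < t <= T -> 0 < y t) \/
  exists2 c, s < c <= T & [/\ y c = 0, v c <= 0 & forall t, s < t < c -> 0 < y t].
Proof.
move=> S ys vs yv; have [e e0 he] := pos_after S ys vs yv.
have [Tse|/ltW seT] := leP T (s + e); first by left => t ht; apply: he; lra.
have [hall|/existsNP[t1 /not_implyP[ht1 /negP]]] :=
  pselect (forall t, s + e <= t <= T -> 0 < y t); last rewrite -leNgt => yt1.
  by left => t ht; have [h|h] := leP t (s + e); [apply: he|apply: hall]; lra.
right; have [|||c hc [yc hc']] := @first_exit _ (fun t => - y t) (s + e) T.
- by move=> t ht; have [D _] := S t ltac:(lra); exact: isD_cont (isD_opp D).
- by rewrite oppr_lt0 he //; lra.
- by exists t1 => //; rewrite oppr_ge0.
have pos t : s < t < c -> 0 < y t.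
  move=> ht; have [h|h] := leP t (s + e); first by apply: he; lra.
  by have := hc' t; rewrite oppr_lt0; apply; lra.
have {}yc : y c = 0 by lra.
have sc : s < c by lra.
exists c; first lra.
split => //; have [D _] := S c ltac:(lra).
rewrite -oppr_ge0; apply: (isD_left_ge (isD_opp D) sc) => t /andP[st].
rewrite le_eqVlt => /predU1P[->//|tc]; rewrite yc oppr0 oppr_le0.
have [->//|ts] := eqVneq t s; apply/ltW/pos; rewrite tc andbT lt_neqAle eq_sym ts //.
Qed.

(** An upper bound for [a] on a fixed window, named here because the step [e] of [quick_zero]
    depends on it. *)
Let A := sval (cid2 (cont_bounded (fun t (_ : t0 <= t <= t0 + 2) => a_cont H t))).
Let A0 : 0 < A. Proof. by rewrite /A; case: cid2. Qed.
Let aA t : t0 <= t <= t0 + 2 -> a t <= A.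
Proof.
by rewrite /A; case: cid2 => x /= _ h /h; apply: le_trans; exact: ler_norm.
Qed.

Lemma b_ge0_right t : t0 <= t -> 0 <= b t.
Proof.
rewrite le_eqVlt => /predU1P[<-|/(b_pos H)/ltW//].
rewrite leNgt; apply/negP => bn; have nb : 0 < - b t0 by lra.
have [r r0 hr] := isD_cont (b_der H t0) nb.
have := hr (t0 + r / 2); rewrite (_ : t0 + r / 2 - t0 = r / 2); last by ring.
rewrite gtr0_norm; last lra.
move=> /(_ ltac:(lra)); rewrite ltr_norml => /andP[_ h].
have tr : t0 < t0 + r / 2 by lra.
by have := b_pos H tr; lra.
Qed.

(** At bounded height the force is bounded, so a large initial phase must first lift [y] very high;
    a high solution has to return to zero within time [4 e], and so arrives with a steep slope. The
    upward force is controlled by [A y] alone, which makes the estimate uniform in the height. *)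
Lemma quick_zero e S : 0 < e -> e <= 8^-1 -> 32 * e ^+ 2 * A <= 1 -> 0 < S ->
  exists2 N, 0 < N & forall y v s, sol s y v -> t0 <= s <= t0 + 1 -> 0 <= y s -> 0 <= v s ->
    N <= y s + v s ->
    exists2 c, s < c <= s + 4 * e & [/\ y c = 0, v c <= - S & forall t, s < t < c -> 0 < y t].
Proof.
mark; move=> e0 e8 eA S0; have p0 := p_gt0 H.
(* [b] has no positive lower bound up to [t0], so the Sturm window starts a step [e] after [s]. *)
have [m m0 hm] : exists2 m, 0 < m & forall t, t0 + e <= t <= t0 + 2 -> m <= b t.
  apply: cont_pos_min; first lra.
    by move=> t _; exact: isD_cont (b_der H t).
  by move=> t ht; apply: (b_pos H); lra.
have [B B0 hB] := cont_bounded (a := t0) (b := t0 + 2) (fun t _ => isD_cont (b_der H t)).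
pose Q := (A + (pi / e) ^+ 2) / m.
have Q0 : 0 < Q by rewrite divr_gt0 // ltr_pwDl // sqr_ge0.
have [Y Y0 pY] := pw_root p0 Q0.
have hY : A - m * pw p Y <= - (pi / e) ^+ 2.
  by rewrite pY /Q mulrC divfK ?gt_eqF //; lra.
pose V := Y / e + A * Y * e.
have V0 : 0 <= V by rewrite addr_ge0 // ?divr_ge0 ?mulr_ge0 // ltW.
(* [K] bounds the height reached when no zero occurs. In [M1] the summand [8 e S] is what later
   yields a final slope of size [S]. *)
pose K := 2 * (Y + 3 * e * V).
pose M1 := 8 * e * S + K.
have K0 : 0 < K by rewrite /K; have := mulr_ge0 (ltW e0) V0; lra.
have M10 : 0 < M1 by rewrite /M1; have := mulr_gt0 e0 S0; lra.
(* below the level [x] the force is bounded by [C x] *)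
pose C x := (A + B * pw p x) * x.
have C0 x : 0 <= x -> 0 <= C x.
  by move=> x0; rewrite mulr_ge0 // addr_ge0 ?mulr_ge0 ?pw_ge0 // ltW.
exists (M1 + V + 4 * e * C M1 + 1).
  by have := C0 M1 (ltW M10) => h; have := mulr_ge0 (ltW e0) h; lra.
move=> y v s sl hs ys vs hN.
have CM0 : 0 <= e * C M1 by rewrite mulr_ge0 ?C0 // ltW.
have yv : 0 < y s + v s by lra.
have dy t : s <= t -> isD y t (v t) by move=> /sl[].
have dv := sol_factor sl.
have lowv (x r T : R) : 0 <= x -> s <= r -> r <= T -> T <= s + 4 * e ->
    (forall t, s <= t <= T -> 0 <= y t <= x) -> - (4 * e * C x) <= v T - v r.
  move=> x0 sr rT Ts yx.
  have : v r + C x * r <= v T + C x * T.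
    apply: (incrD (f := fun t => v t + C x * t)
      (f' := fun t => (a t - b t * pw p (y t)) * y t + C x) rT) => t ht.
      have D1 := dv t ltac:(lraf sr ht); have D2 := isD_lin (C x) t; exact: isD_add D1 D2.
    have /andP[y1 y2] := yx t ltac:(lraf sr ht).
    have ht2 : t0 <= t <= t0 + 2 by lraf sr ht Ts hs e8.
    have bB : b t * pw p (y t) <= B * pw p x.
      apply: le_trans (ler_norm _) _; rewrite normrM; apply: ler_pM => //; first exact: hB.
      by rewrite ger0_norm ?pw_ge0 // pw_le // !ger0_norm.
    have a0 := a_gt0 H t.
    suff : - (A + B * pw p x) * y t <= (a t - b t * pw p (y t)) * y t.
      have : (A + B * pw p x) * y t <= C x.
        by rewrite ler_wpM2l // addr_ge0 ?mulr_ge0 ?pw_ge0 // ltW.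
      by rewrite mulNr; lraf.
    by rewrite ler_wpM2r //; have := A0; lraf bB a0.
  have : C x * (T - r) <= C x * (4 * e) by rewrite ler_wpM2l ?C0 //; lraf sr Ts.
  by rewrite mulrBr; lraf.
have upv (x r T : R) : 0 <= x -> s <= r -> r <= T -> T <= s + 4 * e ->
    (forall t, s <= t <= T -> 0 <= y t <= x) -> v T - v r <= A * x * (T - r).
  move=> x0 sr rT Ts yx.
  have : A * x * r - v r <= A * x * T - v T.
    apply: (incrD (f := fun t => A * x * t - v t)
      (f' := fun t => A * x - (a t - b t * pw p (y t)) * y t) rT) => t ht.
      have D1 := dv t ltac:(lraf sr ht); have D2 := isD_lin (A * x) t; exact: isD_add D2 (isD_opp D1).
    have /andP[y1 y2] := yx t ltac:(lraf sr ht).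
    have ht2 : t0 <= t <= t0 + 2 by lraf sr ht Ts hs e8.
    have bt := b_ge0_right (proj1 (andP ht2)); have at_ := aA ht2.
    have : (a t - b t * pw p (y t)) * y t <= A * y t.
      rewrite ler_wpM2r //.
      by have := mulr_ge0 bt (pw_ge0 p (y t)); lraf at_.
    have : A * y t <= A * x by rewrite ler_wpM2l // ltW.
    by lraf.
  by rewrite mulrBr; lraf.
have ymax T : s <= T -> exists2 tm, s <= tm <= T & forall t, s <= t <= T -> y t <= y tm.
  move=> sT; have [|tm htm hmax] := @EVT_max R y s T sT.
    by apply: cont_within => t /andP[st _]; exact: isD_cont (dy t st).
  by exists tm; [rewrite in_itv in htm|move=> t ht; apply: hmax; rewrite in_itv].
have [hpos|[c hc [yc vc posc]]] := first_zero (s + 4 * e) sl ys vs yv.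
  exfalso.
  have ynn t : s <= t <= s + 4 * e -> 0 <= y t.
    move=> ht; have [->//|ts] := eqVneq t s; apply/ltW/hpos.
    by have /andP[h1 h2] := ht; rewrite h2 andbT lt_neqAle eq_sym ts.
  have [] := @apriori_window R p y v a b (s + e) e A m Y p0 e0 (ltW A0) m0 Y0 hY.
  - by move=> t ht; apply: dy; lraf ht e0.
  - by move=> t ht; apply: dv; lraf ht e0.
  - by move=> t ht; apply: ynn; lraf ht e0.
  - by move=> t ht; apply: aA; lraf ht hs e0 e8.
  - by move=> t ht; apply: hm; lraf ht hs e0 e8.
  move=> _ [q hq [yq vq]]; have sq : s <= q by lraf hq e0.
  have [tm htm hmax] := ymax q sq.
  have yx t : s <= t <= q -> 0 <= y t <= y tm.
    by move=> ht; rewrite hmax // andbT ynn //; lraf ht hq e0.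
  have ytm0 : 0 <= y tm by apply: ynn; lraf htm hq e0.
  have bound : y tm <= K.
    have [x /andP[x1 x2] ex] := @MVTD _ y v tm q ltac:(lraf htm) (fun t ht => dy t ltac:(lraf htm ht)).
    have h1 := upv (y tm) x q ytm0 ltac:(lraf htm x1) x2 ltac:(lraf hq e0) yx.
    have h2 : A * y tm * (q - x) <= A * y tm * (3 * e).
      by rewrite ler_wpM2l ?mulr_ge0 ?(ltW A0) //; lraf hq e0 htm x1.
    have h3 : v x * (q - tm) >= - (V + A * y tm * (3 * e)) * (3 * e).
      have vxl : - (V + A * y tm * (3 * e)) <= v x.
        by move: vq; rewrite -/V ler_norml => /andP[]; lraf h1 h2.
      have P0 : 0 <= V + A * y tm * (3 * e).
        by rewrite addr_ge0 // !mulr_ge0 ?(ltW A0) ?(ltW e0).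
      apply: (@le_trans _ _ (- (V + A * y tm * (3 * e)) * (q - tm))).
        by rewrite !mulNr lerN2 ler_wpM2l //; lraf hq e0 htm.
      by rewrite ler_wpM2r //; lraf vxl htm.
    have h4 : A * y tm * (3 * e) * (3 * e) <= y tm / 2.
      rewrite (_ : A * y tm * (3 * e) * (3 * e) = (9 * (e ^+ 2 * A)) * y tm); last by ring.
      have : 9 * (e ^+ 2 * A) <= 1 / 2 by have := mulr_ge0 (sqr_ge0 e) (ltW A0); lraf eA.
      by move=> h; have := ler_wpM2r ytm0 h; lraf.
    by rewrite /K; lraf h3 h4 ex yq.
  have yx' t : s <= t <= q -> 0 <= y t <= M1.
    move=> ht; have /andP[-> h] := yx t ht; rewrite /= (le_trans h) // (le_trans bound) //.
    by rewrite /M1; have := mulr_gt0 e0 S0; lraf.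
  have hv := lowv M1 s q (ltW M10) (lexx s) sq ltac:(lraf hq e0) yx'.
  have := yx' s; rewrite lexx sq => /(_ isT) /andP[_ ysM].
  by move: vq; rewrite -/V ler_norml => /andP[]; lraf hv hN ysM.
exists c => //; have /andP[sc cs] := hc.
have ynn t : s <= t <= c -> 0 <= y t.
  move=> /andP[h1 h2]; have [->//|ts] := eqVneq t s; have [->|tc] := eqVneq t c; first by rewrite yc.
  by apply/ltW/posc; rewrite !lt_neqAle eq_sym ts tc h1.
have [tm htm hmax] := ymax c (ltW sc).
have yx t : s <= t <= c -> 0 <= y t <= y tm by move=> ht; rewrite hmax // ynn.
have ytm0 : 0 <= y tm by apply: ynn.
(* Below [M1] the force changes [v] by at most [4 e C M1], so [v] would stay positive; but it is
   nonpositive somewhere, because [y c = 0 <= y s]. *)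
have large : M1 <= y tm.
  rewrite leNgt; apply/negP => small.
  have yx' t : s <= t <= c -> 0 <= y t <= M1.
    by move=> ht; have /andP[-> h] := yx t ht; rewrite /= (le_trans h) // ltW.
  have [x /andP[x1 x2] ex] := @MVTD _ y v s c (ltW sc) (fun t ht => dy t (proj1 (andP ht))).
  have vx : v x <= 0.
    rewrite leNgt; apply/negP => vx; have : 0 < v x * (c - s) by rewrite mulr_gt0 // subr_gt0.
    by rewrite -ex yc; lraf ys.
  have h := lowv M1 s x (ltW M10) (lexx s) x1 ltac:(lraf x2 cs) (fun t ht => yx' t ltac:(lraf ht x2)).
  have := yx' s; rewrite lexx (ltW sc) => /(_ isT) /andP[_ ysM]; lraf h vx hN V0 ysM.
(* The mean slope of the descent from [y tm] and the bound on the growth of [v] give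
   [y tm <= 4 e (- v c) + 16 e^2 A y tm], whose last term is at most half of [y tm]. *)
split => //; have [x /andP[x1 x2] ex] := @MVTD _ y v tm c ltac:(lraf htm) (fun t ht => dy t ltac:(lraf htm ht)).
have h1 := upv (y tm) x c ytm0 ltac:(lraf htm x1) x2 cs yx.
have h2 : A * y tm * (c - x) <= A * y tm * (4 * e).
  by rewrite ler_wpM2l ?mulr_ge0 ?(ltW A0) //; lraf cs htm x1.
have h3 : - (- v c + A * y tm * (4 * e)) * (4 * e) <= v x * (c - tm).
  have P0 : 0 <= - v c + A * y tm * (4 * e).
    by rewrite addr_ge0 ?oppr_ge0 // !mulr_ge0 ?(ltW A0) ?(ltW e0).
  apply: (@le_trans _ _ (- (- v c + A * y tm * (4 * e)) * (c - tm))).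
    by rewrite !mulNr lerN2 ler_wpM2l //; lraf cs htm.
  by rewrite ler_wpM2r //; [lraf htm|lraf h1 h2].
have h4 : A * y tm * (4 * e) * (4 * e) <= y tm / 2.
  rewrite (_ : A * y tm * (4 * e) * (4 * e) = (16 * (e ^+ 2 * A)) * y tm); last by ring.
  have : 16 * (e ^+ 2 * A) <= 1 / 2 by lraf eA.
  by move=> h; have := ler_wpM2r ytm0 h; lraf.
have h5 : y tm <= 8 * e * - v c by rewrite yc in ex; lraf ex h3 h4.
have h6 : 8 * e * S <= 8 * e * - v c by apply: le_trans h5; apply: le_trans large; rewrite /M1; lraf K0.
have e8' : 0 < 8 * e by rewrite mulr_gt0.
by move: h6; rewrite ler_pM2l //; lraf.
Qed.

(** [quick_zero] is iterated, with the sign reversed at each zero. The slope demanded at a zero is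
    the threshold of the next step, so the thresholds are chosen backwards. *)
Lemma many_zeros k : exists2 N, 0 < N & forall y v, sol t0 y v -> 0 <= y t0 -> 0 <= v t0 ->
  N <= y t0 + v t0 -> atleast y k.
Proof.
mark; pose k1 : R := k.+1%:R; have k10 : 1 <= k1 by rewrite ler1n.
(* The first entry lets [k] steps of length [4 e] fit into [[t0, t0 + 1]]; the second gives
   [32 e^2 A <= 1]. *)
pose e := Num.min (8 * k1)^-1 (32 * A + 32)^-1.
have A32 : 0 < 32 * A + 32 by have := A0; move=> ?; lra.
have e0 : 0 < e by rewrite lt_min !invr_gt0 A32 andbT; lra.
have e1 : e <= (8 * k1)^-1 by rewrite ge_min lexx.
have e2 : e <= (32 * A + 32)^-1 by rewrite ge_min lexx orbT.
have e8 : e <= 8^-1 by rewrite (le_trans e1) // lef_pV2 ?posrE //; lra.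
have ek : 4 * e * k1 <= 1.
  have : e * (8 * k1) <= 1 by rewrite -ler_pdivlMr ?mul1r //; lra.
  have : 0 <= e * k1 by rewrite mulr_ge0 ?(ltW e0) //; lra.
  lra.
have eA : 32 * e ^+ 2 * A <= 1.
  have h : e * (32 * A + 32) <= 1 by rewrite -ler_pdivlMr ?mul1r.
  have h1 : e * (e * (32 * A)) <= e * 1.
    by rewrite ler_wpM2l ?(ltW e0) // (le_trans _ h) // ler_wpM2l ?(ltW e0) //; lra.
  by rewrite expr2 (_ : 32 * (e * e) * A = e * (e * (32 * A))); [lra|ring].
suff [N N0 hN] : exists2 N, 0 < N & forall y v s, sol s y v -> t0 <= s -> s + 4 * e * k%:R <= t0 + 1 ->
    0 <= y s -> 0 <= v s -> N <= y s + v s ->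
    exists zs : seq R, [/\ uniq zs, size zs = k & forall t, t \in zs -> s < t /\ y t = 0].
  exists N => // y v sl y0 v0 yv; have [||zs [u s h]] := hN y v t0 sl _ _ y0 v0 yv => //.
    by rewrite lerD2l (le_trans _ ek) // ler_wpM2l ?mulr_ge0 ?(ltW e0) // ler_nat.
  by exists zs; split => // t /h[].
elim: (k) => [|j [N N0 IH]]; first by exists 1 => // *; exists [::].
have [N' N'0 hN'] := quick_zero e0 e8 eA N0.
exists N' => // y v s sl ts hs ys vs yv.
have j0 : 0 <= 4 * e * j%:R by rewrite !mulr_ge0 ?ler0n ?(ltW e0).
have hs' : s + 4 * e * j%:R + 4 * e <= t0 + 1.
  have ej : j.+1%:R = j%:R + 1 :> R by rewrite natr1.
  by move: hs; rewrite ej mulrDr mulr1 addrA.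
have [|c hc [yc vc pos]] := hN' y v s sl _ ys vs yv; first by lraf ts hs' j0 e0.
have /andP[sc cs] := hc.
have {hN'} [|||||zs [u sz h]] := IH _ _ c (sol_le (ltW sc) (solN sl)).
- exact: le_trans ts (ltW sc).
- by lraf hs' cs.
- by rewrite yc oppr0.
- by lraf vc N0.
- by rewrite yc; lraf vc.
exists (c :: zs); split; rewrite /= ?sz //.
  by rewrite u andbT; apply/negP => /h[]; rewrite ltxx.
move=> t; rewrite inE => /orP[/eqP->|/h[ct /eqP]]; first by split => //; lraf sc.
by rewrite oppr_eq0 => /eqP; split => //; lraf sc ct.
Qed.

End ManyZeros.

(** * Behaviour at [+oo] *)

Lemma ctn_max (R : realType) (f g : R -> R) t : ctn f t -> ctn g t ->
  ctn (fun s => Num.max (f s) (g s)) t.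
Proof.
move=> cf cg e e0; have [d1 d10 h1] := cf e e0; have [d2 d20 h2] := cg e e0.
exists (Num.min d1 d2); first by rewrite lt_min d10.
move=> s; rewrite lt_min => /andP[/h1 + /h2]; rewrite !ltr_norml => /andP[? ?] /andP[? ?].
by have [?|?] := leP (f s) (g s); have [?|?] := leP (f t) (g t); apply/andP; split; lra.
Qed.

(* [mu] is a repelling rate, so the only bounded solutions of [z' = mu z - Q]
   are those that converge. *)
Lemma limP_unstable (R : realType) (mu M T q : R) (z Q : R -> R) : 0 < mu ->
  (forall t, T <= t -> isD z t (mu * z t - Q t)) -> (forall t, T <= t -> `|z t| <= M) ->
  limP Q q -> limP z (q / mu).
Proof.
move=> mu0.
have half (z' Q' : R -> R) (q' : R) : (forall t, T <= t -> isD z' t (mu * z' t - Q' t)) ->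
    (forall t, T <= t -> `|z' t| <= M) -> limP Q' q' -> forall e, 0 < e ->
    exists T', forall t, T' <= t -> z' t - q' / mu < e.
  move=> dz zM Ql e e0; have me : 0 < mu * e / 2 by rewrite divr_gt0 // mulr_gt0.
  have [T1 h1] := Ql _ me; exists (Num.max T T1) => t1; rewrite ge_max => /andP[Tt Tt1].
  rewrite ltNge; apply/negP => h.
  (* Chosen so that [mu A e / 2 = M + |q' / mu| + e]: after time [A] the deviation has grown beyond
     what the bound [M] permits. *)
  pose A := 2 * (M + `|q' / mu| + e) / (mu * e).
  have A0 : 0 <= A.
    rewrite divr_ge0 ?mulr_ge0 ?(ltW mu0) ?(ltW e0) //.
    have := zM T (lexx _); have := normr_ge0 (z' T); have := normr_ge0 (q' / mu); lra.
  have key : expR (- mu * t1) * (z' t1 - q' / mu - e / 2) <=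
      expR (- mu * (t1 + A)) * (z' (t1 + A) - q' / mu - e / 2).
    apply: (incrD (f := fun t => expR (- mu * t) * (z' t - q' / mu - e / 2))
      (f' := fun t => expR (- mu * t) * (mu * (q' / mu) + mu * e / 2 - Q' t))); first lra.
      move=> t /andP[t1t _]; have D1 := isD_explin (- mu) t; have D2 := dz t ltac:(lra).
      isD_calc.
    move=> t /andP[t1t _]; rewrite mulr_ge0 ?expR_ge0 // mulrCA divff ?mulr1 ?gt_eqF //.
    by have := h1 t ltac:(lra); rewrite ltr_norml => /andP[]; lra.
  have h2 : expR (mu * A) * (e / 2) <= z' (t1 + A) - q' / mu - e / 2.
    have h3 := ler_wpM2l (expR_ge0 (mu * (t1 + A))) key.
    have e1 : expR (mu * (t1 + A)) * expR (- mu * t1) = expR (mu * A).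
      by rewrite -expRD; congr expR; ring.
    have e2 : expR (mu * (t1 + A)) * expR (- mu * (t1 + A)) = 1.
      by rewrite -expRD mulNr addrN expR0.
    rewrite [X in X <= _]mulrA [X in _ <= X]mulrA e1 e2 mul1r in h3.
    by apply: le_trans h3; rewrite ler_wpM2l ?expR_ge0 //; lra.
  have h4 : (1 + mu * A) * (e / 2) <= expR (mu * A) * (e / 2).
    by rewrite ler_wpM2r ?expR_ge1Dx //; lra.
  have h5 : mu * A * (e / 2) = M + `|q' / mu| + e by rewrite /A; field; rewrite !gt_eqF.
  have := zM (t1 + A) ltac:(lra); have := ler_norm (z' (t1 + A)); have := ler_norm (- (q' / mu)).
  by rewrite normrN; lra.
move=> dz zM Ql e e0; have [T1 h1] := half z Q q dz zM Ql e e0.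
have [|||T2 h2] := half (fun t => - z t) (fun t => - Q t) (- q) _ _ _ e e0.
- by move=> t /dz D; apply: (isD_eq (isD_opp D)); ring.
- by move=> t /zM; rewrite normrN.
- by have := limP_Z (-1) Ql; rewrite mulN1r; apply: (limP_ext (T := 0)) => t _; rewrite mulN1r.
exists (Num.max T1 T2) => t; rewrite ge_max => /andP[/h1 a1 /h2 a2].
by move: a2; rewrite mulNr ltr_norml; lra.
Qed.

(** * A Lyapunov function for the limit equation *)

Section Potential.
Variables (R : realType) (p gam kap c P : R).
Hypotheses (p0 : 0 < p) (gam0 : 0 < gam) (kap0 : 0 < kap) (P0 : 0 < P).
Hypothesis cE : c = kap * pw p P.
Implicit Types (x s e r : R).

Definition gg x := kap * npow p x - c * x.
Definition GG x := kap * gpow p x - c * (x ^+ 2 / 2).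
(** The usual energy [s^2/2 + GG x] loses only [2 gam s^2]. The added terms change the loss into
    [gam DD], which in [0 <= x] vanishes only at the equilibria. Moreover
    [VV 0 s = V00 + s^2/2 - gam P s], so an orbit below the level [V00], the value at the origin,
    cannot leave [0 < x] through [x = 0]. *)
Definition VV x s := (s + gam * (x - P)) ^+ 2 / 2 + gam ^+ 2 * (x - P) ^+ 2 / 2 + GG x.
Definition V00 := gam ^+ 2 * P ^+ 2.
Definition DD x s := s ^+ 2 + (x - P) * gg x.

Lemma c_gt0 : 0 < c.
Proof. by rewrite cE mulr_gt0 // pw_gt0 // gt_eqF. Qed.

Lemma ggE x : gg x = kap * (pw p x - pw p P) * x.
Proof. by rewrite /gg cE /npow; ring. Qed.

Lemma gg_sign x : 0 <= x -> 0 <= (x - P) * gg x.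
Proof.
move=> x0; rewrite ggE (_ : _ * _ = kap * x * ((x - P) * (pw p x - pw p P))); last by ring.
apply: mulr_ge0; first by rewrite mulr_ge0 // ltW.
have [xP|/ltW Px] := leP x P.
  by rewrite mulr_le0 ?subr_le0 // pw_le // !ger0_norm // ltW.
by rewrite mulr_ge0 ?subr_ge0 // pw_le // !ger0_norm // ltW.
Qed.

Lemma isD_GG x : isD GG x (gg x).
Proof.
have D1 := isD_gpow p0 x; have D2 : isD (fun x : R => x ^+ 2 / 2) x x.
  by apply: isD_eq; [isD_auto|rewrite /=; field].
apply: (isD_eq (isD_add (isD_mul (isD_cst kap x) D1) (isD_opp (isD_mul (isD_cst c x) D2)))).
by rewrite /gg /=; ring.
Qed.

Lemma GG0 : GG 0 = 0.
Proof. by rewrite /GG gpow0 // expr0n /= mul0r !mulr0 subr0. Qed.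

Lemma GG_min x : 0 <= x -> GG P <= GG x.
Proof.
move=> x0; have [xP|/ltW Px] := leP x P.
  rewrite -lerN2; apply: (incrD (f := fun t => - GG t) (f' := fun t => - gg t) xP) => t /andP[xt tP].
    exact: isD_opp (isD_GG t).
  have t0 : 0 <= t by lra.
  rewrite ggE oppr_ge0 mulr_le0_ge0 // mulr_ge0_le0 // ?(ltW kap0) // subr_le0.
  by rewrite pw_le // !ger0_norm // ltW.
apply: (incrD (f := GG) (f' := gg) Px) => t /andP[Pt tx]; first exact: isD_GG.
have t0 : 0 <= t by have := P0; move=> ?; lra.
rewrite ggE mulr_ge0 // mulr_ge0 // ?(ltW kap0) // subr_ge0.
by rewrite pw_le // !ger0_norm // ltW.
Qed.

Lemma GGP_lt : GG P < V00.
Proof.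
have c0 := c_gt0; have PP : 0 < P ^+ 2 by rewrite exprn_gt0.
have : GG P = - (c * P ^+ 2 * (p / (2 * (p + 2)))).
  by rewrite /GG /gpow cE; field; rewrite gt_eqF //; have := p0; move=> ?; lra.
move=> ->; apply: (@lt_trans _ _ 0); last by rewrite /V00 mulr_gt0 // exprn_gt0.
have hp := p0; have p2 : 0 < 2 * (p + 2) by lra.
by rewrite oppr_lt0; apply: mulr_gt0; [exact: mulr_gt0|exact: divr_gt0].
Qed.

Lemma VV_ge x s : 0 <= x -> GG P <= VV x s.
Proof.
move=> x0; have := GG_min x0; have := sqr_ge0 (s + gam * (x - P)).
by have := mulr_ge0 (sqr_ge0 gam) (sqr_ge0 (x - P)); rewrite /VV; lra.
Qed.

Lemma VV_bound : exists2 C, 0 < C & forall x s, 0 <= x -> VV x s <= V00 -> x <= C /\ `|s| <= C.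
Proof.
pose K := V00 - GG P; have K0 : 0 < K by rewrite subr_gt0 GGP_lt.
pose r := 1 + 2 * K / gam ^+ 2; pose q := 1 + 2 * K.
have g2 : 0 < gam ^+ 2 by rewrite exprn_gt0.
have r1 : 1 <= r by rewrite lerDl divr_ge0 ?(ltW g2) //; lra.
have sq_le (u m : R) : 0 <= m -> u ^+ 2 <= m -> `|u| <= 1 + m.
  move=> m0 um; rewrite -(@ler_pXn2r _ 2) ?nnegrE ?addr_ge0 // -normrX ger0_norm ?sqr_ge0 //.
  by have := sqr_ge0 m; rewrite sqrrD expr1n mul1r; lra.
have gr : 0 <= gam * r by rewrite mulr_ge0 ?(ltW gam0) //; lra.
exists (P + r + gam * r + q); first by have := P0; move=> ?; rewrite /q; lra.
move=> x s x0 h; have h1 := GG_min x0.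
have s1 := sqr_ge0 (s + gam * (x - P)); have s2 := mulr_ge0 (ltW g2) (sqr_ge0 (x - P)).
have b1 : `|x - P| <= r.
  apply: sq_le; first by rewrite divr_ge0 ?(ltW g2) //; lra.
  by rewrite ler_pdivlMr // mulrC; rewrite /VV in h; rewrite /K; lra.
have b2 : `|s + gam * (x - P)| <= q.
  by apply: sq_le; rewrite /VV in h; rewrite /K; lra.
have b3 : `|gam * (x - P)| <= gam * r by rewrite normrM (gtr0_norm gam0) ler_wpM2l // ltW.
split; first by move: b1; rewrite ler_norml /q => /andP[]; lra.
have := ler_normB (s + gam * (x - P)) (gam * (x - P)); rewrite addrK.
by have := P0; move=> ?; lra.
Qed.

Lemma VV_near0 e : 0 < e ->
  exists2 r, 0 < r & forall x s, `|x| <= r -> `|s| <= r -> `|VV x s - V00| < e.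
Proof.
move=> e0; have e2 : 0 < e / 2 by lra.
have [r1 r10 h1] := isD_cont (isD_GG 0) e2.
pose K := 1 / 2 + gam * (P + 1) + gam ^+ 2 * (1 + 2 * P).
have gP : 0 <= gam * (P + 1) by have := P0; move=> ?; rewrite mulr_ge0 ?(ltW gam0) //; lra.
have gP2 : 0 <= gam ^+ 2 * (1 + 2 * P) by have := P0; move=> ?; rewrite mulr_ge0 ?sqr_ge0 //; lra.
have K0 : 0 < K by rewrite /K; lra.
pose r := Num.min (Num.min 1 (r1 / 2)) (e / (2 * K)).
have r0 : 0 < r by rewrite !lt_min ltr01 !divr_gt0 ?mulr_gt0.
have ra : r <= 1 by rewrite !ge_min lexx.
have rb : r <= r1 / 2 by rewrite !ge_min lexx orbT.
have rc : r * K <= e / 2.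
  have : r <= e / (2 * K) by rewrite ge_min lexx orbT.
  by rewrite ler_pdivlMr ?mulr_gt0 //; lra.
exists r => // x s xr sr.
have hG : `|GG x| < e / 2 by have := h1 x; rewrite GG0 !subr0; apply; lra.
have -> : VV x s - V00 = s * s / 2 + gam * (s * (x - P)) + gam ^+ 2 * (x * (x - 2 * P)) + GG x.
  by rewrite /VV /V00; field.
have n1 : `|s * s / 2| <= r / 2.
  rewrite normrM [`|2^-1|]ger0_norm ?invr_ge0 // ler_wpM2r ?invr_ge0 // normrM.
  by rewrite -[X in _ <= X]mulr1 ler_pM // (le_trans sr).
have n2 : `|gam * (s * (x - P))| <= r * (gam * (P + 1)).
  rewrite normrM (gtr0_norm gam0) [X in _ <= X]mulrCA ler_wpM2l ?(ltW gam0) // normrM ler_pM //.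
  rewrite (le_trans (ler_normB _ _)) // (gtr0_norm P0) addrC lerD2l; lra.
have n3 : `|gam ^+ 2 * (x * (x - 2 * P))| <= r * (gam ^+ 2 * (1 + 2 * P)).
  rewrite normrM (ger0_norm (sqr_ge0 _)) [X in _ <= X]mulrCA ler_wpM2l ?sqr_ge0 // normrM ler_pM //.
  rewrite (le_trans (ler_normB _ _)) // [`|2 * P|]gtr0_norm ?mulr_gt0 // lerD2r; lra.
have t1 := ler_normD (s * s / 2 + gam * (s * (x - P)) + gam ^+ 2 * (x * (x - 2 * P))) (GG x).
have t2 := ler_normD (s * s / 2 + gam * (s * (x - P))) (gam ^+ 2 * (x * (x - 2 * P))).
have t3 := ler_normD (s * s / 2) (gam * (s * (x - P))).
by rewrite /K !mulrDr in rc; lra.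
Qed.

Lemma VV_nearP e : 0 < e ->
  exists2 r, 0 < r & forall x s, `|x - P| <= r -> `|s| <= r -> VV x s < GG P + e.
Proof.
move=> e0; have e2 : 0 < e / 2 by lra.
have [r1 r10 h1] := isD_cont (isD_GG P) e2.
pose K := 1 / 2 + gam + gam ^+ 2.
have K0 : 0 < K by rewrite /K; have := gam0; have := sqr_ge0 gam; move=> ? ?; lra.
pose r := Num.min (Num.min 1 (r1 / 2)) (e / (2 * K)).
have r0 : 0 < r by rewrite !lt_min ltr01 !divr_gt0 ?mulr_gt0.
have ra : r <= 1 by rewrite !ge_min lexx.
have rb : r <= r1 / 2 by rewrite !ge_min lexx orbT.
have rc : r * K <= e / 2.
  have : r <= e / (2 * K) by rewrite ge_min lexx orbT.
  by rewrite ler_pdivlMr ?mulr_gt0 //; lra.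
exists r => // x s xr sr.
have hG : `|GG x - GG P| < e / 2 by apply: h1; lra.
have sq1 (u w : R) : `|u| <= r -> `|w| <= r -> u * w <= r.
  move=> ur wr; apply: le_trans (ler_norm _) _; rewrite normrM.
  by rewrite -[X in _ <= X]mulr1 ler_pM // (le_trans wr).
have -> : VV x s = s * s / 2 + gam * (s * (x - P)) + gam ^+ 2 * ((x - P) * (x - P)) + GG x.
  by rewrite /VV; field.
have n1 := sq1 s s sr sr.
have n2 := ler_wpM2l (ltW gam0) (sq1 s (x - P) sr xr).
have n3 := ler_wpM2l (sqr_ge0 gam) (sq1 (x - P) (x - P) xr xr).
by move: hG; rewrite /K !mulrDr ltr_norml in rc *; move=> /andP[]; lra.
Qed.

(** Away from [0] and [P] the term [(x - P) gg x] is bounded below, also as [x] tends to infinity,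
    by monotonicity of [pw p]. *)
Lemma DD_small r : 0 < r -> exists2 e, 0 < e & forall x s, 0 <= x -> DD x s < e ->
  `|s| < r /\ (x < r \/ `|x - P| < r).
Proof.
move=> r0.
have [e1 e10 h1] : exists2 e1, 0 < e1 & forall x, r <= x -> x <= P - r -> e1 <= (x - P) * gg x.
  have [Pr|Pr] := leP (P - r) 0.
    by exists 1 => // x rx xP; exfalso; lra.
  exists (kap * r * (r * (pw p P - pw p (P - r)))).
    by rewrite !mulr_gt0 // subr_gt0 pw_lt // !gtr0_norm //; lra.
  move=> x rx xP.
  rewrite ggE (_ : (x - P) * _ = kap * x * ((P - x) * (pw p P - pw p x))); last by ring.
  have pp : pw p x <= pw p (P - r) by rewrite pw_le // !ger0_norm //; lra.
  have pp2 : pw p (P - r) <= pw p P by rewrite pw_le // !ger0_norm //; lra.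
  by apply: ler_pM; rewrite ?mulr_ge0 ?(ltW kap0) ?(ltW r0) ?subr_ge0 //;
    [rewrite ler_wpM2l // ltW|apply: ler_pM; lra].
have [e2 e20 h2] : exists2 e2, 0 < e2 & forall x, P + r <= x -> e2 <= (x - P) * gg x.
  exists (kap * P * (r * (pw p (P + r) - pw p P))).
    by rewrite !mulr_gt0 // subr_gt0 pw_lt // !gtr0_norm ?addr_gt0 // ltrDl.
  move=> x Px; have Pr : 0 < P + r by rewrite addr_gt0.
  rewrite ggE (_ : (x - P) * _ = kap * x * ((x - P) * (pw p x - pw p P))); last by ring.
  have pp : pw p (P + r) <= pw p x by rewrite pw_le // !ger0_norm //; lra.
  have pp2 : pw p P <= pw p (P + r) by rewrite pw_le // !ger0_norm //; [lra|exact: ltW|exact: ltW].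
  by apply: ler_pM; rewrite ?mulr_ge0 ?(ltW kap0) ?(ltW r0) ?(ltW P0) ?subr_ge0 //;
    [rewrite ler_wpM2l ?(ltW kap0) //; lra|apply: ler_pM; lra].
exists (Num.min (r ^+ 2) (Num.min e1 e2)); first by rewrite !lt_min exprn_gt0 // e10.
move=> x s x0; rewrite /DD !lt_min => /and3P[d1 d2 d3].
have q1 := gg_sign x0; have q2 := sqr_ge0 s; split.
  rewrite ltNge; apply/negP => rs.
  have : r ^+ 2 <= `|s| ^+ 2 by rewrite lerXn2r ?nnegrE // ltW.
  by rewrite real_normK ?num_real //; lra.
have [xr|rx] := ltP x r; first by left.
right; rewrite ltr_norml; apply/andP; split; rewrite ltNge; apply/negP => hx.
  by have := h1 x rx; lra.
by have := h2 x; lra.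
Qed.

(** At any level of [VV] away from the two critical values [V00] and [GG P] the dissipation is
    bounded below. *)
Lemma DD_level e : 0 < e -> exists2 r, 0 < r & forall x s, 0 <= x -> DD x s < r ->
  `|VV x s - V00| < e \/ VV x s < GG P + e.
Proof.
move=> e0; have [r1 r10 h1] := VV_near0 e0; have [r2 r20 h2] := VV_nearP e0.
have r0 : 0 < Num.min r1 r2 by rewrite lt_min r10.
have [d d0 hd] := DD_small r0; exists d => // x s x0 /(hd _ _ x0)[].
rewrite !lt_min => /andP[s1 s2] [/andP[x1 _]|/andP[_ x2]].
  by left; apply: h1; [rewrite ger0_norm // ltW|exact: ltW].
by right; apply: h2; exact: ltW.
Qed.

End Potential.

(** * The asymptotically autonomous equation: trapping and dichotomy *)

Section Tail.
Variables (R : realType) (p l0 l1 gam kap t0 FL : R) (a b b1 om om1 F F1 : R -> R).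
Hypothesis H : emden_data p l0 l1 gam kap t0 FL a b b1 om om1 F F1.
Variable P : R.
Hypotheses (P0 : 0 < P) (PE : l1 ^+ 2 - gam ^+ 2 = kap * pw p P).
Implicit Types (y v x s : R -> R) (t T e r : R).

Let c := l1 ^+ 2 - gam ^+ 2.
Let kk t := b t * expR (p * gam * t).
Let g := gg p kap c.
Let G := GG p kap c.
Let V := VV p gam kap c P.
Let Vo := V00 gam P.
Let D := DD p kap c P.
Let p0 := p_gt0 H.
Let gam0 := gam_gt0 H.
Let kap0 := kap_gt0 H.

Definition err t (z : R) := (a t - l1 ^+ 2) * z - (b t * expR (p * gam * t) - kap) * npow p z.

(* The solution in the variables [x = exp (- gam t) y], [s = x'], in which the
   equation is asymptotically autonomous. *)
Definition orb T x s := forall t, T <= t ->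
  isD x t (s t) /\ isD s t (- (2 * gam) * s t - g (x t) + err t (x t)).

Lemma orb_force t (z : R) : - g z + err t z = (a t - gam ^+ 2 - kk t * pw p z) * z.
Proof. by rewrite /g /gg /err /c /kk /npow; ring. Qed.

Lemma orbN T x s : orb T x s -> orb T (fun t => - x t) (fun t => - s t).
Proof.
move=> S t /S[D1 D2]; split; first exact: isD_opp.
by apply: (isD_eq (isD_opp D2)); rewrite /g /gg /err npowN; ring.
Qed.

Lemma orb_le T T' x s : T <= T' -> orb T x s -> orb T' x s.
Proof. by move=> TT S t Tt; apply: S; lra. Qed.

Lemma sol_orb T y v : sol p a b T y v ->
  orb T (fun t => expR (- gam * t) * y t) (fun t => expR (- gam * t) * (v t - gam * y t)).
Proof.
move=> S t /S[D1 D2]; have D3 := isD_explin (- gam) t; split; first by isD_calc.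
apply: isD_eq; first by isD_auto.
rewrite /= -[RHS]addrA orb_force /kk pwM pw_expR /npow.
have e1 : expR (p * gam * t) * expR (p * (- gam * t)) = 1.
  by rewrite -expRD (_ : _ + _ = 0) ?expR0 //; ring.
rewrite (_ : b t * expR (p * gam * t) * (expR (p * (- gam * t)) * pw p (y t)) =
  (expR (p * gam * t) * expR (p * (- gam * t))) * (b t * pw p (y t))); last by ring.
by rewrite e1; ring.
Qed.

(* Shifting the exponential factor to a base time [r] keeps the bounds on a
   window around [r] independent of [r]. *)
Lemma orb_window T x s r : orb T x s -> forall t, T <= t ->
  isD (fun t => expR (gam * (t - r)) * x t) t (expR (gam * (t - r)) * (s t + gam * x t)) /\
  isD (fun t => expR (gam * (t - r)) * (s t + gam * x t)) t
   ((a t - kk t * expR (- (p * gam) * (t - r)) * pw p (expR (gam * (t - r)) * x t)) *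
     (expR (gam * (t - r)) * x t)).
Proof.
move=> S t /S[D1 D2].
have D0 : isD (fun t => gam * (t - r)) t gam by isD_calc.
have D3 : isD (fun t => expR (gam * (t - r))) t (gam * expR (gam * (t - r))).
  by apply: (isD_eq (isD_expR D0)); rewrite mulrC.
split; first by isD_calc.
apply: isD_eq; first by isD_auto.
rewrite /= -(addrA _ (- g (x t))) orb_force pwM pw_expR.
have e1 : expR (- (p * gam) * (t - r)) * expR (p * (gam * (t - r))) = 1.
  by rewrite -expRD (_ : _ + _ = 0) ?expR0 //; ring.
rewrite (_ : kk t * _ * (_ * pw p (x t)) =
  (expR (- (p * gam) * (t - r)) * expR (p * (gam * (t - r)))) * (kk t * pw p (x t))); last by ring.
by rewrite e1; ring.
Qed.

Let a_near e : 0 < e -> exists T, forall t, T <= t -> `|a t - l1 ^+ 2| < e.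
Proof. by move=> e0; have [T h] := a_lim H e0; exists T. Qed.

Let kk_near e : 0 < e -> exists T, forall t, T <= t -> `|kk t - kap| < e.
Proof. by move=> e0; have [T h] := b_lim H e0; exists T. Qed.

Lemma err_small C e : 0 <= C -> 0 < e -> exists T, forall t, T <= t -> forall z, `|z| <= C -> `|err t z| <= e.
Proof.
move=> C0 e0; pose K := C + C * pw p C + 1.
have CC : 0 <= C * pw p C by rewrite mulr_ge0 ?pw_ge0.
have K0 : 0 < K by rewrite /K; lra.
have [T1 h1] := a_near (divr_gt0 e0 K0); have [T2 h2] := kk_near (divr_gt0 e0 K0).
exists (Num.max T1 T2) => t; rewrite ge_max => /andP[/h1 a1 /h2 a2] z zC.
have n1 : `|(a t - l1 ^+ 2) * z| <= e / K * C by rewrite normrM ler_pM // ltW.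
have n2 : `|(kk t - kap) * npow p z| <= e / K * (C * pw p C).
  rewrite normrM ler_pM //; first exact: ltW.
  rewrite /npow normrM ler_pM // ger0_norm ?pw_ge0 // pw_le // (ger0_norm C0) //.
have : e / K * K = e by rewrite divfK ?gt_eqF.
have : 0 <= e / K by rewrite divr_ge0 ?(ltW e0) ?(ltW K0).
rewrite /err -/(kk t); have := ler_normB ((a t - l1 ^+ 2) * z) ((kk t - kap) * npow p z).
by rewrite {3}/K !mulrDr mulr1; lra.
Qed.

(** The bound is independent of the orbit. Around [r] two windows of length [3] supply points with
    bounded phase, one on each side; since [v] grows at a bounded rate, the left one bounds [x r]
    and [v r] from above and the right one bounds [v r] from below. *)
Lemma orb_bound : exists2 C, 0 < C & exists T0, forall T x s, T0 <= T -> orb T x s ->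
  (forall t, T <= t -> 0 <= x t) -> forall t, T + 3 <= t -> x t <= C /\ `|s t| <= C.
Proof.
mark; have [T1 h1] := a_near ltr01.
have k2 : 0 < kap / 2 by have := kap0; move=> ?; lra.
have [T2 h2] := kk_near k2.
pose A := l1 ^+ 2 + 1; have A0 : 0 <= A by rewrite addr_ge0 ?sqr_ge0.
(* A lower bound for the rescaled coefficient, attained at the far end [r + 3] of the windows. *)
pose m := kap / 2 * expR (- (p * gam) * 3).
have m0 : 0 < m by rewrite mulr_gt0 ?expR_gt0.
pose Q := (A + (pi / 1) ^+ 2) / m.
have Q0 : 0 < Q by rewrite divr_gt0 // ltr_wpDl // exprn_gt0 // divr_gt0 ?pi_gt0.
have [Y Y0 pY] := pw_root p0 Q0.
have hY : A - m * pw p Y <= - (pi / 1) ^+ 2.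
  by rewrite pY /Q mulrC divfK ?gt_eqF //; lra.
pose W := Y / 1 + A * Y * 1.
have AY : 0 <= A * Y by rewrite mulr_ge0 // ltW.
have W0 : 0 <= W by rewrite /W divr1 mulr1; lra.
pose B := Y + 2 * (W + 2 * (A * Y)).
have gB : 0 <= gam * B by rewrite mulr_ge0 ?(ltW gam0) // /B; lra.
exists (W + 2 * (A * Y) + B + gam * B); first by rewrite /B in gB *; lra.
exists (Num.max T1 T2) => T x s; rewrite ge_max => /andP[TT1 TT2] S x0 r Tr.
have SW := orb_window r S.
pose y t := expR (gam * (t - r)) * x t.
pose v t := expR (gam * (t - r)) * (s t + gam * x t).
pose bb t := kk t * expR (- (p * gam) * (t - r)).
have win q : r - 3 <= q <= r -> (forall t, q <= t <= q + 3 * 1 ->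
    (a t - bb t * pw p (y t)) * y t <= A * Y) /\
    exists2 t, q + 1 <= t <= q + 2 * 1 & y t < Y /\ `|v t| <= W.
  move=> /andP[q1 q2].
  apply: (@apriori_window R p y v a bb q 1 A m Y p0 ltr01 A0 m0 Y0 hY) => t /andP[qt tq].
  - by have [] := SW t ltac:(lraf Tr q1 qt).
  - by have [] := SW t ltac:(lraf Tr q1 qt).
  - by rewrite mulr_ge0 ?expR_ge0 // x0 //; lraf Tr q1 qt.
  - by have := h1 t ltac:(lraf TT1 Tr q1 qt); rewrite ltr_norml /A => /andP[]; lraf.
  - have k1 : kap / 2 <= kk t by have := h2 t ltac:(lraf TT2 Tr q1 qt); rewrite ltr_norml => /andP[]; lraf.
    rewrite /bb /m; apply: ler_pM; [exact: ltW|exact: expR_ge0|exact: k1|].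
    rewrite ler_expR !mulNr lerN2 ler_wpM2l ?mulr_ge0 ?(ltW p0) ?(ltW gam0) //; lraf q2 tq.
have [up1 [q1 hq1 [yq1 vq1]]] := win (r - 3) ltac:(lraf Tr).
have [up2 [q2 hq2 [yq2 vq2]]] := win r ltac:(lraf Tr).
have vup (x1 x2 : R) : r - 3 <= x1 -> x1 <= x2 -> x2 <= r + 3 -> v x2 - v x1 <= A * Y * (x2 - x1).
  move=> e1 e2 e3; have : A * Y * x1 - v x1 <= A * Y * x2 - v x2; last by lraf.
  apply: (incrD (f := fun t => A * Y * t - v t)
    (f' := fun t => A * Y - (a t - bb t * pw p (y t)) * y t) e2) => t ht.
    have [_ D2] := SW t ltac:(lraf Tr e1 ht); exact: isD_add (isD_lin _ _) (isD_opp D2).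
  rewrite subr_ge0; have [tr|/ltW rt] := leP t r; first by apply: up1; lraf tr e1 ht.
  by apply: up2; lraf rt e3 ht.
have AYd u : u <= 2 -> A * Y * u <= 2 * (A * Y) by move=> u2; rewrite mulrC ler_wpM2r.
have {}vq1 := le_trans (ler_norm _) vq1.
have {}vq2 : - W <= v q2 by move: vq2; rewrite ler_norml => /andP[].
have e1 : y r = x r by rewrite /y subrr mulr0 expR0 mul1r.
have e2 : v r = s r + gam * x r by rewrite /v subrr mulr0 expR0 mul1r.
have yr : y r <= B.
  have [w hw ew] := @MVTD _ y v q1 r ltac:(lraf hq1) (fun t ht => (SW t ltac:(lraf Tr hq1 ht)).1).
  have vw : v w <= W + 2 * (A * Y).
      have := vup q1 w ltac:(lraf hq1) ltac:(lraf hw) ltac:(lraf hw); have := AYd (w - q1) ltac:(lraf hw hq1).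
    by move=> i1 i2; apply: le_trans (_ : A * Y * (w - q1) + v q1 <= _); [rewrite -lerBlDr|rewrite addrC lerD].
  have : v w * (r - q1) <= (W + 2 * (A * Y)) * 2.
    apply: (@le_trans _ _ ((W + 2 * (A * Y)) * (r - q1))).
      by rewrite ler_wpM2r //; lraf hq1.
    by rewrite ler_wpM2l //; [lraf W0 AY|lraf hq1].
  by rewrite /B; lraf yq1 ew.
have xr0 : 0 <= x r by apply: x0; lraf Tr.
have xB : x r <= B by rewrite -e1.
have gx : 0 <= gam * x r <= gam * B.
  by rewrite mulr_ge0 ?(ltW gam0) //= ler_wpM2l // ltW.
have vr1 : v r <= W + 2 * (A * Y).
  have := vup q1 r ltac:(lraf hq1) ltac:(lraf hq1) ltac:(lraf hq1); have := AYd (r - q1) ltac:(lraf hq1).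
  by move=> i1 i2; apply: le_trans (_ : A * Y * (r - q1) + v q1 <= _); [rewrite -lerBlDr|rewrite addrC lerD].
have vr2 : - (W + 2 * (A * Y)) <= v r.
  have := vup r q2 ltac:(lraf hq2) ltac:(lraf hq2) ltac:(lraf hq2); have := AYd (q2 - r) ltac:(lraf hq2).
  move=> i1 i2; rewrite opprD; apply: (@le_trans _ _ (v q2 - A * Y * (q2 - r))).
    by rewrite lerD // lerN2.
  by rewrite lerBlDr addrC -lerBlDr.
have B0 : 0 <= B by apply: le_trans xB.
rewrite e2 in vr1 vr2; have [gx0 gx1] := andP gx.
split; first by lraf xB gB W0 AY.
by rewrite ler_norml; apply/andP; split; [lraf vr2 gx1 B0|lraf vr1 gx0 gB B0].
Qed.

Let isDG z : isD G z (g z).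
Proof. exact: isD_GG. Qed.

Let cP : G P < Vo.
Proof. exact: GGP_lt. Qed.

Let Vge z w : 0 <= z -> G P <= V z w.
Proof. exact: VV_ge. Qed.

Let Vbound : exists2 C, 0 < C & forall z w, 0 <= z -> V z w <= Vo -> z <= C /\ `|w| <= C.
Proof. exact: VV_bound. Qed.

Let Vnear0 e : 0 < e ->
  exists2 r, 0 < r & forall z w, `|z| <= r -> `|w| <= r -> `|V z w - Vo| < e.
Proof. exact: VV_near0. Qed.

Let VnearP e : 0 < e ->
  exists2 r, 0 < r & forall z w, `|z - P| <= r -> `|w| <= r -> V z w < G P + e.
Proof. exact: VV_nearP. Qed.

Let Dsmall r : 0 < r -> exists2 e, 0 < e & forall z w, 0 <= z -> D z w < e ->
  `|w| < r /\ (z < r \/ `|z - P| < r).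
Proof. exact: DD_small. Qed.

Let Dlevel e : 0 < e -> exists2 r, 0 < r & forall z w, 0 <= z -> D z w < r ->
  `|V z w - Vo| < e \/ V z w < G P + e.
Proof. exact: DD_level. Qed.

Lemma isD_V T x s : orb T x s -> forall t, T <= t -> isD (fun t => V (x t) (s t)) t
  (- gam * D (x t) (s t) + (s t + gam * (x t - P)) * err t (x t)).
Proof.
move=> S t /S[D1 D2].
have D3 : isD (fun t => G (x t)) t (g (x t) * s t) := isD_comp (isDG (x t)) D1.
have D4 : isD (fun t => (s t + gam * (x t - P)) ^+ 2 / 2) t
    ((s t + gam * (x t - P)) * (- gam * s t - g (x t) + err t (x t))).
  by apply: isD_eq; [isD_auto|rewrite /=; field].
have D5 : isD (fun t => gam ^+ 2 * (x t - P) ^+ 2 / 2) t (gam ^+ 2 * (x t - P) * s t).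
  by apply: isD_eq; [isD_auto|rewrite /=; field].
apply: (isD_eq (isD_add (isD_add D4 D5) D3)).
by rewrite /D /DD -/g; ring.
Qed.

Lemma V_decrease C e : 0 <= C -> 0 < e -> exists T0, forall T x s, orb T x s ->
  forall t, T <= t -> T0 <= t -> 0 <= x t -> x t <= C -> `|s t| <= C ->
  exists2 d, isD (fun t => V (x t) (s t)) t d & d <= - gam * D (x t) (s t) + e.
Proof.
move=> C0 e0; pose K := C + gam * (C + P) + 1.
have gC : 0 <= gam * (C + P) by rewrite mulr_ge0 ?(ltW gam0) // addr_ge0 // ltW.
have K0 : 0 < K by rewrite /K; lra.
have [T0 hT] := err_small C0 (divr_gt0 e0 K0).
exists T0 => T x s S t Tt T0t x0 xC sC; eexists; first exact: (isD_V S Tt).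
rewrite lerD2l; apply: le_trans (ler_norm _) _; rewrite normrM.
have n1 : `|s t + gam * (x t - P)| <= K.
  apply: le_trans (ler_normD _ _) _; rewrite normrM (gtr0_norm gam0).
  have : gam * `|x t - P| <= gam * (C + P).
    rewrite ler_wpM2l ?(ltW gam0) // ler_norml; have := P0; move=> ?; apply/andP; split; lra.
  by rewrite /K; lra.
have n2 := hT t T0t (x t) (_ : `|x t| <= C); rewrite ger0_norm // in n2.
apply: (@le_trans _ _ (K * (e / K))); first by rewrite ler_pM // n2.
by rewrite mulrC divfK ?gt_eqF.
Qed.

(** At [x = 0] the orbit would arrive with [s <= 0], where [V >= Vo]; on the level [Vo - e] the
    dissipation dominates the error, so [V] decreases. That [T0] depends on [e] alone is what makes
    slow decay an open condition. *)
Lemma trap e : 0 < e -> exists T0, forall T x s, T0 <= T -> orb T x s -> 0 < x T ->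
  V (x T) (s T) < Vo - e -> forall t, T <= t -> 0 < x t /\ V (x t) (s t) < Vo - e.
Proof.
mark; move=> e0; have [C C0 hC] := Vbound.
have [le|lt] := leP (Vo - e) (G P).
  exists 0 => T x s _ S xT VT; exfalso.
  by have := Vge (s T) (ltW xT); lra.
(* The distance from the level [Vo - e] to the critical values [Vo] and [G P]. *)
pose eta := Num.min e (Vo - e - G P).
have eta0 : 0 < eta by rewrite lt_min e0 subr_gt0.
have eta1 : eta <= e by rewrite ge_min lexx.
have eta2 : eta <= Vo - e - G P by rewrite ge_min lexx orbT.
have [d d0 hd] := Dlevel eta0.
have gd : 0 < gam * d / 2 by rewrite divr_gt0 ?mulr_gt0.
have [T0 hT] := V_decrease (ltW C0) gd.
exists T0 => T x s TT S xT VT t1 Tt1.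
have cx t : T <= t -> ctn x t by move=> /S[D1 _]; exact: isD_cont D1.
have cV t : T <= t -> ctn (fun t => V (x t) (s t)) t by move=> /(isD_V S); exact: isD_cont.
have : Num.max (- x t1) (V (x t1) (s t1) - (Vo - e)) < 0; last first.
  by rewrite gt_max oppr_lt0 subr_lt0 => /andP[].
apply: (@bootstrap _ (fun t => Num.max (- x t) (V (x t) (s t) - (Vo - e))) T t1); last by rewrite Tt1 lexx.
- move=> t /andP[Tt _]; apply: ctn_max.
    by have [D1 _] := S t Tt; exact: isD_cont (isD_opp D1).
  by apply: ctn_sub (cV t Tt) (ctn_cst _ _).
- by rewrite gt_max oppr_lt0 xT subr_lt0.
move=> t /andP[Tt tt1] hs; have {}Tt' := ltW Tt.
have in_ r : T <= r <= t -> 0 <= x r /\ V (x r) (s r) <= Vo - e.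
  by move=> /hs; rewrite ge_max oppr_le0 subr_le0 => /andP[].
have [xt Vt] := in_ t ltac:(by rewrite Tt' lexx).
have xt0 : x t != 0.
  apply/eqP => z; have [D1 _] := S t Tt'.
  have h : s t <= 0.
    rewrite -oppr_ge0; apply: (isD_left_ge (isD_opp D1) Tt) => r hr.
    by rewrite z oppr0 oppr_le0 (in_ r hr).1.
  move: Vt; rewrite z /V /VV GG0 // sub0r.
  have -> : (s t + gam * - P) ^+ 2 / 2 + gam ^+ 2 * (- P) ^+ 2 / 2 + 0 = Vo + s t ^+ 2 / 2 - gam * P * s t.
    by rewrite /Vo /V00; field.
  have : 0 <= gam * P * - s t by rewrite mulr_ge0 ?mulr_ge0 ?(ltW gam0) ?(ltW P0) ?oppr_ge0.
  by have := sqr_ge0 (s t); lraf e0.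
have Vtn : V (x t) (s t) != Vo - e.
  apply/eqP => E.
  have [xC sC] := hC (x t) (s t) xt ltac:(rewrite E; lraf e0).
  have [dd Dd dle] := hT T x s S t Tt' (le_trans TT Tt') xt xC sC.
  have d_ge : d <= D (x t) (s t).
    rewrite leNgt; apply/negP => /(hd _ _ xt); rewrite E.
    by case=> [|h]; [rewrite addrAC subrr add0r normrN gtr0_norm // => h|]; lraf h eta1 eta2.
  have : 0 <= dd by apply: isD_left_ge Dd Tt _ => r /in_[_]; rewrite E.
  have : gam * d <= gam * D (x t) (s t) by rewrite ler_wpM2l // ltW.
  by lraf dle gd.
by rewrite gt_max oppr_lt0 lt_neqAle eq_sym xt0 xt subr_lt0 lt_neqAle Vtn.
Qed.

Definition away x := exists2 r, 0 < r & exists T, forall t, T <= t -> r <= x t.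
Definition vanish x s := limP x 0 /\ limP s 0.

(** In the trapping set a small [x] forces a definite positive [s], so the orbit is pushed away from
    [0]: it reaches [r] and cannot fall back to [r / 2]. *)
Lemma trap_away T x s e : 0 < e -> orb T x s ->
  (forall t, T <= t -> 0 < x t /\ V (x t) (s t) < Vo - e) -> away x.
Proof.
mark; move=> e0 S hV; have [r1 r10 h1] := Vnear0 e0.
pose r := Num.min r1 P; have r0 : 0 < r by rewrite lt_min r10.
have rr : r <= r1 by rewrite ge_min lexx.
have rP : r <= P by rewrite ge_min lexx orbT.
(* A small nonnegative [s] would give [V] close to [Vo]; a negative one would only raise [V] above
   [V x 0], because [x <= P]. *)
have push t : T <= t -> x t <= r -> r <= s t.
  move=> Tt xr; have [xt Vt] := hV t Tt; rewrite leNgt; apply/negP => sr.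
  have xr1 : `|x t| <= r1 by rewrite gtr0_norm //; exact: le_trans xr rr.
  have [s0|s0] := leP 0 (s t).
    have := h1 (x t) (s t) xr1; rewrite (ger0_norm s0) -/V -/Vo => /(_ ltac:(lraf sr rr)).
    by rewrite ltr_norml => /andP[]; lraf Vt.
  have := h1 (x t) 0 xr1; rewrite normr0 -/V -/Vo => /(_ (ltW r10)).
  have : V (x t) 0 <= V (x t) (s t).
    have -> : V (x t) (s t) = V (x t) 0 + s t ^+ 2 / 2 + gam * ((P - x t) * - s t).
      by rewrite /V /VV; field.
    have : 0 <= gam * ((P - x t) * - s t) by rewrite !mulr_ge0 ?(ltW gam0) //; [lraf xr rP|lraf s0].
    by have := sqr_ge0 (s t); lraf.
  by move=> h0; rewrite ltr_norml => /andP[]; lraf Vt h0.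
have [t1 Tt1 xt1] : exists2 t1, T <= t1 & r <= x t1.
  apply: contrapT => hn.
  have small t : T <= t -> x t < r by move=> Tt; rewrite ltNge; apply/negP => h; apply: hn; exists t.
  have := small (T + 1) ltac:(lraf r0); have [] := hV T (lexx _).
  have := @incrD R (fun t => x t - r * t) (fun t => s t - r) T (T + 1) ltac:(lraf r0).
  move=> /(_ _ _) h; have {}h : x T - r * T <= x (T + 1) - r * (T + 1).
    apply: h => t /andP[Tt _].
      by have [D1 _] := S t Tt; exact: isD_add D1 (isD_opp (isD_lin _ _)).
    by rewrite subr_ge0 push // ltW // small.
  by lra.
exists (r / 2); first lra.
exists t1 => t t1t; suff : r / 2 - x t < 0 by lra.
apply: (@bootstrap _ (fun t => r / 2 - x t) t1 t); last by rewrite t1t lexx.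
- move=> q /andP[t1q _]; have [D1 _] := S q (le_trans Tt1 t1q).
  by apply: ctn_sub (ctn_cst _ _) (isD_cont D1).
- lra.
move=> q /andP[t1q qt] hq; have Tq : T <= q by lraf Tt1 t1q.
have := hq q; rewrite (ltW t1q) lexx => /(_ isT) hqq.
have [E|] := eqVneq (x q) (r / 2); last by rewrite neq_lt => /orP[]; lraf hqq.
exfalso; have [D1 _] := S q Tq.
have : 0 <= - s q.
  by apply: isD_left_ge (isD_opp D1) t1q _ => w /hq; rewrite E; lraf.
by have := push q Tq; lraf r0 E.
Qed.

Lemma orb_lip C : 0 <= C -> exists2 C', 0 < C' & exists T0, forall T x s, T0 <= T -> orb T x s ->
  (forall t, T <= t -> [/\ 0 <= x t, x t <= C & `|s t| <= C]) -> forall t q, T <= t -> t <= q ->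
  `|x q - x t| <= C * (q - t) /\ `|s q - s t| <= C' * (q - t).
Proof.
mark; move=> C0; have c0 : 0 < c := c_gt0 kap0 P0 PE.
have [T0 h0] := err_small C0 ltr01.
have g2 : 0 < 2 * gam by rewrite mulr_gt0.
pose C' := 2 * gam * C + (kap * (C * pw p C) + c * C) + 1.
exists C'; first by rewrite ltr_wpDl // !addr_ge0 // !mulr_ge0 ?pw_ge0 // ltW.
exists T0 => T x s T0T S hb t q Tt tq; split.
  rewrite mulrBr; apply: (lipD (f' := s) (w := fun t => C * t) (w' := fun=> C) tq) => z /andP[tz _].
  - by have [] := S z (le_trans Tt tz).
  - exact: isD_lin.
  - by have [] := hb z (le_trans Tt tz).
rewrite mulrBr; apply: (lipD (f' := fun z => - (2 * gam) * s z - g (x z) + err z (x z))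
  (w := fun t => C' * t) (w' := fun=> C') tq) => z /andP[tz _]; have Tz := le_trans Tt tz.
- by have [] := S z Tz.
- exact: isD_lin.
have [xz xC sC] := hb z Tz.
have n1 : `|- (2 * gam) * s z| <= 2 * gam * C.
  by rewrite normrM normrN (gtr0_norm g2) ler_wpM2l // ltW.
have n2 : `|g (x z)| <= kap * (C * pw p C) + c * C.
  apply: le_trans (ler_normB _ _) _; rewrite !normrM (gtr0_norm kap0) (gtr0_norm c0) (ger0_norm xz).
  apply: lerD; rewrite ler_wpM2l ?(ltW kap0) ?(ltW c0) //.
  by rewrite (ger0_norm (pw_ge0 _ _)) ler_pM ?pw_ge0 // pw_le // !ger0_norm.
have n3 := h0 z (le_trans T0T Tz) (x z); rewrite (ger0_norm xz) in n3; have {}n3 := n3 xC.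
have m1 := ler_normD (- (2 * gam) * s z - g (x z)) (err z (x z)).
have m2 := ler_normB (- (2 * gam) * s z) (g (x z)).
by rewrite /C'; lraf n1 n2 n3 m1 m2.
Qed.

(** The level has to be undercut at arbitrarily late times, since [trap] works only after a time
    depending on [e]. *)
Definition trapped x s := exists2 e, 0 < e & forall T, exists2 t, T <= t & V (x t) (s t) < Vo - e.

Lemma trapped_away T x s : orb T x s -> (forall t, T <= t -> 0 < x t) -> trapped x s -> away x.
Proof.
move=> S xp [e e0 he]; have [T1 h1] := trap e0; have [t] := he (Num.max T T1).
rewrite ge_max => /andP[Tt T1t] Vt; have St := orb_le Tt S.
exact: (trap_away e0 St (h1 t x s T1t St (xp t Tt) Vt)).
Qed.

(** Without trapping the lower limit of [V] is at least [Vo], and above [Vo] the function [V]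
    decreases at a definite rate, so [V] tends to [Vo]. Then the dissipation cannot stay large on an
    interval of fixed length; by the Lipschitz bound the orbit is always near an equilibrium, and
    [P] is excluded by its value of [V]. *)
Lemma dichotomy T x s : orb T x s -> (forall t, T <= t -> 0 < x t) -> trapped x s \/ vanish x s.
Proof.
mark; move=> S xp; have [aw|naw] := pselect (trapped x s); [by left|right].
have [C C0 [T1 hC]] := orb_bound.
have Cn : 0 <= C := ltW C0.
pose T2 := Num.max T T1.
have T2T : T <= T2 by rewrite le_max lexx.
have T2T1 : T1 <= T2 by rewrite le_max lexx orbT.
have S2 := orb_le T2T S.
have bd t : T2 + 3 <= t -> x t <= C /\ `|s t| <= C.
  by apply: hC T2T1 S2 _ t => q hq; apply/ltW/xp; lraf T2T hq.
have low e : 0 < e -> exists T3, forall t, T3 <= t -> Vo - e <= V (x t) (s t).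
  move=> e0; apply: contrapT => hn; apply: naw; exists e => // T3.
  apply: contrapT => h3; apply: hn; exists T3 => t Tt; rewrite leNgt; apply/negP => Vt.
  by apply: h3; exists t.
have high e : 0 < e -> exists T3, forall t, T3 <= t -> V (x t) (s t) < Vo + e.
  move=> e0; have [d d0 hd] := Dlevel e0.
  have gd : 0 < gam * d / 2 by rewrite divr_gt0 ?mulr_gt0.
  have [T3 h3] := V_decrease Cn gd.
  pose T4 := Num.max T3 (T2 + 3).
  have T43 : T3 <= T4 by rewrite le_max lexx.
  have T42 : T2 + 3 <= T4 by rewrite le_max lexx orbT.
  have dec t : T4 <= t -> Vo + e <= V (x t) (s t) ->
      exists2 w, isD (fun t => V (x t) (s t)) t w & w <= - (gam * d / 2).
    move=> T4t Vt; have [xC sC] := bd t ltac:(lraf T42 T4t); have xt := ltW (xp t ltac:(lraf T42 T4t T2T)).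
    have [w Dw wle] := h3 T x s S t ltac:(lraf T42 T4t T2T) ltac:(lraf T43 T4t) xt xC sC.
    exists w => //; have : d <= D (x t) (s t).
      rewrite leNgt; apply/negP => /(hd _ _ xt); have cPV := cP.
      by case=> [|h]; [rewrite ltr_norml => /andP[_ h]|]; lraf h Vt cPV.
    move=> dD; have : gam * d <= gam * D (x t) (s t) by rewrite ler_wpM2l // ltW.
    by lraf wle.
  (* Otherwise [V] would decrease at a fixed rate forever, although it is at least [G P]; [q] is the
     time by which this bound is violated. *)
  have [t1 T4t1 Vt1] : exists2 t1, T4 <= t1 & V (x t1) (s t1) < Vo + e.
    apply: contrapT => hn.
    have big t : T4 <= t -> Vo + e <= V (x t) (s t).
      by move=> Tt; rewrite leNgt; apply/negP => h; apply: hn; exists t.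
    pose q := (V (x T4) (s T4) - G P + 1) / (gam * d / 2).
    have VG t : T4 <= t -> G P <= V (x t) (s t).
      by move=> T4t; apply: Vge; apply/ltW/xp; lra.
    have q0 : 0 <= q by rewrite divr_ge0 ?(ltW gd) //; have := VG T4 (lexx _); lra.
    have /choice[w hw] : forall t, exists w, T4 <= t -> isD (fun t => V (x t) (s t)) t w /\ w <= - (gam * d / 2).
      move=> t; have [T4t|tT4] := leP T4 t; last by exists 0 => h; exfalso; lraf h tT4.
      by have [w D1 wl] := dec t T4t (big t T4t); exists w.
    have : - V (x T4) (s T4) - gam * d / 2 * T4 <= - V (x (T4 + q)) (s (T4 + q)) - gam * d / 2 * (T4 + q).
      apply: (incrD (f := fun t => - V (x t) (s t) - gam * d / 2 * t) (f' := fun t => - w t - gam * d / 2)).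
      - by lraf q0.
      - by move=> t /andP[T4t _]; have [D1 _] := hw t T4t; exact: isD_add (isD_opp D1) (isD_opp (isD_lin _ _)).
      - by move=> t /andP[T4t _]; have [_ h] := hw t T4t; lraf h.
    have : gam * d / 2 * q = V (x T4) (s T4) - G P + 1 by rewrite /q mulrC divfK ?gt_eqF.
    by have := VG (T4 + q) ltac:(lraf q0); lraf.
  exists t1 => t t1t; suff : V (x t) (s t) - (Vo + e) < 0 by lraf.
  apply: (@bootstrap _ (fun t => V (x t) (s t) - (Vo + e)) t1 t); last by rewrite t1t lexx.
  - move=> q /andP[t1q _]; apply: ctn_sub (ctn_cst _ _).
    by apply: isD_cont (isD_V S _); lraf T42 T4t1 T2T t1q.
  - by lraf Vt1.
  move=> q /andP[t1q qt] hq; have := hq q; rewrite (ltW t1q) lexx => /(_ isT) hqq.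
  have [E|] := eqVneq (V (x q) (s q)) (Vo + e); last by rewrite neq_lt => /orP[]; lraf hqq.
  exfalso; have [w Dw wle] := dec q (le_trans T4t1 (ltW t1q)) ltac:(by rewrite E).
  have : 0 <= w by apply: isD_left_ge Dw t1q _ => z /hq; rewrite E; lraf.
  by lraf wle gd.
suff main r : 0 < r -> exists T3, forall t, T3 <= t -> `|s t| < r /\ x t < r.
  split=> e e0; have [T3 h3] := main e e0; exists (Num.max T3 T) => t; rewrite ge_max => /andP[/h3[h4 h5] Tt].
    by rewrite subr0 gtr0_norm ?xp.
  by rewrite subr0.
have cPV := cP; have e1 : 0 < (Vo - G P) / 2 by lra.
have [rP rP0 hP] := VnearP e1.
(* For small [r] an orbit within [r] of [(P, 0)] has [V] below the midpoint of [G P] and [Vo]. *)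
wlog rrP : r / r <= rP.
  move=> wl r0; have [h|h] := leP r rP; first exact: wl.
  have [T3 h3] := wl rP (lexx _) rP0; exists T3 => t /h3[h4 h5]; split; [lraf h h4|lraf h h5].
move=> r0; have r2 : 0 < r / 2 by lra.
have [d d0 hd] := Dsmall r2.
have [C4 C40 [T4 h4]] := orb_lip Cn.
(* During time [tau] neither [x] nor [s] moves by more than [r / 2]. *)
pose tau := r / (2 * (C + C4)).
have CC : 0 < 2 * (C + C4) by lra.
have tau0 : 0 < tau by rewrite divr_gt0.
have tauE : tau * (C + C4) = r / 2 by rewrite /tau; field; rewrite gt_eqF //; lra.
have gd : 0 < gam * d / 2 by rewrite divr_gt0 ?mulr_gt0.
(* A loss at rate [gam d / 2] during [tau] is four times this tolerance, whereas [V] stays within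
   one tolerance of [Vo]. *)
have gdt : 0 < gam * d * tau / 8 by apply: divr_gt0 => //; apply: mulr_gt0 tau0; exact: mulr_gt0.
have [T3 h3] := V_decrease Cn gd.
have [T5 h5] := low _ gdt; have [T6 h6] := high _ gdt; have [T7 h7] := low _ e1.
exists (Num.max (Num.max (Num.max T3 T4) (Num.max T5 T6)) (Num.max T7 (T2 + 3))) => t.
rewrite !ge_max => /andP[/andP[/andP[t3 t4] /andP[t5 t6]] /andP[t7 t2]].
have lipx q : t <= q <= t + tau -> `|x q - x t| <= r / 2 /\ `|s q - s t| <= r / 2.
  move=> /andP[tq qt].
  have [||||n1 n2] := h4 (Num.max (T2 + 3) T4) x s _ _ _ t q _ tq.
  - by rewrite le_max lexx orbT.
  - by apply: orb_le S; rewrite le_max; apply/orP; left; lraf T2T.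
  - move=> z; rewrite ge_max => /andP[z1 _]; have [? ?] := bd z z1.
    by split=> //; apply/ltW/xp; lraf T2T z1.
  - by rewrite ge_max t2.
  have Cq : C * (q - t) <= tau * (C + C4).
    by rewrite mulrC; apply: ler_pM; [lraf tq|lraf C0|lraf qt|lraf C40].
  have C4q : C4 * (q - t) <= tau * (C + C4).
    by rewrite mulrC; apply: ler_pM; [lraf tq|lraf C40|lraf qt|lraf C0].
  by rewrite tauE in Cq C4q; split; [exact: le_trans n1 Cq|exact: le_trans n2 C4q].
apply: contrapT => hn.
have [xC sC] := bd t t2.
have xt := xp t ltac:(lraf t2 T2T).
have notP : ~ (`|x t - P| < r /\ `|s t| < r).
  move=> [q1 q2]; have := hP (x t) (s t) ltac:(lraf q1 rrP) ltac:(lraf q2 rrP).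
  by have := h7 t t7; rewrite -/V -/G; lraf e1.
have outside q : t <= q <= t + tau -> d <= D (x q) (s q).
  move=> hq; rewrite leNgt; apply/negP => hD; have xq := ltW (xp q ltac:(lraf hq t2 T2T)).
  have [sq xq'] := hd _ _ xq hD; have [lx ls] := lipx q hq.
  have s1 : `|s t| < r.
    by have := ler_normB (s q) (s q - s t); rewrite opprB addrC subrK; lraf ls sq.
  case: xq' => [q1|q1].
    by apply: hn; split => //; move: lx; rewrite ler_norml => /andP[]; lraf q1.
  apply: notP; split => //.
  have := ler_normB (x q - P) (x q - x t).
  by rewrite (_ : x q - P - (x q - x t) = x t - P); [lraf lx q1|ring].
have /choice[w hw] : forall q, exists w, t <= q <= t + tau ->
    isD (fun t => V (x t) (s t)) q w /\ w <= - (gam * d / 2).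
  move=> q; have [hq|hq] := boolP (t <= q <= t + tau); last by exists 0.
  have [xqC sqC] := bd q ltac:(lraf hq t2); have xq := ltW (xp q ltac:(lraf hq t2 T2T)).
  have [w D1 wl] := h3 T x s S q ltac:(lraf hq t2 T2T) ltac:(lraf hq t3) xq xqC sqC.
  exists w => _; split => //.
  by have : gam * d <= gam * D (x q) (s q); [rewrite ler_wpM2l ?(ltW gam0) ?outside|lraf wl].
have : - V (x t) (s t) - gam * d / 2 * t <= - V (x (t + tau)) (s (t + tau)) - gam * d / 2 * (t + tau).
  apply: (incrD (f := fun t => - V (x t) (s t) - gam * d / 2 * t) (f' := fun t => - w t - gam * d / 2)).
  - by lraf tau0.
  - by move=> q /hw[D1 _]; exact: isD_add (isD_opp D1) (isD_opp (isD_lin _ _)).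
  - by move=> q /hw[_ h]; lraf h.
have := h6 t t6; have := h5 (t + tau) ltac:(lraf tau0 t5).
have : gam * d / 2 * tau = 4 * (gam * d * tau / 8) by field.
by lraf gdt.
Qed.

End Tail.

Lemma bounded_sign (R : realType) (f : R -> R) (l T : R) : (forall t u, T <= t -> t <= u -> f t <= f u) ->
  limP f l -> forall t, T <= t -> f t <= l.
Proof.
move=> mono fl t Tt; rewrite leNgt; apply/negP => lt_.
have [T1 h1] := fl (f t - l) ltac:(lra).
have := h1 (Num.max T1 t) _; rewrite le_max lexx => /(_ isT).
have tm : t <= Num.max T1 t by rewrite le_max lexx orbT.
by have := mono t _ Tt tm; rewrite ltr_norml => ? /andP[]; lra.
Qed.

(** * Orbits near the saddle *)

Section Saddle.
Variables (R : realType) (p l0 l1 gam kap t0 FL : R) (a b b1 om om1 F F1 : R -> R).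
Hypothesis H : emden_data p l0 l1 gam kap t0 FL a b b1 om om1 F F1.
Variable P : R.
Hypotheses (P0 : 0 < P) (PE : l1 ^+ 2 - gam ^+ 2 = kap * pw p P).
Implicit Types (y v x s : R -> R) (t T e r : R).
Local Notation orb := (orb p l1 gam kap a b).

Let c := l1 ^+ 2 - gam ^+ 2.
(** The equation reads [x'' + 2 gam x' = m t x x], where near the saddle the coefficient is close to
    [c > 0]. *)
Let m t (z : R) := a t - gam ^+ 2 - b t * expR (p * gam * t) * pw p z.

Let c0 : 0 < c.
Proof. exact: c_gt0 (kap_gt0 H) P0 PE. Qed.

Lemma orbE T x s : orb T x s -> forall t, T <= t ->
  isD x t (s t) /\ isD s t (- (2 * gam) * s t + m t (x t) * x t).
Proof.
move=> S t /S[D1 D2]; split=> //; apply: (isD_eq D2).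
by rewrite -addrA (orb_force p l1 gam kap a b t (x t)).
Qed.

Lemma m_near e : 0 < e -> exists2 r, 0 < r & exists T, forall t, T <= t ->
  forall z, `|z| <= r -> `|m t z - c| < e.
Proof.
mark; move=> e0.
have kap0 := kap_gt0 H.
have [r r0 hr] := pw_small (p_gt0 H) (e := e / (4 * kap)) ltac:(by rewrite divr_gt0 // mulr_gt0).
have [T1 h1] := a_lim H (e := e / 2) ltac:(lraf e0).
have [T2 h2] := b_lim H kap0.
exists r => //; exists (Num.max T1 T2) => t; rewrite ge_max => /andP[/h1 {}h1 /h2 {}h2] z /hr zr.
rewrite /m /c (_ : _ - _ = (a t - l1 ^+ 2) - b t * expR (p * gam * t) * pw p z); last by ring.
apply: le_lt_trans (ler_normB _ _) _; rewrite [in X in _ + X]normrM (ger0_norm (pw_ge0 _ _)).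
suff : `|b t * expR (p * gam * t)| * pw p z <= 2 * kap * (e / (4 * kap)).
  rewrite (_ : 2 * kap * (e / (4 * kap)) = e / 2); last by field; rewrite gt_eqF.
  by lraf h1.
apply: ler_pM; rewrite ?pw_ge0 ?(ltW zr) //.
by have := ler_normD (b t * expR (p * gam * t) - kap) kap; rewrite subrK (gtr0_norm kap0); lraf h2.
Qed.

(** The stable eigenvalue is [- mu] with [mu = l1 + gam]. For [z = e^(mu t) x] one has
    [z' = 2 l1 z - Q] and [Q' = - f z], where [0 < z <= Q / mu] and [f] is integrable. A Gronwall
    argument bounds [Q], so [Q] converges, and the repelling equation forces [z] to converge. *)
Lemma fd_limit T x s : orb T x s -> (forall t, T <= t -> 0 < x t) -> vanish x s ->
  exists L, limP (fun t => expR ((l1 + gam) * t) * x t) L.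
Proof.
mark; move=> S xp [xl sl].
have gam0 := gam_gt0 H; have p0 := p_gt0 H; have gl := gam_lt H; have kap0 := kap_gt0 H.
have [r r0 [T1 h1]] := m_near c0.
have [T2 h2] := xl r r0; have [T3 h3] := b_lim H kap0.
pose T4 := Num.max (Num.max T T1) (Num.max T2 T3).
have [T4T [T41 [T42 T43]]] : T <= T4 /\ T1 <= T4 /\ T2 <= T4 /\ T3 <= T4.
  by rewrite /T4 !le_max !lexx !orbT.
have {}h2 t : T4 <= t -> `|x t| <= r.
  by move=> Tt; have := h2 t (le_trans T42 Tt); rewrite subr0 => /ltW.
have {}h1 t : T4 <= t -> 0 < m t (x t).
  by move=> Tt; have := h1 t (le_trans T41 Tt) (x t) (h2 t Tt); rewrite ltr_norml => /andP[]; lra.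
have {}xp t : T4 <= t -> 0 < x t by move=> Tt; apply: xp; lraf Tt T4T.
have D t : T4 <= t -> isD x t (s t) /\ isD s t (- (2 * gam) * s t + m t (x t) * x t).
  by move=> Tt; apply: orbE S _ _; lraf Tt T4T.
(* This quantity is nondecreasing and tends to [0]. It yields decay of [x] at rate [2 gam], which
   makes |x|^p integrable. *)
have R0 t : T4 <= t -> s t + 2 * gam * x t <= 0.
  apply: (bounded_sign (f := fun t => s t + 2 * gam * x t)) => //.
    move=> u w Tu uw; apply: (incrD (f := fun t => s t + 2 * gam * x t) (f' := fun t => m t (x t) * x t)) uw _ _.
      move=> z /andP[uz _]; have [D1 D2] := D z (le_trans Tu uz).
      by have D3 := isD_cst (2 * gam) z; isD_calc.
    by move=> z /andP[uz _]; have Tz := le_trans Tu uz; rewrite mulr_ge0 ?ltW ?h1 ?xp.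
  have := limP_D sl (limP_Z (2 * gam) xl); rewrite mulr0 addr0 => h; exact: h.
pose B := expR (2 * gam * T4) * x T4.
have B0 : 0 < B by rewrite mulr_gt0 ?expR_gt0 ?xp.
have xB t : T4 <= t -> x t <= expR (- (2 * gam) * t) * B.
  move=> Tt; rewrite -(ler_pM2l (expR_gt0 (2 * gam * t))) mulrA -expRD mulNr addrN expR0 mul1r -lerN2.
  apply: (incrD (f := fun t => - (expR (2 * gam * t) * x t))
    (f' := fun t => - (expR (2 * gam * t) * (s t + 2 * gam * x t)))) Tt _ _.
    move=> z /andP[uz _]; have [D1 D2] := D z uz; have D3 := isD_explin (2 * gam) z.
    by isD_calc.
  by move=> z /andP[/R0 uz _]; rewrite -mulrN mulr_ge0 ?expR_ge0 // oppr_ge0.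
pose mu := l1 + gam; have mu0 : 0 < mu by rewrite /mu; lraf gam0 gl.
have mu1 : mu != 0 by rewrite gt_eqF.
pose f t := m t (x t) - c.
pose K := 2 * kap * pw p B.
pose q := 2 * gam * p; have q0 : 0 < q by rewrite /q mulr_gt0 // mulr_gt0.
(* A convergent primitive of a majorant of [|f| / mu]: [F] accounts for [a], the exponential for the
   nonlinear term. *)
pose W t := (F t - K / q * expR (- q * t)) / mu.
pose W1 t := (F1 t + K * expR (- q * t)) / mu.
have dW t : isD W t (W1 t).
  have D1 := F_der H t; have D2 := isD_explin (- q) t.
  have D3 := isD_cst (- (K / q)) t; have D4 := isD_cst mu^-1 t.
  rewrite /W (_ : (fun t => _) = fun t => (F t + - (K / q) * expR (- q * t)) * mu^-1).
    by apply: isD_eq; [isD_auto|rewrite /W1 /=; field; rewrite mu1 gt_eqF].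
  by apply/funext => z; ring.
have fW t : T4 <= t -> `|f t| / mu <= W1 t.
  move=> Tt; rewrite ler_pM2r ?invr_gt0 //.
  have -> : f t = (a t - l1 ^+ 2) - b t * expR (p * gam * t) * pw p (x t).
    by rewrite /f /m /c; ring.
  apply: le_trans (ler_normB _ _) (lerD (F1_ge H t) _).
  rewrite normrM (ger0_norm (pw_ge0 _ _)) /K -[2 * kap * _ * _]mulrA; apply: ler_pM; rewrite ?pw_ge0 //.
    have := h3 t (le_trans T43 Tt).
    by have := ler_normD (b t * expR (p * gam * t) - kap) kap; rewrite subrK (gtr0_norm kap0); lraf.
  have -> : pw p B * expR (- q * t) = pw p (expR (- (2 * gam) * t) * B).
    by rewrite pwM pw_expR mulrC; congr (expR _ * _); rewrite /q; ring.
  apply: pw_le => //; rewrite (gtr0_norm (xp t Tt)) ger0_norm ?xB //.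
  by apply: mulr_ge0; [exact: expR_ge0|exact: ltW].
have Wl : limP W (FL / mu).
  have /limN_P h := limN_exp q0.
  have := limP_D (limP_Z mu^-1 (F_lim H)) (limP_Z (- (K / q) / mu) h).
  rewrite mulr0 addr0 [mu^-1 * FL]mulrC => hl; apply: (limP_ext (T := 0)) hl.
  by move=> t _; rewrite /W (_ : - q * t = q * - t); [field; rewrite mu1 gt_eqF|ring].
pose z t := expR (mu * t) * x t.
(* The linear form vanishes on the unstable eigenvector, so [Q] is the rescaled stable component. *)
pose Q t := expR (mu * t) * ((l1 - gam) * x t - s t).
have z0 t : T4 <= t -> 0 < z t by move=> Tt; rewrite mulr_gt0 ?expR_gt0 ?xp.
have dz t : T4 <= t -> isD z t (2 * l1 * z t - Q t).
  move=> Tt; have [D1 D2] := D t Tt; have D3 := isD_explin mu t.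
  by apply: isD_eq; [rewrite /z; isD_auto|rewrite /z /Q /mu /=; ring].
have dQ t : T4 <= t -> isD Q t (- (f t * z t)).
  move=> Tt; have [D1 D2] := D t Tt; have D3 := isD_explin mu t; have D4 := isD_cst (l1 - gam) t.
  by apply: isD_eq; [rewrite /Q; isD_auto|rewrite /f /z /c /mu /=; ring].
have Qz t : T4 <= t -> z t <= Q t / mu.
  move=> Tt; rewrite ler_pdivlMr // -mulrA ler_wpM2l ?expR_ge0 //.
  by have := R0 t Tt; rewrite /mu; lraf.
have Q0 t : T4 <= t -> 0 < Q t.
  by move=> Tt; have := lt_le_trans (z0 t Tt) (Qz t Tt); rewrite pmulr_lgt0 // invr_gt0.
have fzW t : T4 <= t -> `|f t * z t| <= W1 t * Q t.
  move=> Tt; rewrite normrM (gtr0_norm (z0 t Tt)); apply: le_trans (ler_wpM2l (normr_ge0 _) (Qz t Tt)) _.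
  by rewrite mulrA mulrAC ler_pM2r ?Q0 // fW.
have [T5 h5] := limP_bound Wl.
pose T6 := Num.max T4 T5.
have [T64 T65] : T4 <= T6 /\ T5 <= T6 by split; rewrite le_max lexx ?orbT.
pose M := Q T4 * expR (- W T4) * expR (`|FL / mu| + 1).
have QM t : T6 <= t -> Q t <= M.
  move=> Tt; have T4t := le_trans T64 Tt.
  have : Q t * expR (- W t) <= Q T4 * expR (- W T4).
    rewrite -lerN2; apply: (incrD (f := fun t => - (Q t * expR (- W t)))
      (f' := fun t => expR (- W t) * (W1 t * Q t + f t * z t))) T4t _ _ => u /andP[Tu _].
      have D1 := dQ u Tu; have D2 := dW u.
      by apply: isD_eq; [isD_auto|rewrite /=; ring].
    rewrite mulr_ge0 ?expR_ge0 //; have := fzW u Tu; rewrite ler_norml => /andP[]; lraf.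
  rewrite expRN ler_pdivrMr ?expR_gt0 // => h; apply: le_trans h _.
  apply: ler_wpM2l; first by rewrite mulr_ge0 ?expR_ge0 ?(ltW (Q0 _ (lexx _))).
  rewrite ler_expR.
  by apply: le_trans (ler_norm _) (h5 t (le_trans T65 Tt)).
have M0 : 0 <= M by apply: le_trans (QM T6 (lexx _)); rewrite ltW ?Q0.
have W10 t : T4 <= t -> 0 <= W1 t.
  by move=> Tt; apply: le_trans (fW t Tt); rewrite divr_ge0 // ltW.
have [L QL] : exists L, limP Q L.
  apply: (limP_dominated (f' := fun t => - (f t * z t)) (w := fun t => M * W t)
    (w' := fun t => M * W1 t) (T := T6)) (limP_Z M Wl) => t Tt; have T4t := le_trans T64 Tt.
  - exact: dQ.
  - by apply: isD_eq (isD_mul (isD_cst M t) (dW t)) _; rewrite mul0r add0r.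
  - rewrite normrN; apply: le_trans (fzW t T4t) _; rewrite mulrC ler_wpM2r ?W10 ?QM //.
exists (L / (2 * l1)); apply: (limP_unstable (M := M / mu) (T := T6)) QL.
- by lraf gam0 gl.
- by move=> t Tt; apply: dz (le_trans T64 Tt).
move=> t Tt; have T4t := le_trans T64 Tt; rewrite gtr0_norm ?z0 //.
by apply: le_trans (Qz t T4t) _; rewrite ler_pM2r ?invr_gt0 ?QM.
Qed.

Definition hyperbolic r T0 := forall t, T0 <= t -> forall z, `|z| <= r -> c / 2 <= m t z <= 2 * c.

Lemma hyperbolic_near : exists2 r, 0 < r & exists T0, hyperbolic r T0.
Proof.
have [r r0 [T0 hT]] := m_near (e := c / 2) ltac:(by rewrite divr_gt0).
exists r => //; exists T0 => t Tt z zr; have := hT t Tt z zr.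
by rewrite ltr_norml => /andP[? ?]; have := c0; move=> ?; apply/andP; split; lra.
Qed.

Lemma hyperbolic_le r r' T0 : r' <= r -> hyperbolic r T0 -> hyperbolic r' T0.
Proof. by move=> rr h t Tt z zr; apply: h => //; exact: le_trans zr rr. Qed.

Lemma isD_damped k T x s : orb T x s -> forall t, T <= t ->
  isD (fun t => expR (2 * gam * t) * (s t - k)) t (expR (2 * gam * t) * (m t (x t) * x t - 2 * gam * k)).
Proof.
move=> S t Tt; have [D1 D2] := orbE S Tt; have D3 := isD_explin (2 * gam) t.
by apply: isD_eq; [isD_auto|rewrite /=; ring].
Qed.

(** While [0 <= x <= r] the function [e^(2 gam t) s] is nondecreasing, so [s] stays nonnegative and
    [x] cannot decrease; a bootstrap removes the assumption [0 <= x]. *)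
Lemma rise r T0 T x s t1 : hyperbolic r T0 -> T0 <= T -> orb T x s -> 0 < x T -> 0 <= s T ->
  (forall t, T <= t <= t1 -> x t <= r) -> forall t, T <= t <= t1 -> x T <= x t /\ 0 <= s t.
Proof.
mark; move=> hr T0T S x0 s0 xr.
have step t : T <= t <= t1 -> (forall u, T <= u <= t -> 0 <= x u) -> x T <= x t /\ 0 <= s t.
  move=> /andP[Tt tt1] xp.
  have sp u : T <= u <= t -> 0 <= s u.
    move=> /andP[Tu ut].
    have : expR (2 * gam * T) * (s T - 0) <= expR (2 * gam * u) * (s u - 0).
      apply: (incrD (f := fun t => expR (2 * gam * t) * (s t - 0))) Tu _ _ => z /andP[Tz zu].
        exact: isD_damped S z Tz.
      have xz : 0 <= x z by apply: xp; rewrite Tz (le_trans zu).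
      have /andP[mz _] : c / 2 <= m z (x z) <= 2 * c.
        apply: hr; first exact: le_trans T0T Tz.
        by rewrite ger0_norm // xr // Tz (le_trans zu (le_trans ut tt1)).
      rewrite mulr0 subr0 mulr_ge0 ?expR_ge0 // mulr_ge0 //; have := c0; lraf mz.
    rewrite !subr0 => h; rewrite -(pmulr_rge0 _ (expR_gt0 (2 * gam * u))).
    by apply: le_trans h; rewrite mulr_ge0 ?expR_ge0.
  split; last by apply: sp; rewrite Tt lexx.
  apply: incrD Tt _ _ => z; last exact: sp.
  by move=> /andP[Tz _]; have [] := orbE S Tz.
move=> t /andP[Tt tt1]; apply: (step t); first by rewrite Tt.
move=> u /andP[Tu ut]; rewrite -oppr_le0; apply/ltW.
apply: (@bootstrap _ (fun t => - x t) T t); last by rewrite Tu ut.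
- move=> z /andP[Tz _]; have [D1 _] := orbE S Tz; exact: isD_cont (isD_opp D1).
- by rewrite oppr_lt0.
move=> z /andP[Tz zt] hz; rewrite oppr_lt0; apply: lt_le_trans x0 _.
have [||-> _] := step z => //; first by rewrite (ltW Tz) (le_trans zt).
by move=> w /hz; rewrite oppr_le0.
Qed.

(** The driving term is at most [2 c r <= 2 gam k], so the damping keeps [s] below [k]. *)
Lemma rise_bound r T0 T x s t1 k : hyperbolic r T0 -> T0 <= T -> orb T x s -> 0 < x T -> 0 <= s T ->
  (forall t, T <= t <= t1 -> x t <= r) -> s T <= k -> c * r <= gam * k ->
  forall t, T <= t <= t1 -> s t <= k.
Proof.
mark; move=> hr T0T S x0 s0 xr sk rk t /andP[Tt tt1].
have : - (expR (2 * gam * T) * (s T - k)) <= - (expR (2 * gam * t) * (s t - k)).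
  apply: (incrD (f := fun t => - (expR (2 * gam * t) * (s t - k)))
    (f' := fun t => - (expR (2 * gam * t) * (m t (x t) * x t - 2 * gam * k)))) Tt _ _ => z /andP[Tz zt].
    exact: isD_opp (isD_damped k S Tz).
  have zt1 : T <= z <= t1 by rewrite Tz (le_trans zt).
  have [xz _] := rise hr T0T S x0 s0 xr zt1.
  have xz0 : 0 <= x z by apply: le_trans xz; exact: ltW.
  have /andP[_ mz] : c / 2 <= m z (x z) <= 2 * c.
    by apply: hr; [exact: le_trans T0T Tz|rewrite ger0_norm // xr].
  rewrite -mulrN mulr_ge0 ?expR_ge0 // oppr_ge0 subr_le0.
  apply: le_trans (_ : 2 * c * r <= _); last by rewrite -!mulrA ler_pM2l.
  apply: le_trans (ler_wpM2r xz0 mz) _; rewrite ler_wpM2l ?xr //.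
  by rewrite mulr_ge0 // ltW // c0.
rewrite lerN2 => h; rewrite -subr_le0 -(pmulr_rle0 _ (expR_gt0 (2 * gam * t))).
by apply: le_trans h _; rewrite pmulr_rle0 ?expR_gt0 // subr_le0.
Qed.

(** For these [s] the first square of [VV] is at most its value at [s = 0], and [GG r <= 0]. An
    orbit leaving the neighbourhood of the saddle thus enters the trapping set with a margin
    independent of the orbit. *)
Lemma VV_exit r (s : R) : 0 < r -> r <= P / 2 -> 0 <= s -> s <= gam * P ->
  VV p gam kap c P r s < V00 gam P - gam ^+ 2 * r * P / 2.
Proof.
mark; move=> r0 rP s0 sP; have P0' := P0; have gam0 := gam_gt0 H; have p0 := p_gt0 H; have kap0 := kap_gt0 H.
have G0 : GG p kap c r <= 0.
  have h : kap * pw p r <= c.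
    have rP' : `|r| <= `|P| by rewrite !gtr0_norm //; lraf P0' rP.
    by rewrite /c PE ler_wpM2l ?(ltW kap0) ?pw_le.
  have cp : 0 < p + 2 by lraf p0.
  rewrite /GG /gpow (_ : _ - _ = r ^+ 2 / (p + 2) * (kap * pw p r - c * ((p + 2) / 2))); last first.
    by field; rewrite gt_eqF.
  rewrite mulr_ge0_le0 ?divr_ge0 ?sqr_ge0 ?ltW // subr_lt0.
  by apply: le_lt_trans h _; rewrite -{1}[c]mulr1 ltr_pM2l ?c0 //; lraf p0.
have h : (s + gam * (r - P)) ^+ 2 <= gam ^+ 2 * (r - P) ^+ 2.
  rewrite -exprMn -subr_ge0 (_ : _ - _ = s * (2 * gam * P - (s + 2 * gam * r))); last by ring.
  rewrite mulr_ge0 //; have : gam * r <= gam * (P / 2) by rewrite ler_wpM2l // ltW.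
  by lraf sP.
have e : gam ^+ 2 * (r - P) ^+ 2 = gam ^+ 2 * P ^+ 2 - gam ^+ 2 * r * P - gam ^+ 2 * r * (P - r) by ring.
have q1 : 0 < gam ^+ 2 * r * P by rewrite !mulr_gt0.
have q2 : 0 < gam ^+ 2 * r * (P - r) by rewrite !mulr_gt0 // subr_gt0; lraf P0' rP.
by rewrite /VV /V00; lraf G0 h e q1 q2.
Qed.

(** The orbit moves outwards with controlled speed, and if it reaches [x = r] it does so inside the
    trapping set. *)
Lemma exit_away : exists2 rho, 0 < rho & exists T0, forall T x s, T0 <= T -> orb T x s ->
  0 < x T -> x T <= rho -> 0 <= s T -> s T <= rho -> (forall t, T <= t -> 0 < x t) /\ away x.
Proof.
mark; have gam0 := gam_gt0 H; have [r1 r10 [T1 h1]] := hyperbolic_near.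
have := c0 => c0'.
(* The last entry makes the speed bound [k = c r / gam] at most [gam P], as [VV_exit] demands. *)
pose r := Num.min r1 (Num.min (P / 2) (gam ^+ 2 * P / c)).
have r0 : 0 < r by rewrite !lt_min r10 !divr_gt0 // mulr_gt0 // exprn_gt0.
have hr : hyperbolic r T1 by apply: hyperbolic_le h1; rewrite ge_min lexx.
have rP : r <= P / 2 by rewrite /r !ge_min lexx orbT.
have rg : r <= gam ^+ 2 * P / c by rewrite /r !ge_min lexx !orbT.
pose k := c * r / gam.
have k0 : 0 < k by rewrite divr_gt0 ?mulr_gt0.
have kP : k <= gam * P.
  by rewrite ler_pdivrMr // mulrC -ler_pdivlMr // (_ : _ / c = gam ^+ 2 * P / c) //; congr (_ / c); ring.
pose e := gam ^+ 2 * r * P / 2; have e0 : 0 < e by rewrite divr_gt0 // !mulr_gt0.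
have [T2 h2] := trap H P0 PE e0.
exists (Num.min (r / 2) k); first by rewrite lt_min k0 divr_gt0.
exists (Num.max T1 T2) => T x s; rewrite ge_max => /andP[TT1 TT2] S x0.
rewrite !le_min => /andP[xr _] s0 /andP[_ sk].
have xT : x T < r by lraf r0 xr.
(* An orbit that never passes [r] is nondecreasing, so [x T] already bounds it away from [0]. *)
have [hn|] := pselect (forall t, T <= t -> x t <= r).
  have mono t : T <= t -> x T <= x t.
    move=> Tt; have [] := rise hr TT1 S x0 s0 (t1 := t) _ (t := t) => //; last by rewrite Tt lexx.
    by move=> u /andP[Tu _]; exact: hn.
  by split=> [t /mono|]; [exact: lt_le_trans|exists (x T) => //; exists T].
move=> /existsNP[t2 /not_implyP[Tt2 /negP]]; rewrite -ltNge => xt2.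
have [|||t1 /andP[Tt1 t12] [xt1 below]] := @first_exit _ (fun t => x t - r) T t2.
- move=> t /andP[Tt _]; have [D _] := orbE S Tt; exact: ctn_sub (isD_cont D) (ctn_cst _ _).
- by rewrite subr_lt0.
- by exists t2; rewrite ?Tt2 ?lexx // subr_ge0 ltW.
have xt1' : x t1 = r by apply/eqP; rewrite -subr_eq0 xt1.
have xr1 t : T <= t <= t1 -> x t <= r.
  move=> /andP[Tt]; rewrite le_eqVlt => /orP[/eqP->|tt1]; first by rewrite xt1'.
  by have := below t; rewrite Tt tt1 => /(_ isT); rewrite subr_lt0 => /ltW.
have t1T : T <= t1 <= t1 by rewrite (ltW Tt1) lexx.
have [_ st1] := rise hr TT1 S x0 s0 xr1 t1T.
have kE : c * r <= gam * k by rewrite [gam * k]mulrC divfK // gt_eqF.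
have sk1 := rise_bound hr TT1 S x0 s0 xr1 sk kE t1T.
have S1 := orb_le (ltW Tt1) S.
have inV := h2 t1 x s (le_trans TT2 (ltW Tt1)) S1.
rewrite xt1' in inV; have {}inV := inV r0 (VV_exit r0 rP st1 (le_trans sk1 kP)).
split; last first.
  have h3 := trap_away H P0 e0 S1; apply: h3; exact: inV.
move=> t Tt; have [t1t|/ltW tt1] := leP t1 t; first by have [] := inV t t1t.
have [] := rise hr TT1 S x0 s0 xr1 (t := t); first by rewrite Tt.
by move=> h _; exact: lt_le_trans h.
Qed.

Lemma vanish_stable r T0 T x s : hyperbolic r T0 -> T0 <= T -> orb T x s ->
  (forall t, T <= t -> 0 < x t <= r) -> vanish x s -> forall t, T <= t -> s t + 2 * gam * x t <= 0.
Proof.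
move=> hr T0T S xr [xl sl].
have h := limP_D sl (limP_Z (2 * gam) xl); rewrite mulr0 addr0 in h.
suff mono : forall t u, T <= t -> t <= u -> s t + 2 * gam * x t <= s u + 2 * gam * x u.
  exact: bounded_sign mono h.
move=> t u Tt tu.
apply: (incrD (f := fun t => s t + 2 * gam * x t) (f' := fun t => m t (x t) * x t)) tu _ _.
  move=> z /andP[tz _]; have [D1 D2] := orbE S (le_trans Tt tz).
  by have D3 := isD_cst (2 * gam) z; isD_calc.
move=> z /andP[tz _]; have Tz := le_trans Tt tz; have /andP[x0 xz] := xr z Tz.
rewrite mulr_ge0 ?(ltW x0) //; have /andP[h3 _] : c / 2 <= m z (x z) <= 2 * c.
  by apply: hr; [exact: le_trans T0T Tz|rewrite gtr0_norm].
by apply: le_trans h3; rewrite divr_ge0 // ltW // c0.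
Qed.

(** Backward uniqueness for an orbit given only from [T] on: [K] is chosen so that
    [(x^2 + s^2) e^(K t)] is nondecreasing. *)
Lemma hyperbolic_nontrivial r T0 T x s t1 : hyperbolic r T0 -> T0 <= T -> orb T x s -> T <= t1 ->
  (forall t, T <= t <= t1 -> `|x t| <= r) -> 0 < x T -> x t1 = 0 -> s t1 = 0 -> False.
Proof.
mark; move=> hr T0T S Tt1 xr x0 x1 s1; have gam0 := gam_gt0 H; have c0' := c0.
pose K := 1 + 2 * c + 4 * gam.
have : (x T ^+ 2 + s T ^+ 2) * expR (K * T) <= (x t1 ^+ 2 + s t1 ^+ 2) * expR (K * t1).
  apply: (incrD (f := fun t => (x t ^+ 2 + s t ^+ 2) * expR (K * t))
    (f' := fun t => expR (K * t) * ((1 + m t (x t)) * (x t + s t) ^+ 2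
      + (2 * c - m t (x t)) * (x t ^+ 2 + s t ^+ 2) + 4 * gam * x t ^+ 2))) Tt1 _ _ => t /andP[Tt tt1].
    have [D1 D2] := orbE S Tt; have D3 := isD_explin K t.
    by apply: isD_eq; [isD_auto|rewrite /K /=; ring].
  have /andP[m1 m2] : c / 2 <= m t (x t) <= 2 * c.
    by apply: hr; [exact: le_trans T0T Tt|rewrite xr // Tt].
  have q1 : 0 <= 1 + m t (x t) by lraf c0' m1.
  have q2 : 0 <= 2 * c - m t (x t) by lraf m2.
  have q3 : 0 <= 4 * gam by lraf gam0.
  apply: mulr_ge0; first exact: expR_ge0.
  by apply: addr_ge0; first apply: addr_ge0; apply: mulr_ge0 => //; rewrite ?addr_ge0 ?sqr_ge0.
rewrite x1 s1 expr0n /= addr0 mul0r pmulr_lle0 ?expR_gt0 //.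
by have : 0 < x T ^+ 2; [rewrite exprn_gt0|have := sqr_ge0 (s T); lraf].
Qed.

(** The first quantity is the derivative of [y = e^(gam t) x]; the second is the speed freed from
    its damping. Both are driven by nonnegative multiples of [x]. *)
Lemma speed_mono r T0 T x s t1 : hyperbolic r T0 -> T0 <= T -> orb T x s -> T <= t1 ->
  (forall t, T <= t <= t1 -> 0 <= x t <= r) ->
  expR (gam * T) * (s T + gam * x T) <= expR (gam * t1) * (s t1 + gam * x t1) /\
  expR (2 * gam * T) * s T <= expR (2 * gam * t1) * s t1.
Proof.
mark; move=> hr T0T S Tt1 xr; have c0' := c0.
have mr t : T <= t <= t1 -> 0 <= m t (x t) /\ 0 <= x t.
  move=> ht; have /andP[x0 xt] := xr t ht; have /andP[Tt _] := ht.
  have /andP[h _] : c / 2 <= m t (x t) <= 2 * c.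
    by apply: hr; [exact: le_trans T0T Tt|rewrite ger0_norm].
  by split=> //; lraf c0' h.
split.
  apply: (incrD (f := fun t => expR (gam * t) * (s t + gam * x t))
    (f' := fun t => expR (gam * t) * ((m t (x t) + gam ^+ 2) * x t))) Tt1 _ _ => t ht.
    have /andP[Tt _] := ht; have [D1 D2] := orbE S Tt; have D3 := isD_explin gam t.
    have D4 := isD_cst gam t; by apply: isD_eq; [isD_auto|rewrite /=; ring].
  have [h x0] := mr t ht.
  by apply: mulr_ge0; [exact: expR_ge0|apply: mulr_ge0 => //; exact: addr_ge0 h (sqr_ge0 _)].
have : expR (2 * gam * T) * (s T - 0) <= expR (2 * gam * t1) * (s t1 - 0); last by rewrite !subr0.
apply: (incrD (f := fun t => expR (2 * gam * t) * (s t - 0))) Tt1 _ _ => t ht.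
  by have /andP[Tt _] := ht; exact: isD_damped S t Tt.
have [h x0] := mr t ht.
by rewrite mulr0 subr0; apply: mulr_ge0; [exact: expR_ge0|exact: mulr_ge0].
Qed.

(* [s T + gam * x T] has the sign of the derivative of [y], which is positive for small [d]. *)
Lemma near_saddle : exists2 rho, 0 < rho & exists T0, forall T x s, T0 <= T -> orb T x s ->
  0 < x T -> x T <= rho -> `|s T| <= rho ->
  ((forall t, T <= t -> 0 < x t) /\ (away x \/ vanish x s /\ s T + gam * x T <= 0)) \/
  (s T + gam * x T <= 0 /\ exists2 t1, T < t1 & [/\ forall t, T <= t < t1 -> 0 < x t, x t1 = 0,
     forall t, t1 < t -> x t < 0 & away (fun t => - x t)]).
Proof.
mark; have gam0 := gam_gt0 H.
have [r r0 [T1 hr]] := hyperbolic_near; have [re re0 [T2 hexit]] := exit_away.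
exists (Num.min r (re / 2)); first by rewrite lt_min r0 divr_gt0.
exists (Num.max T1 T2) => T x s; rewrite ge_max !le_min => /andP[T1T T2T] S x0 /andP[xr xe] /andP[_ se].
have xe' : x T <= re by lraf re0 xe.
have [s0|s0] := leP 0 (s T).
  left; have se' : s T <= re by move: se; rewrite ger0_norm //; lraf re0.
  by have [h1 h2] := hexit T x s T2T S x0 xe' s0 se'; split=> //; left.
rewrite ltr0_norm // in se.
have decr t1 : T <= t1 -> (forall t, T <= t <= t1 -> s t <= 0) -> x t1 <= x T.
  move=> Tt1 neg; rewrite -lerN2.
  apply: (incrD (f := fun t => - x t) (f' := fun t => - s t) Tt1) => t ht.
    by have /andP[Tt _] := ht; have [D1 _] := S t Tt; exact: isD_opp.
  by rewrite oppr_ge0 neg.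
(* An orbit that descends forever is settled by the dichotomy; if it vanishes, [s + 2 gam x <= 0]
   gives the sign of the speed. *)
have [hn|] := pselect (forall t, T <= t -> 0 < x t /\ s t < 0).
  have xp t : T <= t -> 0 < x t by move=> /hn[].
  left; split=> //; have [tr|v] := dichotomy H P0 PE S xp; [left|right; split=> //].
    by have h := trapped_away H P0 PE S xp tr.
  have xr' t : T <= t -> 0 < x t <= r.
    move=> Tt; rewrite xp //=; apply: le_trans (decr t Tt _) xr => u /andP[Tu _].
    by have [_ /ltW] := hn u Tu.
  have := vanish_stable hr T1T S xr' v (lexx T).
  have : 0 < gam * x T by rewrite mulr_gt0.
  by lraf.
move=> /existsNP[t2 /not_implyP[Tt2 hn]].
have cx t : T <= t -> ctn x t by move=> Tt; have [D1 _] := S t Tt; exact: isD_cont D1.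
have cs t : T <= t -> ctn s t by move=> Tt; have [_ D2] := S t Tt; exact: isD_cont D2.
(* The descent ends either with [s = 0 < x], where the orbit turns back and [exit_away] applies, or
   with [x = 0 > s], a crossing. *)
have [|||t1 /andP[Tt1 t12] [ft1 below]] := @first_exit _ (fun t => Num.max (- x t) (s t)) T t2.
- by move=> t /andP[Tt _]; have [D1 _] := S t Tt; exact: ctn_max (isD_cont (isD_opp D1)) (cs t Tt).
- by rewrite gt_max oppr_lt0 x0.
- exists t2; first by rewrite Tt2 lexx.
  rewrite leNgt gt_max oppr_lt0; apply/negP => /andP[h1 h2]; exact: hn.
have xs t : T <= t < t1 -> 0 < x t /\ s t < 0.
  by move=> /below; rewrite gt_max oppr_lt0 => /andP[].
have x1 : 0 <= x t1 by rewrite -oppr_le0 -ft1 le_max lexx.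
have s1 : s t1 <= 0 by rewrite -ft1 le_max lexx orbT.
have xs' t : T <= t <= t1 -> 0 <= x t /\ s t <= 0.
  move=> /andP[Tt]; rewrite le_eqVlt => /orP[/eqP->//|tt1].
  by have [] := xs t; [rewrite Tt|split; exact: ltW].
have xT t : T <= t <= t1 -> x t <= x T.
  move=> /andP[Tt tt1]; apply: decr Tt _ => u /andP[Tu ut].
  by have [] := xs' u; rewrite ?Tu ?(le_trans ut).
have xr' t : T <= t <= t1 -> 0 <= x t <= r.
  by move=> ht; have [-> _] := xs' t ht; exact: le_trans (xT t ht) xr.
have [v1 s1'] := speed_mono hr T1T S (ltW Tt1) xr'.
have t1t1 : T <= t1 <= t1 by rewrite (ltW Tt1) lexx.
have S1 := orb_le (ltW Tt1) S; have T2t1 := le_trans T2T (ltW Tt1).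
have [x1'|x1'] := ltP 0 (x t1).
  have s10 : s t1 = 0.
    apply/eqP; rewrite eq_le s1 /= leNgt; apply/negP => h.
    by move/eqP: ft1; rewrite eq_le => /andP[_]; rewrite leNgt gt_max oppr_lt0 x1' h.
  have [|||h1 h2] := hexit t1 x s T2t1 S1 x1'; rewrite ?s10 ?(ltW re0) //.
    exact: le_trans (xT _ t1t1) xe'.
  left; split=> [t Tt|]; last by left.
  have [/h1//|tt1] := leP t1 t.
  by have [] := xs t; rewrite ?Tt.
have x10 : x t1 = 0 by apply/eqP; rewrite eq_le x1' x1.
have s10 : s t1 < 0.
  rewrite lt_neqAle s1 andbT; apply/eqP => s10.
  apply: (hyperbolic_nontrivial hr T1T S (ltW Tt1) _ x0 x10 s10) => t ht.
  by have /andP[h1 h2] := xr' t ht; rewrite ger0_norm.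
right; split.
  rewrite leNgt; apply/negP => h; have : 0 < expR (gam * T) * (s T + gam * x T).
    by rewrite mulr_gt0 ?expR_gt0.
  move=> h'; have := lt_le_trans h' v1.
  by rewrite x10 mulr0 addr0 pmulr_rgt0 ?expR_gt0 // ltNge (ltW s10).
have st1 : - s t1 <= re / 2.
  apply: le_trans se; rewrite lerN2.
  rewrite -(ler_pM2l (expR_gt0 (2 * gam * t1))); apply: le_trans s1'.
  by rewrite ler_nM2r // ler_expR ler_pM2l ?(ltW Tt1) // mulr_gt0.
(* Shortly after the crossing the reflected orbit is positive, moves outwards and is still small, so
   [exit_away] applies to [- x]. *)
have [d1 d10 hd1] := cs t1 (ltW Tt1) (Num.min (- s t1) (re / 2)) ltac:(by rewrite lt_min oppr_gt0 s10 divr_gt0).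
have [d2 d20 hd2] := cx t1 (ltW Tt1) re re0.
pose d := Num.min d1 d2 / 2.
have d0 : 0 < d by rewrite divr_gt0 // lt_min d10.
have [dd1 dd2] : d < d1 /\ d < d2.
  by rewrite /d; have [h|h] := leP d1 d2; split; lraf d10 d20 h.
have right_ t : t1 <= t <= t1 + d -> [/\ s t < 0, - s t <= re & `|x t| <= re].
  move=> ht; have dt : `|t - t1| <= d by rewrite ger0_norm; lraf ht.
  have := hd1 t (le_lt_trans dt dd1); have := hd2 t (le_lt_trans dt dd2).
  rewrite x10 subr0 lt_min !ltr_norml => /andP[h1 h2] /andP[/andP[h3 h4] /andP[h5 h6]].
  by rewrite ler_norml; split; [lraf h4|lraf st1 h5|apply/andP; split; lraf h1 h2].
have xn t : t1 < t <= t1 + d -> x t < 0.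
  move=> /andP[t1t td]; rewrite -oppr_gt0 -oppr0 -x10.
  apply: (incrSD (f := fun t => - x t) (f' := fun t => - s t)) t1t _ _ => u /andP[t1u ut].
    by have [D1 _] := S u (le_trans (ltW Tt1) t1u); exact: isD_opp.
  by have [|h _ _] := right_ u; [rewrite t1u (le_trans ut)|rewrite oppr_gt0].
have t3 : t1 < t1 + d <= t1 + d by rewrite ltrDl d0 lexx.
have [s3 s3' x3] := right_ (t1 + d) ltac:(by rewrite lexx lerDl ltW).
have x3n := xn _ t3.
have S3 := orbN (orb_le (ltW (andP t3).1) S1).
have [|||||h1 h2] := hexit (t1 + d) _ _ _ S3; rewrite ?oppr_gt0 ?oppr_ge0 ?(ltW s3) //.
- by apply: le_trans T2t1 (ltW (andP t3).1).
- by move: x3; rewrite ltr0_norm.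
exists t1 => //; split=> // [t ht|t t1t]; first by have [] := xs t ht.
have [td|/ltW td] := leP t (t1 + d); first by rewrite xn // t1t.
by have := h1 t td; rewrite oppr_gt0.
Qed.
End Saddle.

(** * Shooting *)

Section Shooting.
Variables (R : realType) (p l0 l1 gam kap t0 FL : R) (a b b1 om om1 F F1 : R -> R).
Hypothesis H : emden_data p l0 l1 gam kap t0 FL a b b1 om om1 F F1.
Variable P : R.
Hypotheses (P0 : 0 < P) (PE : l1 ^+ 2 - gam ^+ 2 = kap * pw p P).
Implicit Types (y v x s : R -> R) (t T e r d sg : R) (k : nat).
Local Notation orb := (orb p l1 gam kap a b).
Local Notation Rsol := (Rsol p l0 a b).
Local Notation trapped := (trapped p l1 gam kap P).
Let c := l1 ^+ 2 - gam ^+ 2.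
Let V := VV p gam kap c P.
Let Vo := V00 gam P.

Definition sgn sg := sg = 1 \/ sg = -1.
(** The orbit of [sg y]: the results on positive orbits then cover both eventual signs. *)
Definition ox sg y t := expR (- gam * t) * (sg * y t).
Definition os sg y v t := expR (- gam * t) * (sg * v t - gam * (sg * y t)).

Lemma sgnE sg : sgn sg -> sg * sg = 1.
Proof. by case=> ->; rewrite ?mulr1 // mulrNN mulr1. Qed.

Lemma Rsol_orb d y v sg T : Rsol d y v -> sgn sg -> orb T (ox sg y) (os sg y v).
Proof.
move=> [D1 D2 _] E; apply: (@sol_orb _ p l1 gam kap a b T (fun t => sg * y t) (fun t => sg * v t)) => t _.
split; first by apply: isD_eq (isD_mul (isD_cst sg t) (D1 t)) _; rewrite mul0r add0r.
apply: isD_eq (isD_mul (isD_cst sg t) (D2 t)) _.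
by case: E => ->; rewrite ?mul1r ?mul0r ?add0r // !mulN1r npowN; ring.
Qed.

Lemma ox_gt0 sg y t : (0 < ox sg y t) = (0 < sg * y t).
Proof. by rewrite /ox pmulr_rgt0 ?expR_gt0. Qed.

Lemma ox_eq0 sg y t : sgn sg -> ox sg y t = 0 -> y t = 0.
Proof.
move=> /sgnE E /eqP; rewrite mulf_eq0 gt_eqF ?expR_gt0 //= => /eqP h.
by rewrite -[y t]mul1r -E -mulrA h mulr0.
Qed.

Lemma eventual_sign d y v k : Rsol d y v -> cnt y k ->
  exists sg T, [/\ sgn sg, cnt_upto y T k & forall t, T <= t -> 0 < sg * y t].
Proof.
move=> [D1 _ _] /cnt_cnt_upto[T hT]; have [hk hy] := hT T (lexx T).
have ivt t : T <= t -> 0 < y T * y t.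
  move=> Tt; rewrite ltNge; apply/negP => h.
  have [z /andP[Tz _] yz] := IVTD Tt (fun u _ => isD_cont (D1 u)) h.
  by have := hy z Tz; rewrite yz eqxx.
have [yT|yT] := ltP 0 (y T).
  exists 1, T; split=> // [|t /ivt]; first by left.
  by rewrite mul1r pmulr_rgt0.
have {}yT : y T < 0 by rewrite lt_neqAle yT hy.
exists (-1), T; split=> // [|t /ivt]; first by right.
by rewrite mulN1r nmulr_rgt0 // oppr_gt0.
Qed.

Definition slow y := exists2 sg, sgn sg & away (ox sg y).
Definition fast y := exists L, limP (fun t => expR (l1 * t) * y t) L.

Lemma away_sign x s : away x -> vanish x s -> False.
Proof.
move=> [r r0 [T h]] [/(_ r r0)[T1 h1] _].
have := h1 (Num.max T T1); have := h (Num.max T T1); rewrite !le_max !lexx orbT => /(_ isT) h2 /(_ isT).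
by rewrite subr0 ltr_norml => /andP[_]; lra.
Qed.

Lemma slow_not_vanish sg y s : sgn sg -> slow y -> vanish (ox sg y) s -> False.
Proof.
move=> E [sg' E' aw] [h _]; apply: (@away_sign _ (fun=> 0) aw); split; last exact: limP_cst.
have := limP_Z (sg' * sg) h; rewrite mulr0 => {}h; apply: (limP_ext (T := 0)) h => t _.
rewrite /ox (_ : _ * _ = expR (- gam * t) * (sg' * (sg * sg * y t))); last by ring.
by rewrite (sgnE E) mul1r.
Qed.

Lemma vanish_fast d y v sg T : Rsol d y v -> sgn sg -> (forall t, T <= t -> 0 < sg * y t) ->
  vanish (ox sg y) (os sg y v) -> fast y.
Proof.
move=> S E pos van; have xp t : T <= t -> 0 < ox sg y t by move=> /pos; rewrite ox_gt0.
have [L h] := fd_limit H P0 PE (Rsol_orb (T := T) S E) xp van.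
exists (sg * L); apply: (limP_ext (T := 0)) (limP_Z sg h) => t _.
rewrite /ox (_ : _ * _ = expR ((l1 + gam) * t) * expR (- gam * t) * (sg * sg * y t)); last by ring.
by rewrite (sgnE E) mul1r -expRD; congr (expR _ * _); ring.
Qed.

Lemma V_open (x0 s0 w : R) : V x0 s0 < w ->
  exists2 e, 0 < e & forall x s : R, `|x - x0| < e -> `|s - s0| < e -> V x s < w.
Proof.
mark; move=> Vw; have g0 := gam_gt0 H; have p0 := p_gt0 H.
pose A0 := s0 + gam * (x0 - P); pose eta := (w - V x0 s0) / 3.
have eta0 : 0 < eta by rewrite divr_gt0 // subr_gt0.
have c1 : ctn (fun z => z ^+ 2 / 2) A0.
  have D := isD_sqr (isD_id A0); exact: isD_cont (isD_mul D (isD_cst 2^-1 A0)).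
have c2 : ctn (fun z => gam ^+ 2 * (z - P) ^+ 2 / 2) x0.
  have D := isD_sqr (isD_add (isD_id x0) (isD_cst (- P) x0)).
  exact: isD_cont (isD_mul (isD_mul (isD_cst (gam ^+ 2) x0) D) (isD_cst 2^-1 x0)).
have c3 : ctn (GG p kap c) x0 by exact: isD_cont (isD_GG kap c p0 x0).
have [d1 d10 h1] := c1 eta eta0; have [d2 d20 h2] := c2 eta eta0; have [d3 d30 h3] := c3 eta eta0.
have q0 : 0 < 1 + gam by lraf g0.
pose e := Num.min (d1 / (1 + gam)) (Num.min d2 d3).
have e0 : 0 < e by rewrite !lt_min d20 d30 divr_gt0.
exists e => // x s; rewrite !lt_min => /andP[x1 /andP[x2 x3]] /andP[s1 _].
have hA : `|s + gam * (x - P) - A0| < d1.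
  rewrite (_ : _ - A0 = (s - s0) + gam * (x - x0)); last by rewrite /A0; ring.
  apply: le_lt_trans (ler_normD _ _) _; rewrite normrM (gtr0_norm g0).
  rewrite ltr_pdivlMr // in x1; rewrite ltr_pdivlMr // in s1.
  have e1 : `|s - s0| < d1 / (1 + gam) by rewrite ltr_pdivlMr.
  have e2 : gam * `|x - x0| < gam * (d1 / (1 + gam)) by rewrite ltr_pM2l // ltr_pdivlMr.
  have e3 : d1 / (1 + gam) + gam * (d1 / (1 + gam)) = d1 by field; rewrite gt_eqF.
  by lraf e1 e2 e3.
have := h1 _ hA; have := h2 _ x2; have := h3 _ x3.
rewrite !ltr_norml => /andP[_ i1] /andP[_ i2] /andP[_ i3].
have E : 3 * eta = w - V x0 s0 by rewrite /eta mulrC divfK.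
rewrite /V /VV in E *; rewrite -/A0 in E.
by lraf i1 i2 i3 E.
Qed.

Lemma ox_close d y v T e : Rsol d y v -> 0 < e -> exists2 r, 0 < r & forall d', `|d' - d| < r ->
  exists y' v', Rsol d' y' v' /\ forall sg, sgn sg ->
    `|ox sg y' T - ox sg y T| < e /\ `|os sg y' v' T - os sg y v T| < e.
Proof.
mark; move=> S e0; have g0 := gam_gt0 H; have E0 := expR_gt0 (- gam * T).
set E := expR _ in E0.
have q0 : 0 < E * (1 + gam) by rewrite mulr_gt0 //; lraf g0.
have [r r0 hr] := Rsol_close H T S (divr_gt0 e0 q0).
exists r => // d' /hr[y' [v' [S' h]]]; exists y', v'; split=> // sg Esg.
have [hy hv] := h T (lexx T).
have sg1 : `|sg| = 1 by case: Esg => ->; rewrite ?normrN normr1.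
have {}hy : E * `|y' T - y T| < e / (1 + gam).
  rewrite -ltr_pdivlMl // (_ : E^-1 * _ = e / (E * (1 + gam))) //.
  by field; rewrite !gt_eqF //; lraf g0.
have {}hv : E * `|v' T - v T| < e / (1 + gam).
  rewrite -ltr_pdivlMl // (_ : E^-1 * _ = e / (E * (1 + gam))) //.
  by field; rewrite !gt_eqF //; lraf g0.
have ee : e / (1 + gam) + gam * (e / (1 + gam)) = e by field; rewrite gt_eqF //; lraf g0.
have e1 : 0 < gam * (e / (1 + gam)) by rewrite mulr_gt0 // divr_gt0 //; lraf g0.
have gy : gam * (E * `|y' T - y T|) < gam * (e / (1 + gam)) by rewrite ltr_pM2l.
rewrite /ox /os -/E; split.
  rewrite (_ : _ - _ = E * (sg * (y' T - y T))); last by ring.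
  by rewrite !normrM sg1 mul1r (gtr0_norm E0); lraf hy ee e1.
rewrite (_ : _ - _ = E * (sg * (v' T - v T)) - gam * (E * (sg * (y' T - y T)))); last by ring.
apply: le_lt_trans (ler_normB _ _) _; rewrite !normrM sg1 !mul1r (gtr0_norm E0) (gtr0_norm g0).
by lraf hv gy ee.
Qed.

Lemma sgn_mul_gt0 sg (y1 y2 : R) : sgn sg -> 0 < sg * y1 -> 0 < y2 * y1 -> 0 < sg * y2.
Proof.
move=> E h1 h2; have := mulr_gt0 h1 h2; rewrite (_ : sg * y1 * (y2 * y1) = sg * y2 * y1 ^+ 2); last by ring.
rewrite pmulr_lgt0 // lt_neqAle sqr_ge0 andbT eq_sym sqrf_eq0.
by apply: contraTneq h1 => ->; rewrite mulr0 ltxx.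
Qed.

Lemma sgn_neq0 sg (z : R) : 0 < sg * z -> z != 0.
Proof. by apply: contraTneq => ->; rewrite mulr0 ltxx. Qed.

(** Lying in the trapping set at one late time [t] is an open condition, and it excludes zeros after
    [t]; the zeros before [t] are stable. *)
Lemma slow_open d y v k sg T : Rsol d y v -> 0 < d -> sgn sg -> cnt_upto y T k ->
  (forall t, T <= t -> 0 < sg * y t) -> trapped (ox sg y) (os sg y v) ->
  exists2 r, 0 < r & forall d', `|d' - d| < r -> exists y' v', [/\ Rsol d' y' v', cnt y' k & slow y'].
Proof.
mark; move=> S d0 E hk pos [e e0 he].
have [T1 h1] := trap H P0 PE e0; have [t] := he (Num.max T T1).
rewrite ge_max => /andP[Tt T1t] Vt; have [eta eta0 hV] := V_open Vt.
have yt := pos t Tt; have hkt : cnt_upto y t k.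
  by apply: cnt_upto_extend0 Tt hk _ => u /andP[/ltW/pos/sgn_neq0].
have [r1 r10 hr1] := cnt_upto_stable H S d0 (sgn_neq0 yt) hkt.
have [r2 r20 hr2] := ox_close t S eta0.
exists (Num.min r1 r2); first by rewrite lt_min r10.
move=> d'; rewrite lt_min => /andP[/hr1 {}hr1 /hr2[y' [v' [S' h]]]].
have [hk' yt'] := hr1 _ _ S'; have [hx hs] := h sg E.
have xt' : 0 < ox sg y' t by rewrite ox_gt0; exact: sgn_mul_gt0 yt yt'.
have O := Rsol_orb (T := t) S' E.
have tr := h1 t _ _ T1t O xt' (hV _ _ hx hs).
exists y', v'; split=> //; last first.
  by exists sg => //; have aw := trap_away H P0 e0 O tr.
apply: cnt_upto_cnt hk' _ => u /ltW/tr[]; rewrite ox_gt0 => /sgn_neq0 //.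
Qed.

(** At a late time nearby orbits are close to the saddle, where [near_saddle] allows at most one
    more zero, followed by slow decay. *)
Lemma fast_near d y v k sg T : Rsol d y v -> 0 < d -> sgn sg -> cnt_upto y T k ->
  (forall t, T <= t -> 0 < sg * y t) -> vanish (ox sg y) (os sg y v) ->
  exists2 r, 0 < r & forall d', `|d' - d| < r -> exists y' v', Rsol d' y' v' /\
    (cnt y' k \/ cnt y' k.+1 /\ slow y').
Proof.
mark; move=> S d0 E hk pos [vx vs]; have [rho rho0 [T0 hs]] := near_saddle H P0 PE.
have r2 : 0 < rho / 2 by rewrite divr_gt0.
have [T1 h1] := vx _ r2; have [T2 h2] := vs _ r2.
pose t := Num.max (Num.max T T0) (Num.max T1 T2).
have [Tt T0t] : T <= t /\ T0 <= t by rewrite /t; split; rewrite !le_max lexx ?orbT.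
have xt : `|ox sg y t| < rho / 2.
  by have := h1 t; rewrite subr0; apply; rewrite /t !le_max lexx !orbT.
have st : `|os sg y v t| < rho / 2.
  by have := h2 t; rewrite subr0; apply; rewrite /t !le_max lexx !orbT.
have yt := pos t Tt; have hkt : cnt_upto y t k.
  by apply: cnt_upto_extend0 Tt hk _ => u /andP[/ltW/pos/sgn_neq0].
have [r1 r10 hr1] := cnt_upto_stable H S d0 (sgn_neq0 yt) hkt.
have [r3 r30 hr3] := ox_close t S r2.
exists (Num.min r1 r3); first by rewrite lt_min r10.
move=> d'; rewrite lt_min => /andP[/hr1 {}hr1 /hr3[y' [v' [S' h]]]].
have [hk' yt'] := hr1 _ _ S'; have [hx hs'] := h sg E.
exists y', v'; split=> //.
have xt' : 0 < ox sg y' t by rewrite ox_gt0; exact: sgn_mul_gt0 yt yt'.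
have xr : ox sg y' t <= rho.
  have := ler_normD (ox sg y' t - ox sg y t) (ox sg y t); rewrite subrK gtr0_norm //; lraf hx xt.
have sr : `|os sg y' v' t| <= rho.
  have := ler_normD (os sg y' v' t - os sg y v t) (os sg y v t); rewrite subrK; lraf hs' st.
have [[h3 _]|[_ [t1 tt1 [q1 q2 q3 q4]]]] := hs t _ _ T0t (Rsol_orb (T := t) S' E) xt' xr sr.
  left; apply: cnt_upto_cnt hk' _ => u /ltW/h3; rewrite ox_gt0; exact: sgn_neq0.
right; have yt1 := ox_eq0 E q2.
have nz u : t1 < u -> y' u != 0.
  by move=> /q3 h4; apply: contraTneq h4 => e; rewrite /ox e !mulr0 ltxx.
split; last first.
  exists (- sg); first by case: E => ->; [right|left; rewrite opprK].
  have [r0 r00 [T3 h4]] := q4; exists r0 => //; exists T3 => u /h4.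
  by rewrite /ox [- sg * _]mulNr mulrN.
apply: cnt_upto_cnt nz; apply: (cnt_upto_extend1 hk' _ yt1); first by rewrite tt1 lexx.
move=> u /andP[tu ut1] yu; apply/eqP; apply: contraT => ne.
have : 0 < ox sg y' u by apply: q1; rewrite (ltW tu) lt_neqAle ne.
by rewrite ox_gt0 yu mulr0 ltxx.
Qed.

Lemma continuation d y v k : Rsol d y v -> 0 < d -> cnt y k ->
  (slow y /\ exists2 r, 0 < r & forall d', `|d' - d| < r ->
     exists y' v', [/\ Rsol d' y' v', cnt y' k & slow y']) \/
  [/\ fast y, ~ slow y & exists2 r, 0 < r & forall d', `|d' - d| < r ->
     exists y' v', Rsol d' y' v' /\ (cnt y' k \/ cnt y' k.+1 /\ slow y')].
Proof.
move=> S d0 /(eventual_sign S)[sg [T [E hk pos]]].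
have xp t : T <= t -> 0 < ox sg y t by move=> /pos; rewrite ox_gt0.
have [tr|van] := dichotomy H P0 PE (Rsol_orb (T := T) S E) xp.
  left; split; last exact: slow_open S d0 E hk pos tr.
  by exists sg => //; have h := trapped_away H P0 PE (Rsol_orb (T := T) S E) xp tr.
right; split; [exact: vanish_fast S E pos van| |exact: fast_near S d0 E hk pos van].
by move=> sl; exact: slow_not_vanish E sl van.
Qed.

Lemma Rsol0 : Rsol 0 (fun=> 0) (fun=> 0).
Proof.
split=> [t|t|]; first exact: isD_cst.
  by rewrite npow0 // !mulr0 subr0; exact: isD_cst.
by apply: (limN_ext (f := fun=> 0) (T := 0)) (limN_cst 0) => t _; rewrite mulr0.
Qed.

(* While [|y|] is small, [y'' = (a - b |y|^p) y] has the sign of [y]. *)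
Lemma small_pos T : t0 <= T -> exists2 e, 0 < e & forall d y v, 0 < d -> Rsol d y v ->
  (forall t, t0 <= t <= T -> `|y t| < e) -> forall t, t <= T -> 0 < y t /\ 0 < v t.
Proof.
mark; move=> t0T.
have [m m0 hm] := cont_pos_min t0T (fun t _ => a_cont H t) (fun t _ => a_gt0 H t).
have [B B0 hB] := cont_bounded (a := t0) (b := T) (fun t _ => isD_cont (b_der H t)).
have [e e0 he] := pw_small (p_gt0 H) (divr_gt0 m0 B0).
exists e => // d y v d0 S ye; have left_ := Rsol_pos_left H d0 S; have [D1 D2 _] := S.
have [y0 v0] := left_ t0 (lexx _).
have step t : t0 <= t <= T -> (forall u, t0 <= u <= t -> 0 <= y u) -> y t0 <= y t /\ v t0 <= v t.
  move=> /andP[tt tT] yp.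
  have vm u : t0 <= u <= t -> v t0 <= v u.
    move=> /andP[tu ut]; apply: (incrD tu (fun z _ => D2 z)) => z /andP[tz zu].
    have zT : t0 <= z <= T by rewrite tz (le_trans zu (le_trans ut tT)).
    have yz : 0 <= y z by apply: yp; rewrite tz (le_trans zu).
    rewrite (_ : _ - _ = (a z - b z * pw p (y z)) * y z); last by rewrite /npow; ring.
    rewrite mulr_ge0 // subr_ge0; apply: le_trans (ler_norm _) _.
    rewrite normrM (ger0_norm (pw_ge0 _ _)); apply: le_trans (hm z zT).
    rewrite -(divfK (lt0r_neq0 B0) m) mulrC; apply: ler_pM; rewrite ?pw_ge0 //.
      by apply/ltW/he/ltW/ye.
    exact: hB.
  split; last by apply: vm; rewrite tt lexx.
  apply: (incrD tt (fun z _ => D1 z)) => z /vm; exact/le_trans/ltW.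
move=> t tT; have [/left_//|/ltW t0t] := leP t t0.
have tt : t0 <= t <= T by rewrite t0t.
have [|h1 h2] := step t tt; last by split; [exact: lt_le_trans h1|exact: lt_le_trans h2].
move=> u /andP[tu ut]; rewrite -oppr_le0; apply/ltW.
apply: (@bootstrap _ (fun t => - y t) t0 t); last by rewrite tu ut.
- by move=> z _; exact: isD_cont (isD_opp (D1 z)).
- by rewrite oppr_lt0.
move=> z /andP[tz zt] hz; rewrite oppr_lt0; apply: lt_le_trans y0 _.
have [||-> _] := step z => //; first by rewrite (ltW tz) (le_trans zt).
by move=> w /hz; rewrite oppr_le0.
Qed.

(** Small solutions stay close to zero until [T], and there [0 < v T], that is [0 < s + gam x]. This
    leaves only the alternative without zeros and away from the saddle. *)
Lemma small_slow : exists2 r, 0 < r & forall d, 0 < d < r ->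
  exists y v, [/\ Rsol d y v, cnt y 0 & slow y].
Proof.
mark; have [rho rho0 [T0 hs]] := near_saddle H P0 PE.
pose T := Num.max T0 t0.
have [T0T t0T] : T0 <= T /\ t0 <= T by split; rewrite le_max lexx ?orbT.
have [e e0 he] := small_pos t0T.
have [r1 r10 hr1] := ox_close T Rsol0 rho0.
have [r2 r20 hr2] := Rsol_near H T Rsol0 e0.
exists (Num.min r1 r2); first by rewrite lt_min r10.
move=> d; rewrite lt_min => /andP[d0 /andP[d1 d2]].
have nd : `|d - 0| = d by rewrite subr0 gtr0_norm.
have [|y [v [S h]]] := hr1 d; first by rewrite nd.
have ye : forall t, t0 <= t <= T -> `|y t| < e.
  move=> t /andP[_ tT]; have [] := hr2 d y v _ S t tT; first by rewrite nd.
  by rewrite subr0.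
have pos := he d y v d0 S ye; have [yT vT] := pos T (lexx _).
have E : sgn 1 by left.
have [hx hv] := h 1 E; rewrite /ox /os !mulr0 !subr0 mulr0 subr0 -/(ox 1 y T) -/(os 1 y v T) in hx hv.
have xT : 0 < ox 1 y T by rewrite ox_gt0 mul1r.
have xr : ox 1 y T <= rho by rewrite gtr0_norm // in hx; exact: ltW.
have sT : 0 < os 1 y v T + gam * ox 1 y T.
  rewrite /os /ox (_ : _ + _ = expR (- gam * T) * v T); last by ring.
  by rewrite mulr_gt0 ?expR_gt0.
have [[h1 h2]|[]] := hs T _ _ T0T (Rsol_orb (T := T) S E) xT xr (ltW hv); last by lraf sT.
have aw : away (ox 1 y) by case: h2 => [//|[_]]; lraf sT.
exists y, v; split=> //; last by exists 1.
exists [::]; split=> // t; rewrite in_nil; apply/esym/negbTE.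
have [tT|/ltW Tt] := leP t T; first by rewrite gt_eqF // (pos t tT).1.
by have := h1 t Tt; rewrite ox_gt0 => /sgn_neq0.
Qed.

(** Few zeros bound the phase at [t0]. With [Q = e^(- l0 t) (l0 y + v)], the product [Q e^(om / l0)]
    is nondecreasing up to [t0]: the term in [b] helps, and the one in [a - l0^2] costs at most
    [om1 Q / l0]. So the bound travels back to [-oo]. *)
Lemma phase_bound k : exists M, forall d y v, 0 < d -> Rsol d y v -> ~ atleast y k ->
  d <= M /\ forall t, t <= t0 -> `|expR (- l0 * t) * y t| <= M.
Proof.
mark; have [N N0 hN] := many_zeros H k; have l00 := l0_gt0 H.
pose q := expR (- l0 * t0) * ((l0 + 1) * N) * expR (om t0 / l0).
exists (q / l0) => d y v d0 S hk; have left_ := Rsol_pos_left H d0 S.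
have [D1 D2 yl] := S; have [y0 v0] := left_ t0 (lexx _).
have yvN : y t0 + v t0 < N.
  rewrite ltNge; apply/negP => h; apply: hk; apply: hN h; [|exact: ltW|exact: ltW].
  by move=> t _; split.
pose Q t := expR (- l0 * t) * (l0 * y t + v t).
have Q0 t : t <= t0 -> expR (- l0 * t) * y t <= Q t / l0.
  move=> /left_[yt vt]; rewrite ler_pdivlMr // -mulrA ler_wpM2l ?expR_ge0 // mulrC lerDl; exact: ltW.
have Qq t : t <= t0 -> Q t <= q.
  move=> tt; apply: (@le_trans _ _ (Q t * expR (om t / l0))).
    rewrite ler_peMr //; last by rewrite -expR0 ler_expR divr_ge0 ?(om_ge0 H) ?ltW.
    have [yt vt] := left_ t tt; rewrite mulr_ge0 ?expR_ge0 // addr_ge0 ?mulr_ge0 //; exact: ltW.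
  apply: (@le_trans _ _ (Q t0 * expR (om t0 / l0))); last first.
    rewrite /q ler_wpM2r ?expR_ge0 // ler_wpM2l ?expR_ge0 // mulrDl mul1r.
    have h1 : y t0 <= N by lraf yvN v0.
    have : l0 * y t0 <= l0 * N by rewrite ler_wpM2l // ltW.
    by lraf yvN y0.
  apply: (incrD (f := fun t => Q t * expR (om t / l0)) (f' := fun t => expR (om t / l0) *
    (expR (- l0 * t) * ((a t - l0 ^+ 2) * y t - b t * npow p (y t)) + om1 t / l0 * Q t))) tt _ _.
    move=> u _; have D3 := D1 u; have D4 := D2 u; have D5 := isD_explin (- l0) u.
    have D6 := om_der H u; have D7 := isD_cst l0^-1 u; have D8 := isD_cst l0 u.
    by apply: isD_eq; [rewrite /Q; isD_auto|rewrite /Q /=; ring].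
  move=> u /andP[_ ut]; have [yu vu] := left_ u ut; apply: mulr_ge0; first exact: expR_ge0.
  have i1 : 0 <= - b u * npow p (y u).
    rewrite mulr_ge0 ?oppr_ge0 ?(b_le0 H) // /npow mulr_ge0 ?pw_ge0 //; exact: ltW.
  have i2 : 0 <= om1 u * (expR (- l0 * u) * y u) - `|a u - l0 ^+ 2| * (expR (- l0 * u) * y u).
    rewrite -mulrBl mulr_ge0 // ?subr_ge0; last by rewrite mulr_ge0 ?expR_ge0 // ltW.
    by apply: le_trans (om1_ge H u); rewrite lerDl mulr_ge0 ?expR_ge0.
  have i3 : om1 u * (expR (- l0 * u) * y u) <= om1 u / l0 * Q u.
    by rewrite -mulrA [l0^-1 * _]mulrC ler_wpM2l ?(om1_ge0 H) ?Q0.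
  have i4 : - (`|a u - l0 ^+ 2| * (expR (- l0 * u) * y u)) <= (a u - l0 ^+ 2) * (expR (- l0 * u) * y u).
    by rewrite -mulNr ler_wpM2r ?mulr_ge0 ?expR_ge0 ?(ltW yu) // lerNl -normrN ler_norm.
  have i5 : 0 <= expR (- l0 * u) * (- b u * npow p (y u)) by rewrite mulr_ge0 ?expR_ge0.
  rewrite (_ : expR _ * (_ - _) = (a u - l0 ^+ 2) * (expR (- l0 * u) * y u)
    + expR (- l0 * u) * (- b u * npow p (y u))); last by ring.
  by lraf i2 i3 i4 i5.
have zq t : t <= t0 -> expR (- l0 * t) * y t <= q / l0.
  by move=> tt; apply: le_trans (Q0 t tt) _; rewrite ler_pM2r ?invr_gt0 ?Qq.
split; first exact: limN_le yl zq.
move=> t tt; have [yt _] := left_ t tt.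
by rewrite ger0_norm ?zq // mulr_ge0 ?expR_ge0 // ltW.
Qed.

(** Stated by negation because having at least [k] zeros is an open condition. *)
Definition few k d := 0 < d /\ exists y v, Rsol d y v /\ ~ atleast y k.
Definition slow_at k d := exists y v, [/\ Rsol d y v, cnt y k & slow y].
Definition fast_at k d := exists y v, [/\ Rsol d y v, cnt y k & fast y].

Lemma cnt_few k j d y v : 0 < d -> Rsol d y v -> cnt y j -> (j < k)%N -> few k d.
Proof.
move=> d0 S hj jk; split=> //; exists y, v; split=> // /(cnt_atleast hj).
by rewrite leqNgt jk.
Qed.

(** [phase_bound] makes the bound up to [t0] uniform, so the limiting solution exists; [k] zeros of
    it would persist nearby. *)
Lemma few_closed k d : 0 < d -> (forall e, 0 < e -> exists2 d', few k d' & `|d' - d| < e) -> few k d.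
Proof.
move=> d0 h; have [M hM] := phase_bound k.
have M0 : 0 <= M.
  by have [d' [d'0 [y [v [S hk]]]] _] := h 1 ltr01; have [/(lt_le_trans d'0)/ltW] := hM d' y v d'0 S hk.
have [e e0|y [v S]] := Rsol_closed H M0 (d := d).
  have [d' [d'0 [y [v [S hk]]]] d'd] := h e e0; exists d', y, v; split=> //.
  by have [] := hM d' y v d'0 S hk.
split=> //; exists y, v; split=> // -[zs [u sz hz]].
have [T hT] := seq_bound zs.
have hb : atleast_below y T k by exists zs; split=> // t tz; rewrite hT ?hz.
have [r r0 hr] := atleast_open H S (lt0r_neq0 d0) hb.
have [d' [d'0 [y' [v' [S' hk]]]] d'd] := h r r0.
have [zs' [u' sz' hz']] := hr d' y' v' d'd S'.
by apply: hk; exists zs'; split=> // t /hz'[].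
Qed.

(** At the infimum [A] of the values [d > A0] that are not slow with [k] zeros, closedness gives at
    most [k] zeros, and [A0 < A] gives at least [k]. Were the solution slow, openness would move the
    infimum further. *)
Lemma gap k (A0 : R) : 0 <= A0 -> (exists2 r, 0 < r & forall d, A0 < d < A0 + r -> slow_at k d) ->
  (forall d, few k d -> d <= A0) ->
  exists A, [/\ A0 < A, forall d, A0 < d < A -> slow_at k d & fast_at k A].
Proof.
mark; move=> A00 [r r0 hr] hA; pose E := [set d | A0 < d /\ ~ slow_at k d].
have [M hM] := phase_bound k.+1.
have E0 : E !=set0.
  (* Beyond [M] no solution has at most [k] zeros, so such a [d] is not slow with [k] zeros. *)
  exists (Num.max M A0 + 1); split.
    by have : A0 <= Num.max M A0; [rewrite le_max lexx orbT|lraf].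
  have : M <= Num.max M A0 by rewrite le_max lexx.
  move=> hm [y [v [S hk _]]].
  have d0 : 0 < Num.max M A0 + 1.
    by have : A0 <= Num.max M A0; [rewrite le_max lexx orbT|lraf A00].
  have [_ [y' [v' [S' hk']]]] := cnt_few d0 S hk (ltnSn k).
  by have [+ _] := hM _ _ _ d0 S' hk'; lraf hm.
have lb : lbound E (A0 + r).
  by move=> d [A0d nS]; rewrite leNgt; apply/negP => dr; apply/nS/hr; rewrite A0d.
have hE : has_lbound E by exists (A0 + r).
pose A := inf E; have rA : A0 + r <= A by apply: lb_le_inf.
have A0A : A0 < A by lraf rA r0.
have SA d : A0 < d < A -> slow_at k d.
  move=> /andP[A0d dA]; apply: contrapT => nS.
  by have : A <= d; [apply: ge_inf|rewrite leNgt dA].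
exists A; split=> //.
have Apos : 0 < A by lraf A00 A0A.
have [_ [y [v [S hk]]]] : few k.+1 A.
  apply: few_closed Apos _ => e e0.
  pose d := Num.max (A - e / 2) ((A0 + A) / 2).
  have [h1 h2] : A - e / 2 <= d /\ (A0 + A) / 2 <= d by split; rewrite le_max lexx ?orbT.
  have dA : d < A by rewrite /d gt_max; apply/andP; split; lraf e0 A0A.
  have [|y [v [S hk _]]] := SA d; first by rewrite dA andbT; lraf h2 A0A.
  exists d; last by rewrite ltr0_norm; lraf h1 dA e0.
  by apply: cnt_few S hk (ltnSn k); lraf h2 A0A A00.
have [j jk hj] := not_atleast_cnt hk.
have {}hj : cnt y k.
  move: jk; rewrite ltnS leq_eqVlt => /orP[/eqP<-//|jk].
  by have := hA A (cnt_few Apos S hj jk); lraf A0A.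
exists y, v; split=> //; have [[sl [r' r'0 h]]|[]//] := continuation S Apos hj.
have : A + r' <= A; last by lraf r'0.
apply: lb_le_inf => // d [A0d nS]; rewrite leNgt; apply/negP => dr.
have Ad : A <= d by apply: ge_inf.
apply: nS; have [|y' [v' [S' hk' sl']]] := h d; first by rewrite ger0_norm; lraf Ad dr.
by exists y', v'.
Qed.

(** For [k = 0] the set [few 0] is empty and small [d] start the interval at [0]. For [k > 0] the
    supremum of [few k] belongs to it by closedness, and its continuation to the right is slow with
    exactly [k] zeros. *)
Lemma stage k : exists A0 A, [/\ 0 <= A0 < A, forall d, A0 < d < A -> slow_at k d, fast_at k A,
  forall d, few k d -> d <= A0 & k = 0%N -> A0 = 0].
Proof.
mark; have [r r0 hr] := small_slow.
have [k0|kn] := posnP k.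
  have f0 d : few k d -> d <= 0.
    by rewrite k0 => -[_ [y [v [_ []]]]]; exists [::].
  have [|A [A0 h1 h2]] := @gap k 0 (lexx _) _ f0.
    by exists r => // d; rewrite add0r k0 => /hr.
  by exists 0, A; split=> //; rewrite lexx.
have [M hM] := phase_bound k.
have fM d : few k d -> d <= M by move=> [d0 [y [v [S hk]]]]; have [] := hM d y v d0 S hk.
have fr : few k (r / 2).
  have r2 : 0 < r / 2 < r by rewrite divr_gt0 //=; lraf r0.
  by have [y [v [S h0 _]]] := hr _ r2; apply: cnt_few S h0 kn; rewrite divr_gt0.
pose E := [set d | few k d].
have E0 : E !=set0 by exists (r / 2).
have hE : has_ubound E by exists M.
pose A0 := sup E; have ub d : few k d -> d <= A0 by move=> h; apply: ub_le_sup.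
have A00 : 0 < A0 by apply: lt_le_trans (ub _ fr); rewrite divr_gt0.
have [_ [y [v [S hk]]]] : few k A0.
  apply: few_closed A00 _ => e e0; have [d fd Ad] := sup_adherent e0 (conj E0 hE).
  rewrite -/A0 in Ad; exists d => //; have := ub d fd => dA; rewrite ler0_norm; lraf Ad dA.
have [j jk hj] := not_atleast_cnt hk.
have big d y' v' i : A0 < d -> Rsol d y' v' -> cnt y' i -> (k <= i)%N.
  move=> A0d S' hi; rewrite leqNgt; apply/negP => ik.
  by have := ub d (cnt_few (lt_trans A00 A0d) S' hi ik); lraf A0d.
have right_ : exists2 r, 0 < r & forall d, A0 < d < A0 + r -> slow_at k d.
  (* Beyond [A0] solutions cannot keep [j < k] zeros. This rules out a slow solution at [A0]; near a
     fast one only [j + 1] zeros with slow decay remain, so [k = j + 1]. *)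
  have [[sl [r' r'0 h]]|[_ _ [r' r'0 h]]] := continuation S A00 hj; exists r' => // d /andP[A0d dr].
    have [|y' [v' [S' hk' _]]] := h d; first by rewrite gtr0_norm; lraf A0d dr.
    by have := big _ _ _ _ A0d S' hk'; rewrite leqNgt jk.
  have [|y' [v' [S' [hk'|[hk' sl']]]]] := h d; first by rewrite gtr0_norm; lraf A0d dr.
    by have := big _ _ _ _ A0d S' hk'; rewrite leqNgt jk.
  have ek : k = j.+1 by apply/eqP; rewrite eqn_leq jk (big _ _ _ _ A0d S' hk').
  by exists y', v'; split=> //; rewrite ek.
have [A [A0A h1 h2]] := gap (ltW A00) right_ ub.
by exists A0, A; split=> //; [rewrite (ltW A00)|move=> e; rewrite e in kn].
Qed.

(** The stages interlace because the solution at [A k] has [k] zeros, so [A k] lies in [few k.+1],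
    whose upper bound is [A0 k.+1]. *)
Lemma shooting : exists A A0 : nat -> R, [/\ A0 0%N = 0, forall k, 0 <= A0 k < A k,
  forall k, A k <= A0 k.+1, forall k d, A0 k < d < A k -> slow_at k d & forall k, fast_at k (A k)].
Proof.
have /choice[A0 /choice[A h]] := stage; exists A, A0; split=> [|k|k|k|k].
- by have [_ _ _ _] := h 0%N; exact.
- by have [] := h k.
- have [/andP[h1 h2] _ [y [v [S hk _]]] _ _] := h k; have [_ _ _ h3 _] := h k.+1.
  by apply: h3; apply: cnt_few S hk (ltnSn k); exact: le_lt_trans h2.
- by have [] := h k.
- by have [] := h k.
Qed.
End Shooting.

(** * Back to the radial equation *)

Section Limits.
Variable R : realType.
Implicit Types (f g : R -> R) (l d t r : R).

Lemma cvg_limP g l : g r @[r --> +oo] --> l -> limP (fun t => g (expR t)) l.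
Proof.
move=> /cvgrPdist_lt h e /h [M [_ hM]].
exists (ln (Num.max M 1) + 1) => t Mt; rewrite distrC; apply: hM.
apply: (@le_lt_trans _ _ (Num.max M 1)); first by rewrite le_max lexx.
have m0 : 0 < Num.max M 1 by rewrite lt_max ltr01 orbT.
by rewrite -[X in X < _](lnK m0) ltr_expR; lra.
Qed.

Lemma limP_cvg f g l : limP f l -> (forall r, 0 < r -> g r = f (ln r)) -> g r @[r --> +oo] --> l.
Proof.
move=> h gf; apply/cvgrPdist_lt => e /h[T hT].
exists (expR T); split; first exact: num_real.
move=> r Tr; have r0 : 0 < r := lt_trans (expR_gt0 T) Tr.
rewrite /= distrC gf // hT // -ler_expR lnK ?ltW //.
Qed.

Lemma cvg_limN g l : g r @[r --> 0^'+] --> l -> limN (fun t => g (expR t)) l.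
Proof.
move=> /cvgrPdist_lt h e /h /= [d d0 hd].
exists (ln d - 1) => t td; rewrite distrC; apply: hd; last exact: expR_gt0.
rewrite /= sub0r normrN gtr0_norm ?expR_gt0 // -[X in _ < X](lnK (d0 : 0 < d)) ltr_expR.
by lra.
Qed.

Lemma limN_cvg f g l : limN f l -> (forall r, 0 < r -> g r = f (ln r)) -> g r @[r --> 0^'+] --> l.
Proof.
move=> h gf; apply/cvgrPdist_lt => e /h[T hT].
exists (expR T) => /=; first exact: expR_gt0.
move=> r; rewrite /= sub0r normrN => rT r0; rewrite gtr0_norm // in rT.
by rewrite /= distrC gf // hT // -ler_expR lnK ?ltW.
Qed.

Lemma powR_expR (c t : R) : expR t `^ c = expR (c * t).
Proof. by rewrite /powR gt_eqF ?expR_gt0 // expRK. Qed.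

Lemma powR_ln (c r : R) : 0 < r -> r `^ c = expR (c * ln r).
Proof. by move=> r0; rewrite /powR gt_eqF. Qed.

(** Stated with the term behind the little-o notation and a general filter, to serve both at [0] and
    at [+oo]. *)
Lemma littleo_near (F : filter_on R) (g f u : R -> R) :
  (forall r, g r = f r + the_littleo the_tag F (Phantom _ (nbhs F)) ((fun r => g r) \- f) u r) ->
  forall e, 0 < e -> \forall r \near F, `|g r - f r| <= e * `|u r|.
Proof.
move=> h e e0.
have := littleoP (the_littleo the_tag F (Phantom _ (nbhs F)) ((fun r => g r) \- f) u) e0.
by apply: filterS => r; rewrite {1}(h r) addrAC subrr add0r.
Qed.

Lemma cvg_power (F : set_system R) (FF : ProperFilter F) (g : R -> R) (k c : R) : (\forall r \near F, 0 < r) ->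
  (forall e, 0 < e -> \forall r \near F, `|g r - k * r `^ c| <= e * `|r `^ c|) ->
  g r * r `^ (- c) @[r --> F] --> k.
Proof.
move=> pos h; apply/cvgrPdist_le => e e0.
apply: filterS2 pos (h e e0) => r r0; rewrite powR_ln // powR_ln // mulNr expRN.
have E := expR_gt0 (c * ln r); rewrite (gtr0_norm E) => hr.
rewrite distrC (_ : _ - k = (g r - k * expR (c * ln r)) / expR (c * ln r)); last by field; rewrite gt_eqF.
by rewrite normrM (gtr0_norm (_ : 0 < _^-1)) ?invr_gt0 // ler_pdivrMr.
Qed.

Lemma littleo_limP g (k c : R) : (forall r, g r = k * r `^ c +o_(r \near +oo) (r `^ c)) ->
  limP (fun t => g (expR t) * expR (- c * t)) k.
Proof.
move=> h; have pos : \forall r \near +oo, (0 : R) < r by exact: nbhs_pinfty_gt.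
have hl := cvg_limP (cvg_power proper_pinfty_nbhs pos (littleo_near h)).
by apply: (limP_ext (T := 0)) hl => t _; rewrite powR_expR.
Qed.

Lemma littleo_limN g (k c : R) : (forall r, g r = k * r `^ c +o_(r \near 0^'+) (r `^ c)) ->
  limN (fun t => g (expR t) * expR (- c * t)) k.
Proof.
move=> h; have pos : \forall r \near 0^'+, (0 : R) < r by exact: nbhs_right_gt.
have hl := cvg_limN (cvg_power (at_right_proper_filter 0) pos (littleo_near h)).
by apply: (limN_ext (T := 0)) hl => t _; rewrite powR_expR.
Qed.

Lemma primitive_integral (phi G : R -> R) (s t : R) : s < t -> (forall r, 0 < r -> ctn phi r) ->
  (forall u, isD G u (phi (expR u) * expR u)) ->
  (\int[lebesgue_measure]_(r in `[expR s, expR t]) (phi r)%:E)%E = (G t - G s)%:E.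
Proof.
move=> st cphi dG; have es := expR_gt0 s.
have dF (r : R) : 0 < r -> isD (fun r => G (ln r)) r (phi r).
  move=> r0; have := isD_comp (dG (ln r)) (is_derive1_ln r0 : isD (@ln R) r r^-1).
  by move=> h; apply: (isD_eq h); rewrite lnK // mulfK // gt_eqF.
have pos (r : R) : expR s <= r -> 0 < r by exact: lt_le_trans.
rewrite (@continuous_FTC2 _ phi (fun r => G (ln r))); first by rewrite !expRK EFinB.
- by rewrite ltr_expR.
- by apply: cont_within => r /andP[/pos r0 _]; exact: cphi.
- have cF (r : R) : 0 < r -> {for r, continuous (fun r => G (ln r))}.
    by move=> r0; apply/ctnP; exact: isD_cont (dF r r0).
  split.
  + by move=> r; rewrite in_itv /= => /andP[/ltW/pos/dF[]].
  + by apply: cvg_at_right_filter; apply: cF.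
  + by apply: cvg_at_left_filter; apply: cF; exact: expR_gt0.
- move=> r; rewrite in_itv /= => /andP[/ltW/pos r0 _]; rewrite derive1E.
  by have := dF r r0 => -[_ ->].
Qed.

Lemma integrable_bound (D : set R) (f : R -> R) : measurable D ->
  (@lebesgue_measure R).-integrable D (fun r => (f r)%:E) -> exists M : R, forall x y,
  `[x, y] `<=` D -> (\int[lebesgue_measure]_(r in `[x, y]) `|f r|%:E <= M%:E)%E.
Proof.
move=> mD fi; have /integrableP[mf _] := integrable_abse fi.
exists (fine (\int[lebesgue_measure]_(r in D) `|f r|%:E)%E) => x y xyD.
rewrite fineK; last first.
  rewrite ge0_fin_numE //; last by apply: integral_ge0 => r _; rewrite lee_fin.
  by have /integrableP[_] := fi.
exact: ge0_subset_integral.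
Qed.

Lemma ctn_div_id f (l : R) r : 0 < r -> ctn f r -> ctn (fun r => `|(f r - l) / r|) r.
Proof.
move=> r0 cf; apply/ctn_norm/ctn_mul; first exact: ctn_sub cf (ctn_cst l r).
by apply/ctnP; apply: inv_continuous; rewrite gt_eqF.
Qed.

(** Since [dr / r = dt], integrability of [(f - l) / r] bounds the increments of a primitive of
    [|f(e^t) - l|]. *)
Lemma integrable_primitive (D : set R) f (l : R) : measurable D -> (forall r, 0 < r -> ctn f r) ->
  (@lebesgue_measure R).-integrable D (fun r => ((f r - l) / r)%:E) ->
  exists G, (forall t, isD G t `|f (expR t) - l|) /\
    exists M, forall s t, s < t -> `[expR s, expR t] `<=` D -> G t - G s <= M.
Proof.
move=> mD cf fi; have [M hM] := integrable_bound mD fi.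
have [G dG] : exists G, forall t, isD G t `|f (expR t) - l|.
  apply: primitive => t; apply/ctn_norm/ctn_sub; last exact: ctn_cst.
  by apply: ctn_comp (isD_cont (isD_expR (isD_id t))); exact: cf (expR_gt0 t).
exists G; split=> //; exists M => s t st /hM.
rewrite (@primitive_integral _ G) // => [r r0|u]; first exact: ctn_div_id (cf r r0).
apply: (isD_eq (dG u)); rewrite normrM (gtr0_norm (_ : 0 < _^-1)) ?invr_gt0 ?expR_gt0 //.
by rewrite divfK // gt_eqF ?expR_gt0.
Qed.

Lemma primitive_limN g G (M : R) : (forall t, isD G t (g t)) -> (forall t, 0 <= g t) ->
  (forall t, t <= 0 -> G 0 - G t <= M) -> exists G', (forall t, isD G' t (g t)) /\ limN G' 0.
Proof.
move=> dG g0 h; have [|t t0|l [hl _]] := @limN_monotone _ G 0 (G 0 - M).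
- by move=> s t st _; apply: incrD st _ _ => u _; [exact: dG|exact: g0].
- by have := h t t0; lra.
exists (fun t => G t - l); split=> [t|].
  by apply: (isD_eq (isD_add (dG t) (isD_cst (- l) t))); rewrite addr0.
by have := limN_D hl (limN_cst (- l)); rewrite subrr.
Qed.

Lemma primitive_limP g G (M : R) : (forall t, isD G t (g t)) -> (forall t, 0 <= g t) ->
  (forall t, 0 <= t -> G t - G 0 <= M) -> exists L, limP G L.
Proof.
move=> dG g0 h; have [|t t0|l [hl _]] := @limP_monotone _ G 0 (G 0 + M); last by exists l.
- by move=> s t _ st; apply: incrD st _ _ => u _; [exact: dG|exact: g0].
- by have := h t t0; lra.
Qed.
End Limits.

(** * The hypotheses in logarithmic time *)

Section Translation.
Variables (R : realType) (n q eta beta delta0 deltaoo : R) (h K : R -> R).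
Hypotheses (hn : 2 < n) (hq : crit_exp n < q).
Hypotheses (hH : cond_H n eta beta h) (hK : cond_K delta0 deltaoo K).
Hypotheses (hlu : ((l_exp q delta0)%:E < I_exp n eta)%E).
Hypotheses (hls1 : crit_exp n < l_exp q deltaoo) (hls2 : ((l_exp q deltaoo)%:E < I_exp n beta)%E).
Implicit Types (d t r : R) (y v u : R -> R).

Let m := (n - 2) / 2.
Let p := q - 2.
Let la (e : R) := Num.sqrt ((n - 2) ^+ 2 - 4 * e) / 2.
(** The exponent for which the powers cancel: [2 - m p + deltaoo + p gam = 0], so [b e^(p gam t)]
    tends to the leading coefficient of [K] at infinity. *)
Let gam := m - (2 + deltaoo) / p.
Definition coef_a t := m ^+ 2 - h (expR t).
Definition coef_b t := K (expR t) * expR ((2 - m * p) * t).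

Lemma m_gt0 : 0 < m.
Proof. by have := hn; rewrite /m; lra. Qed.

Lemma p_pos : 0 < p.
Proof.
have n2 : 0 < n - 2 by have := hn; lra.
rewrite subr_gt0; apply: lt_trans hq; rewrite /crit_exp ltr_pdivlMr //; have := hn; lra.
Qed.

Lemma la_gt0 (e : R) : e < (n - 2) ^+ 2 / 4 -> 0 < la e.
Proof. by move=> he; rewrite divr_gt0 // sqrtr_gt0; lra. Qed.

Lemma la_sqr (e : R) : e < (n - 2) ^+ 2 / 4 -> la e ^+ 2 = m ^+ 2 - e.
Proof.
by move=> he; rewrite expr_div_n sqr_sqrtr; [rewrite /m; field|lra].
Qed.

Lemma kappaE (e : R) : kappa n e = m - la e.
Proof. by rewrite /kappa /m /la; field. Qed.

(** For [e > 0] the condition compares [2 + 2p/(2 + delta)] with [2 + 2/(m - la e)]. For [e <= 0]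
    one has [m <= la e], while the right-hand side is positive. *)
Lemma below_I (e delta : R) : e < (n - 2) ^+ 2 / 4 -> -2 < delta ->
  ((l_exp q delta)%:E < I_exp n e)%E -> m - la e < (2 + delta) / p.
Proof.
move=> he d2; have p0 := p_pos; have D0 : 0 < 2 + delta by lra.
have m0 := m_gt0; have l0 := la_gt0 he; have l2 := la_sqr he.
have rhs : 0 < (2 + delta) / p by rewrite divr_gt0.
rewrite /I_exp; case: ifPn => [e0 _|]; [|rewrite -ltNge => e0].
  suff : m <= la e by lra.
  have : m ^+ 2 <= la e ^+ 2 by rewrite l2 lerBrDr gerDl.
  by rewrite ler_pXn2r ?nnegrE //; exact: ltW.
have S2 : Num.sqrt ((n - 2) ^+ 2 - 4 * e) = 2 * la e by rewrite /la; field.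
have ml : 0 < m - la e.
  have : la e ^+ 2 < m ^+ 2 by rewrite l2 ltrBlDr ltrDl.
  by rewrite subr_gt0 ltr_pXn2r ?nnegrE //; exact: ltW.
have nE : n = 2 * m + 2 by rewrite /m; field.
rewrite S2 lte_fin /l_exp ltr_pM2l // (_ : n - 2 - _ = 2 * (m - la e)); last by rewrite {1}nE; ring.
rewrite (_ : n - _ = 2 * (m - la e) + 2); last by rewrite {1}nE; ring.
rewrite ltr_pdivrMr // mulrAC ltr_pdivlMr ?mulr_gt0 // => hl.
rewrite ltr_pdivlMr // /p.
move: hl; rewrite (_ : q = q - 2 + 2); last by ring.
by lra.
Qed.

(** The critical exponent is [2 + 2/m], so the lower bound on [l_exp q deltaoo] says
    [1/m < p/(2 + deltaoo)]. *)
Lemma gam_pos : 0 < gam.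
Proof.
have p0 := p_pos; have D0 : 0 < 2 + deltaoo by have := K_deltaoo hK; lra.
have m0 := m_gt0; rewrite subr_gt0 ltr_pdivrMr //.
have n2 : 0 < n - 2 by have := hn; lra.
move: hls1; rewrite /crit_exp /l_exp ltr_pdivrMr // -mulrA ltr_pM2l // mulrAC ltr_pdivlMr //.
by rewrite /m /p; lra.
Qed.

Lemma isD_derive1 (f : R -> R) r : derivable f r 1 -> isD f r (derive1 f r).
Proof. by move=> df; rewrite derive1E; exact: derivableP. Qed.

Lemma h_cont r : 0 < r -> ctn h r.
Proof. by move=> r0; exact: isD_cont (isD_derive1 (H_diff hH r0)). Qed.

Lemma ctn_exp (f : R -> R) t : (forall r, 0 < r -> ctn f r) -> ctn (fun t => f (expR t)) t.
Proof.
move=> cf; apply: ctn_comp (isD_cont (isD_expR (isD_id t))); exact: cf (expR_gt0 t).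
Qed.

Definition coef_b1 t := derive1 K (expR t) * expR t * expR ((2 - m * p) * t)
  + K (expR t) * ((2 - m * p) * expR ((2 - m * p) * t)).

Lemma coef_b_der t : isD coef_b t (coef_b1 t).
Proof.
have D := isD_comp (isD_derive1 (K_diff hK (expR_gt0 t))) (isD_expR (isD_id t)).
by rewrite mulr1 in D; exact: isD_mul D (isD_explin (2 - m * p) t).
Qed.

Lemma coef_a_cont t : ctn coef_a t.
Proof. by apply: ctn_sub (ctn_cst _ t) _; apply: (ctn_exp (f := h)) => r; exact: h_cont. Qed.

Let he := H_eta hH.
Let hb := H_beta hH.

Lemma coef_a_eta t : `|coef_a t - la eta ^+ 2| = `|h (expR t) - eta|.
Proof. by rewrite la_sqr // -normrN /coef_a; congr `|_|; ring. Qed.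

Lemma coef_a_beta t : `|coef_a t - la beta ^+ 2| = `|h (expR t) - beta|.
Proof. by rewrite la_sqr // -normrN /coef_a; congr `|_|; ring. Qed.

Lemma eta_primitive : exists G, (forall t, isD G t `|coef_a t - la eta ^+ 2|) /\ limN G 0.
Proof.
have [|G [dG [M hM]]] := integrable_primitive _ (fun r => @h_cont r) (H_int0 hH).
  exact: measurable_itv.
have [||t t0|G' [dG' l]] := @primitive_limN _ (fun t => `|h (expR t) - eta|) G (Num.max M 0) => //.
  have [->|t00] := eqVneq t 0; first by rewrite subrr le_max lexx orbT.
  rewrite le_max hM // ?lt_neqAle ?t00 // => r; rewrite /= !in_itv /= expR0 => /andP[h1 ->].
  by rewrite (lt_le_trans (expR_gt0 t)).
by exists G'; split=> // t; rewrite coef_a_eta.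
Qed.

Lemma beta_primitive : exists G, (forall t, isD G t `|coef_a t - la beta ^+ 2|) /\ exists L, limP G L.
Proof.
have [|G [dG [M hM]]] := integrable_primitive _ (fun r => @h_cont r) (H_intoo hH).
  exact: measurable_itv.
exists G; split; first by move=> t; rewrite coef_a_beta.
apply: (@primitive_limP _ (fun t => `|h (expR t) - beta|) G (Num.max M 0)) => // t t0.
have [->|t00] := eqVneq t 0; first by rewrite subrr le_max lexx orbT.
rewrite le_max hM // ?lt_neqAle 1?eq_sym ?t00 // => r; rewrite /= !in_itv /= expR0 andbT => /andP[h1 _].
exact: h1.
Qed.

(** Near [-oo] the integrand is at most a constant times [e^(sg t)] with
    [sg = 2 + delta0 - p (m - la eta)], which is positive by [below_I]. *)
Lemma K_primitive : exists G, (forall t, isD G t (`|coef_b t| * expR (p * la eta * t))) /\ limN G 0.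
Proof.
have [G dG] : exists G, forall t, isD G t (`|coef_b t| * expR (p * la eta * t)).
  apply: primitive => t; apply: ctn_mul (isD_cont (isD_explin _ t)).
  exact: ctn_norm (isD_cont (coef_b_der t)).
have [k0 _ /littleo_limN hk] := K_asym0 hK; have [T hT] := limN_bound hk.
pose sg := 2 + delta0 - p * (m - la eta); have p0 := p_pos.
have sg0 : 0 < sg.
  by rewrite subr_gt0 mulrC -ltr_pdivlMr //; exact: below_I he (K_delta0 hK) hlu.
pose C := `|k0| + 1.
have [l hl] : exists l, limN G l.
  apply: (@limN_dominated _ G _ (fun t => C / sg * expR (sg * t)) (fun t => C * expR (sg * t)) 0 T) => [t _|t _|t tT|].
  - exact: dG.
  - apply: (isD_eq (isD_mul (isD_cst (C / sg) t) (isD_explin sg t))).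
    by field; rewrite gt_eqF.
  - rewrite ger0_norm ?mulr_ge0 ?expR_ge0 // /coef_b.
    have -> : K (expR t) * expR ((2 - m * p) * t) =
        K (expR t) * expR (- delta0 * t) * expR ((2 - m * p + delta0) * t).
      by rewrite -mulrA -expRD; congr (_ * expR _); ring.
    have aux (A B D : R) : `|A * expR B| * expR D = `|A| * expR (B + D).
      by rewrite normrM (ger0_norm (expR_ge0 B)) -mulrA -expRD.
    rewrite aux (_ : _ + p * la eta * t = sg * t); last by rewrite /sg; ring.
    by rewrite ler_wpM2r ?expR_ge0 ?hT.
  - by have := limN_Z (C / sg) (limN_exp sg0); rewrite mulr0.
exists (fun t => G t - l); split=> [t|].
  by apply: (isD_eq (isD_add (dG t) (isD_cst (- l) t))); rewrite addr0.
by have := limN_D hl (limN_cst (- l)); rewrite subrr.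
Qed.

Lemma translated : exists kap t0 FL b1 om om1 F F1,
  emden_data p (la eta) (la beta) gam kap t0 FL coef_a coef_b b1 om om1 F F1.
Proof.
have [r0 r00 [Kn Kp]] := K_sign hK; have [koo k0 hk] := K_asymoo hK.
have [G1 [dG1 l1]] := eta_primitive; have [G2 [dG2 l2]] := K_primitive.
have [G3 [dG3 [FL l3]]] := beta_primitive.
exists koo, (ln r0), FL, coef_b1, (fun t => G1 t + G2 t),
  (fun t => `|coef_a t - la eta ^+ 2| + `|coef_b t| * expR (p * la eta * t)), G3,
  (fun t => `|coef_a t - la beta ^+ 2|).
split; try exact: coef_b_der; try exact: dG3.
- exact: p_pos.
- exact: la_gt0.
- exact: gam_pos.
- by have := below_I hb (K_deltaoo hK) hls2; rewrite /gam; lra.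
- exact: k0.
- exact: coef_a_cont.
- move=> t; rewrite /coef_a subr_gt0; have := H_lt hH (expR_gt0 t).
  by rewrite (_ : m ^+ 2 = (n - 2) ^+ 2 / 4) // /m; field.
- move=> t; have c1 := isD_cont (isD_explin (2 - m * p) t).
  have cK : ctn (fun t => K (expR t)) t.
    by apply: (ctn_exp (f := K)) => r r1; exact: isD_cont (isD_derive1 (K_diff hK r1)).
  have cK1 : ctn (fun t => derive1 K (expR t)) t.
    by apply: (ctn_exp (f := derive1 K)) => r r1; apply/ctnP; have := K_C1 hK r1.
  apply: ctn_add; first exact: ctn_mul (ctn_mul cK1 (isD_cont (isD_expR (isD_id t)))) c1.
  exact: ctn_mul cK (ctn_mul (ctn_cst _ t) c1).
- move=> t tt; rewrite /coef_b pmulr_llt0 ?expR_gt0 //; apply: Kn; first exact: expR_gt0.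
  by rewrite -[X in _ < X](lnK (r00 : r0 \is Num.pos)) ltr_expR.
- move=> t tt; rewrite /coef_b pmulr_lgt0 ?expR_gt0 //; apply: Kp.
  by rewrite -[X in X < _](lnK (r00 : r0 \is Num.pos)) ltr_expR.
- by move=> t; exact: isD_add (dG1 t) (dG2 t).
- by move=> t; exact: lexx.
- by have := limN_D l1 l2; rewrite addr0.
- have hl := limP_D (limP_cst (m ^+ 2)) (limP_Z (-1) (cvg_limP (H_limoo hH))).
  rewrite la_sqr // (_ : m ^+ 2 - beta = m ^+ 2 + -1 * beta); last by ring.
  by apply: (limP_ext (T := 0)) hl => t _; rewrite /coef_a mulN1r.
- by move=> t; exact: lexx.
- exact: l3.
- apply: (limP_ext (T := 0)) (littleo_limP hk) => t _.
  rewrite /coef_b -mulrA -expRD; congr (_ * expR _); rewrite /gam.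
  by field; rewrite gt_eqF ?p_pos.
Qed.

End Translation.

(** * The change of variables between [u] and [y] *)

Section Transfer.
Variables (R : realType) (n q eta beta : R) (h K : R -> R).
Implicit Types (d t r : R) (y v u : R -> R).
Let m := (n - 2) / 2.
Let p := q - 2.
Local Notation a := (coef_a n h).
Local Notation b := (coef_b n q K).

Definition back y r := expR (- m * ln r) * y (ln r).
Definition back1 y v r := expR (- (m + 1) * ln r) * (v (ln r) - m * y (ln r)).

Lemma isD_ln r : 0 < r -> isD (@ln R) r r^-1.
Proof. by move=> r0; have := is_derive1_ln r0. Qed.

Lemma isD_pos (f g : R -> R) r l : 0 < r -> (forall s, 0 < s -> f s = g s) -> isD f r l -> isD g r l.
Proof.
move=> r0 fg; apply: near_isD; exists r => // s; rewrite ltr_norml => /andP[s0 _].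
by apply: fg; lra.
Qed.

Lemma isD_derive1E (f : R -> R) r l : isD f r l -> derivable f r 1 /\ derive1 f r = l.
Proof. by case=> df E; split=> //; rewrite derive1E. Qed.

Lemma coef_b_exp (z t : R) : npow p (expR (- m * t) * z) * K (expR t) * expR (2 * t) * expR (m * t) =
  b t * npow p z.
Proof.
rewrite npowM /npow pw_expR -/(npow p z) /coef_b.
have e : expR (- m * t) * expR (p * (- m * t)) * expR (2 * t) * expR (m * t) = expR ((2 - m * p) * t).
  by rewrite -!expRD; congr expR; ring.
by rewrite -/m -/p -e; ring.
Qed.

Lemma expR_ln_pred r : 0 < r -> expR (- (m + 1) * ln r) = expR (- m * ln r) / r.
Proof.
move=> r0; rewrite (_ : - (m + 1) * ln r = - m * ln r - ln r); last by ring.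
by rewrite expRD expRN lnK.
Qed.

Lemma back_solution y v : (forall t, isD y t (v t)) ->
  (forall t, isD v t (a t * y t - b t * npow p (y t))) ->
  (forall r, 0 < r -> derive1 (back y) r = back1 y v r) /\
  solution_on n h (power_nonlin q K) +oo%E (back y).
Proof.
move=> D1 D2.
have dE (k r : R) : 0 < r -> isD (fun r => expR (k * ln r)) r (expR (k * ln r) * (k * r^-1)).
  move=> r0; have D := isD_comp (isD_lin k (ln r)) (isD_ln r0); exact: isD_expR D.
have d1 r : 0 < r -> isD (back y) r (back1 y v r).
  move=> r0; have D3 := dE (- m) r r0; have D4 := isD_comp (D1 (ln r)) (isD_ln r0).
  apply: isD_eq; [rewrite /back; isD_auto|rewrite /back1 expR_ln_pred //=].
  by field; rewrite gt_eqF.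
have d1' r : 0 < r -> derive1 (back y) r = back1 y v r by move=> /d1/isD_derive1E[].
split; first exact: d1'.
move=> r r0 _; have [dr _] := isD_derive1E (d1 r r0).
pose t := ln r; have rt : expR t = r by rewrite lnK.
have rn : r != 0 by rewrite gt_eqF.
have d2 : isD (derive1 (back y)) r (expR (- m * t) * (a t * y t - b t * npow p (y t) - m * v t
     - (m + 1) * (v t - m * y t)) / r ^+ 2).
  apply: (isD_pos r0 (fun s s0 => esym (d1' s s0))).
  have D3 := dE (- (m + 1)) r r0; have D4 := isD_comp (D1 (ln r)) (isD_ln r0).
  have D5 := isD_comp (D2 (ln r)) (isD_ln r0); have D6 := isD_cst m r.
  apply: isD_eq; [rewrite /back1; isD_auto|rewrite /= expR_ln_pred // -/t].
  move: (expR _) (a t * _) (b t * _) => E A B; by field.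
have [dr2 ->] := isD_derive1E d2; split; [exact: dr|exact: dr2|].
rewrite d1' // /back1 expR_ln_pred // /power_nonlin /back -/t -/p -/(pw p _) -/(npow p _).
rewrite -coef_b_exp rt (_ : expR (m * t) = (expR (- m * t))^-1); last by rewrite -expRN mulNr opprK.
rewrite (_ : expR (2 * t) = r ^+ 2); last by rewrite -rt -expRM_natl.
rewrite /coef_a rt -/m (_ : n = 2 * m + 2); last by rewrite /m; field.
have En : expR (- m * t) != 0 by rewrite gt_eqF ?expR_gt0.
set N := npow p _; set E := expR _ in En *; move: (y t) (v t) (h r) (K r) => Y V0 h0 K0.
by field; rewrite rn.
Qed.

Lemma forth_solution T u : solution_on n h (power_nonlin q K) T u ->
  let y t := expR (m * t) * u (expR t) in
  let v t := expR (m * t) * (m * u (expR t) + expR t * derive1 u (expR t)) in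
  forall t, ((expR t)%:E < T)%E -> isD y t (v t) /\ isD v t (a t * y t - b t * npow p (y t)).
Proof.
move=> S y v t tT; have [du du1 E] := S _ (expR_gt0 t) tT.
have D0 : isD (fun t => expR t) t (expR t) by have := isD_expR (isD_id t); rewrite mulr1.
have D1 := isD_comp (isD_derive1 du) D0; have D2 := isD_comp (isD_derive1 du1) D0.
have D3 := isD_explin m t; have D4 := isD_cst m t.
split; first by apply: isD_eq; [rewrite /y; isD_auto|rewrite /v /=; ring].
apply: isD_eq; first by rewrite /v; isD_auto.
have rn : expR t != 0 by rewrite gt_eqF ?expR_gt0.
have e2 : derive1 (derive1 u) (expR t) = - ((n - 1) / expR t * derive1 u (expR t)
    + h (expR t) / expR t ^+ 2 * u (expR t) + power_nonlin q K (u (expR t)) (expR t)).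
  by apply/eqP; rewrite -addr_eq0 !addrA E.
have uE : u (expR t) = expR (- m * t) * y t.
  by rewrite /y mulrA -expRD mulNr addNr expR0 mul1r.
have hb : b t * npow p (y t) = npow p (u (expR t)) * K (expR t) * expR t ^+ 2 * expR (m * t).
  by rewrite -coef_b_exp -uE -expRM_natl.
rewrite e2 hb /power_nonlin -/p -/(pw p _) -/(npow p _) /y /coef_a -/m.
rewrite (_ : n = 2 * m + 2); last by rewrite /m; field.
rewrite /=; set N := npow p _; move: (expR (m * t)) (u _) (derive1 u _) (h _) (K _) => Em U U1 h0 K0.
by field.
Qed.

End Transfer.

(** * Properties of the solutions transferred back to [r] *)

Section Main.
Variables (R : realType) (n q eta beta : R) (h K : R -> R).
Variables (kap t0 FL gam : R) (b1 om om1 F F1 : R -> R).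
Implicit Types (d t r : R) (y v u : R -> R).
Let m := (n - 2) / 2.
Let p := q - 2.
Local Notation la e := (Num.sqrt ((n - 2) ^+ 2 - 4 * e) / 2).
Local Notation a := (coef_a n h).
Local Notation b := (coef_b n q K).
Local Notation f := (power_nonlin q K).
Hypothesis H : emden_data p (la eta) (la beta) gam kap t0 FL a b b1 om om1 F F1.
Local Notation Rsol := (Rsol p (la eta) a b).

Lemma backE y r : 0 < r -> back n y r = 0 <-> y (ln r) = 0.
Proof.
move=> r0; split=> [/eqP|e]; last by rewrite /back e mulr0.
by rewrite mulf_eq0 gt_eqF ?expR_gt0 //= => /eqP.
Qed.

(** A competitor on a bounded interval is compared only up to [ln r], where the half-line uniqueness
    [lsol_uniq] applies. *)
Lemma back_the_solution d y v : Rsol d y v -> the_solution n eta h f d (back n y).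
Proof.
move=> S; have [D1 D2 yl] := S; have [_ sol] := back_solution D1 D2; split=> //.
  apply: (limN_cvg yl) => r r0; rewrite powR_ln // kappaE /back mulrAC -expRD.
  by congr (expR _ * _); ring.
move=> T u T0 su ul r r0 rT.
have rE : expR (ln r) = r by rewrite lnK.
have sub t : t <= ln r -> ((expR t)%:E < T)%E.
  by move=> tr; apply: le_lt_trans rT; rewrite lee_fin -rE ler_expR.
have L := scaled_lsol (p := p) (l0 := la eta) (a := a) (b := b) (d := d) (T := ln r)
  (fun t tr => (forth_solution su (sub t tr)).1) (fun t tr => (forth_solution su (sub t tr)).2).
have ul' : limN (fun t => expR (- la eta * t) * (expR (m * t) * u (expR t))) d.
  apply: (limN_ext (T := 0)) (cvg_limN ul) => t _; rewrite powR_expR kappaE mulrC mulrA -expRD.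
  by congr (expR _ * _); rewrite /m; ring.
have [+ _] := lsol_uniq H (L ul') (Rsol_lsol S (ln r)) (lexx _).
move/(mulfI (negbT (gt_eqF (expR_gt0 _)))); rewrite rE => e.
by rewrite /back -e mulrA -expRD mulNr addNr expR0 mul1r.
Qed.

Lemma back_solution_on d y v : Rsol d y v -> solution_on n h f +oo%E (back n y).
Proof. by move=> S; have [] := back_the_solution S. Qed.

Lemma back_R_solution d y v : Rsol d y v -> R_solution n eta (back n y).
Proof. by move=> S; exists d; have [] := back_the_solution S. Qed.

Lemma back_zeros d y v k : Rsol d y v -> d != 0 -> cnt y k -> nondeg_zeros k (back n y).
Proof.
move=> S d0 [zs [u sz hz]]; have [D1 D2 _] := S; have [d1 _] := back_solution D1 D2; split; last first.
  move=> r r0 /(backE y r0) yr; rewrite d1 // /back1 yr mulr0 subr0; apply: mulf_neq0; first by rewrite gt_eqF ?expR_gt0.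
  by have := Rsol_nontrivial H S d0 yr.
rewrite card_eq_sym; apply/card_set_bijP; exists (fun i => expR (nth 0 zs i)); split.
- move=> i /= ik; split; first exact: expR_gt0.
  by apply/backE; rewrite ?expR_gt0 // expRK; apply/eqP; rewrite -hz mem_nth ?sz.
- move=> i j; rewrite !inE /= => ik jk /expR_inj/eqP.
  by rewrite nth_uniq ?sz // => /eqP.
- move=> r /= [r0 /(backE y r0)/eqP]; rewrite -hz => hr.
  by exists (index (ln r) zs); rewrite /= ?nth_index ?lnK // -sz index_mem.
Qed.

Lemma back_decay y r : 0 < r -> back n y r * r `^ (n - 2 - kappa n beta) = expR (la beta * ln r) * y (ln r).
Proof.
move=> r0; rewrite powR_ln // kappaE /back mulrAC -expRD; congr (expR _ * _).
by field.
Qed.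

Lemma back_fast y : fast (la beta) y -> fast_decay n beta (back n y).
Proof. by move=> [L hL]; exists L; apply: (limP_cvg hL) => r; exact: back_decay. Qed.

(** The weighted solution is [e^((l1 + gam) t)] times the orbit [e^(- gam t) y], which up to sign
    stays above a positive constant; the eventual sign selects the infinite limit. *)
Lemma back_slow y : slow gam y -> slow_decay n beta (back n y).
Proof.
move=> [sg E [r r0 [T hT]]]; have l0 : 0 < la beta + gam.
  by have := gam_gt0 H; have := gam_lt H; lra.
have big (M : R) : exists T', forall t, T' <= t -> M <= expR (la beta * t) * (sg * y t).
  pose T1 := Num.max T (ln (Num.max (M / r) 1) / (la beta + gam)).
  exists T1 => t; rewrite ge_max => /andP[Tt]; rewrite ler_pdivrMr // => Mt.
  have M0 : 0 < Num.max (M / r) 1 by rewrite lt_max ltr01 orbT.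
  have hM : M / r <= expR ((la beta + gam) * t).
    apply: (@le_trans _ _ (Num.max (M / r) 1)); first by rewrite le_max lexx.
    by rewrite -[X in X <= _](lnK M0) ler_expR [X in _ <= X]mulrC.
  rewrite (_ : _ * (sg * _) = expR ((la beta + gam) * t) * ox gam sg y t).
    apply: (@le_trans _ _ (expR ((la beta + gam) * t) * r)); first by rewrite -ler_pdivrMr.
    by rewrite ler_wpM2l ?expR_ge0 ?hT.
  by rewrite /ox [in RHS]mulrA -expRD; congr (expR _ * _); ring.
case: E big => -> big; [left; apply/cvgryPge|right; apply/cvgrNyPle] => M.
  have [T' h'] := big M; exists (expR T'); split; first exact: num_real.
  move=> s Ts; have s0 := lt_trans (expR_gt0 T') Ts.
  rewrite /= back_decay //; have := h' (ln s); rewrite mul1r; apply.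
  by rewrite -ler_expR lnK // ltW.
have [T' h'] := big (- M); exists (expR T'); split; first exact: num_real.
move=> s Ts; have s0 := lt_trans (expR_gt0 T') Ts.
rewrite /= back_decay //; have := h' (ln s); rewrite mulN1r mulrN lerN2; apply.
by rewrite -ler_expR lnK // ltW.
Qed.

End Main.

Theorem corollary1p2 (R : realType) (n q eta beta delta0 deltaoo : R)
  (h K : R -> R)
  (hn : 2 < n) (hq : crit_exp n < q)
  (hH : cond_H n eta beta h) (hK : cond_K delta0 deltaoo K)
  (hlu1 : sub_exp n eta < l_exp q delta0)
  (hlu2 : ((l_exp q delta0)%:E < I_exp n eta)%E)
  (hls1 : crit_exp n < l_exp q deltaoo)
  (hls2 : ((l_exp q deltaoo)%:E < I_exp n beta)%E) :
  let f := power_nonlin q K in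
  exists A : nat -> R,
    [/\ forall k, 0 < A k,
        forall k, A k < A k.+1,
        forall k, exists2 u : R -> R, the_solution n eta h f (A k) u &
          Rkf_solution n eta beta h f k u,
        forall d : R, 0 < d -> d < A 0%N ->
          exists2 u : R -> R, the_solution n eta h f d u &
            Rks_solution n eta beta h f 0%N u
      & forall k, (1 <= k)%N ->
          exists2 As : R, A k.-1 <= As < A k &
            forall d : R, As < d -> d < A k ->
              exists2 u : R -> R, the_solution n eta h f d u &
                Rks_solution n eta beta h f k u].
Proof.
move=> f; have [kap [t0 [FL [b1 [om [om1 [F [F1 H]]]]]]]] := translated hn hq hH hK hlu2 hls1 hls2.
have gam0 := gam_gt0 H; have gl := gam_lt H; have kap0 := kap_gt0 H.
have c0 : 0 < (Num.sqrt ((n - 2) ^+ 2 - 4 * beta) / 2) ^+ 2 - ((n - 2) / 2 - (2 + deltaoo) / (q - 2)) ^+ 2.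
  by rewrite subr_gt0 ltr_pXn2r // nnegrE ltW // (lt_trans gam0 gl).
(* The positive equilibrium of the limit equation; it exists because [gam < l1]. *)
have [P P0 PE] := pw_root (p_gt0 H) (divr_gt0 c0 kap0).
have [|A [A0 [A00 A0A AA slowA fastA]]] := shooting H P0.
  by rewrite PE [kap * _]mulrC divfK // gt_eqF.
have Rks k d : 0 < d -> slow_at (q - 2) (Num.sqrt ((n - 2) ^+ 2 - 4 * eta) / 2)
    ((n - 2) / 2 - (2 + deltaoo) / (q - 2)) (coef_a n h) (coef_b n q K) k d ->
    exists2 u, the_solution n eta h f d u & Rks_solution n eta beta h f k u.
  move=> d0 [y [v [S hk sl]]]; exists (back n y); first exact: back_the_solution H _ _ _ S.
  split; [exact: back_solution_on H _ _ _ S|exact: back_R_solution H _ _ _ S|exact: back_slow H _ sl|].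
  by apply: back_zeros H _ _ _ _ S _ hk; rewrite gt_eqF.
have Apos k : 0 < A k by have /andP[h1 h2] := A0A k; exact: le_lt_trans h2.
exists A; split=> //.
- by move=> k; have /andP[_ h2] := A0A k.+1; exact: le_lt_trans (AA k) h2.
- move=> k; have [y [v [S hk fs]]] := fastA k; exists (back n y); first exact: back_the_solution H _ _ _ S.
  split; [exact: back_solution_on H _ _ _ S|exact: back_R_solution H _ _ _ S|exact: back_fast fs|].
  by apply: back_zeros H _ _ _ _ S _ hk; rewrite gt_eqF.
- by move=> d d0 dA; apply: (Rks 0%N d d0); apply: slowA; rewrite A00 d0.
(* The left end of stage [k.+1] serves as [A_k^*] for that index. *)
case=> // k _; exists (A0 k.+1); first by rewrite AA; have /andP[_ ->] := A0A k.+1.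
move=> d h1 h2; apply: (Rks k.+1 d); last by apply: slowA; rewrite h1.
by apply: le_lt_trans h1; have /andP[] := A0A k.+1.
Qed.
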